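(* Let $\nu>0$ be an integer. There is a constant $C>0$, depending only on $\nu$, such that for every centered random variable $F$ admitting a finite chaos expansion with $\mathbb{E}[F^2]=2\nu$, and with $G(\nu)\sim CenteredGamma(\nu)$, $$d_{Kol}(F,G(\nu))\le\begin{cases}C\,\operatorname{Var}(\Gamma_1(F)-2F)^{1/4},&\text{if }\nu\ge2,\\ C\,\operatorname{Var}(\Gamma_1(F)-2F)^{1/6},&\text{if }\nu=1.\end{cases}$$
   Context: $d_{Kol}(X,Y)=\sup_{x\in\mathbb{R}}|P(X\le x)-P(Y\le x)|$ is the Kolmogorov distance. $F$ admits a finite chaos expansion if $F=\sum_{q=0}^m I_q(f_q)$ for some finite $m$, where $I_q$ is the $q$-th multiple Wiener–Itô integral with respect to an isonormal Gaussian process over a real separable Hilbert space $\mathfrak{H}$ and $f_q\in\mathfrak{H}^{\odot q}$. $\Gamma_1(F)=\langle DF,-DL^{-1}F\rangle_{\mathfrak{H}}$, where $D$ is the Malliavin derivative and $L^{-1}F=-\sum_{p\ge1}\frac1pI_p(f_p)$. $CenteredGamma(\nu)$ is the law of $2\widehat{G}(\nu/2)-\nu$, with $\widehat{G}(\nu/2)$ having density $x^{\nu/2-1}e^{-x}\Gamma(\nu/2)^{-1}\mathbf{1}_{(0,\infty)}(x)$. *)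

(* Defs.v *)
From HB Require Import structures.
From mathcomp Require Import all_boot all_order perm all_algebra.
From mathcomp Require Import all_classical all_reals all_analysis.

Set Implicit Arguments.
Unset Strict Implicit.
Unset Printing Implicit Defensive.

Import Order.TTheory GRing.Theory Num.Theory.
Import numFieldNormedType.Exports.

Local Open Scope classical_set_scope.
Local Open Scope ring_scope.

Section hilbert.
Context {R : realType} {H : completeNormedModType R}.
Variable dot : {dot H for idfun}.

Definition separable_hilbert : Prop :=
  (forall x : H, `|x| ^+ 2 = dot x x) /\
  exists2 S : set H, countable S & dense S.

Definition orthonormal_family (n : nat) (e : 'I_n -> H) : Prop :=
  forall i j, dot (e i) (e j) = (i == j)%:R.

(* The Hilbert tensor power of order q of H is realised as the space of
   Hilbert-Schmidt q-linear forms on H: h_1 (x) ... (x) h_q is the form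
   x |-> \prod_i <h_i, x_i>, and the squared tensor norm of a form f is the sum
   of f (e_(s 1), ..., e_(s q)) ^ 2 over the multi-indices s, for any
   orthonormal basis e.  The supremum over finite orthonormal families below
   equals that sum. *)
Definition tensor_norm2 (q : nat) (f : ('I_q -> H) -> R) : \bar R :=
  ereal_sup [set y | exists (n : nat) (e : 'I_n -> H),
    orthonormal_family e /\
    y = (\sum_(s : {ffun 'I_q -> 'I_n}) f (fun k => e (s k)) ^+ 2)%:E].

Definition multilinear_form (q : nat) (f : ('I_q -> H) -> R) : Prop :=
  forall (x : 'I_q -> H) (i : 'I_q) (a : R) (u v : H),
    f (dfwith x i (a *: u + v)) = a * f (dfwith x i u) + f (dfwith x i v).

Definition symmetric_tensor (q : nat) (f : ('I_q -> H) -> R) : Prop :=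
  [/\ multilinear_form f,
      (forall (s : 'S_q) (x : 'I_q -> H), f (fun k => x (s k)) = f x) &
      (tensor_norm2 f < +oo)%E].

Definition power_tensor (q : nat) (h : H) : ('I_q -> H) -> R :=
  fun x => \prod_i dot h (x i).

End hilbert.

(* Probabilists' Hermite polynomials: 1, X, X^2 - 1, X^3 - 3 X, ... *)
Definition hermite (R : realType) (q : nat) : {poly R} :=
  iter q (fun p => 'X * p - p^`()) 1.

Definition iter_partial (R : realType) (k : nat) (g : 'rV[R]_k -> R)
    (s : seq 'I_k) : 'rV[R]_k -> R :=
  foldr (fun i f x => 'D_(delta_mx 0 i) f x) g s.

(* C^oo, with all partial derivatives (including g itself) of at most
   polynomial growth. *)
Definition smooth_poly_growth (R : realType) (k : nat)
    (g : 'rV[R]_k -> R) : Prop :=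
  forall s : seq 'I_k,
    [/\ (forall x i, derivable (iter_partial g s) x (delta_mx 0 i)),
        continuous (iter_partial g s) &
        exists (c : R) (n : nat),
          forall x, `|iter_partial g s x| <= c * (1 + `|x|) ^+ n].

Record cylinder (R : realType) (H : completeNormedModType R) := Cylinder {
  cyl_dim : nat;
  cyl_fun : 'rV[R]_cyl_dim -> R;
  cyl_vec : 'I_cyl_dim -> H;
  cyl_smooth : smooth_poly_growth cyl_fun }.
Arguments cyl_fun {R H} c x.
Arguments cyl_vec {R H} c i.

(* normal_prob is parametrised by the standard deviation, and is not the Dirac
   mass when the latter is 0. *)
Definition centered_gaussian (R : realType) (s : R) (A : set R) : \bar R :=
  if s == 0 then \d_(0 : R) A else normal_prob 0 s A.

Section wiener.
Context {R : realType} {H : completeNormedModType R}.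
Variable dot : {dot H for idfun}.
Context {d : measure_display} {T : measurableType d} {P : probability T R}.
Variable X : H -> {RV P >-> R}.

Definition isonormal : Prop :=
  (forall (n : nat) (h : 'I_n -> H) (a : 'I_n -> R),
     exists2 s : R, 0 <= s & forall A : set R, measurable A ->
       P ((fun w => \sum_i a i * X (h i) w) @^-1` A) = centered_gaussian s A)
  /\ (forall g h : H, ('E_P[fun w => (X g w * X h w)%R] = (dot g h)%:E)%E).

(* Y is a version of I_q(f): I_q is the continuous linear extension of
   I_q(h^(x)q) = H_q(X(h)), |h| = 1.  For q = 0 the unit-norm condition is
   void, so that I_0(c) = c even when H is trivial. *)
Definition wiener_ito (q : nat) (f : ('I_q -> H) -> R)
    (Y : {RV P >-> R}) : Prop :=
  exists c : nat -> seq (R * H),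
  [/\ (forall n k, k \in c n -> q = 0%N \/ `|k.2| = 1),
      (tensor_norm2 dot (fun x =>
         f x - \sum_(k <- c n) k.1 * power_tensor dot k.2 x)
       @[n --> \oo] --> 0%E) &
      ('E_P[fun w =>
         ((Y w - \sum_(k <- c n) k.1 * (hermite R q).[X k.2 w]) ^+ 2)%R]%E
       @[n --> \oo] --> 0%E)].

(* F = \sum_(q <= m) I_q(f_q), J q being a version of I_q(f_q). *)
Definition chaos_expansion (m : nat) (f : forall q : nat, ('I_q -> H) -> R)
    (J : nat -> {RV P >-> R}) (F : {RV P >-> R}) : Prop :=
  (forall q : nat, (q <= m)%N ->
     symmetric_tensor dot (f q) /\ wiener_ito (f q) (J q)) /\
  {ae P, forall w, F w = \sum_(q < m.+1) J q w}.

Definition finite_chaos_expansion (F : {RV P >-> R}) : Prop :=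
  exists m f J, chaos_expansion m f J F.

(* V is a version of L^-1 F. *)
Definition pseudo_inverse_L (F V : {RV P >-> R}) : Prop :=
  exists m f J, chaos_expansion m f J F /\
    {ae P, forall w, V w = - \sum_(1 <= p < m.+1) p%:R^-1 * J p w}.

Definition cyl_rv (S : cylinder H) (w : T) : R :=
  cyl_fun S (\row_i X (cyl_vec S i) w).

Definition cyl_grad (S : cylinder H) (w : T) : H :=
  \sum_i ('D_(delta_mx 0 i) (cyl_fun S) (\row_j X (cyl_vec S j) w))
         *: cyl_vec S i.

(* F is in the domain D^{1,2} of the closure of the gradient of smooth
   cylindrical random variables, and U is a version of DF; measurability of the
   H-valued U is expressed weakly, H being separable. *)
Definition malliavin_derivative (F : {RV P >-> R}) (U : T -> H) : Prop :=
  (forall h : H, measurable_fun setT (fun w => dot (U w) h)) /\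
  exists S : nat -> cylinder H,
    ('E_P[fun w => ((F w - cyl_rv (S n) w) ^+ 2)%R]%E @[n --> \oo] --> 0%E) /\
    ('E_P[fun w => (`|U w - cyl_grad (S n) w| ^+ 2)%R]%E @[n --> \oo] --> 0%E).

(* G is a version of Gamma_1(F) = <DF, -DL^-1 F>. *)
Definition Gamma1 (F G : {RV P >-> R}) : Prop :=
  exists (V : {RV P >-> R}) (DF DV : T -> H),
  [/\ pseudo_inverse_L F V, malliavin_derivative F DF,
      malliavin_derivative V DV &
      {ae P, forall w, G w = dot (DF w) (- DV w)}].

End wiener.

Definition kolmogorov_dist (R : realType)
    (d1 d2 : measure_display) (T1 : measurableType d1) (T2 : measurableType d2)
    (P1 : probability T1 R) (P2 : probability T2 R)
    (X1 : {RV P1 >-> R}) (X2 : {RV P2 >-> R}) : \bar R :=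
  ereal_sup [set `|cdf X1 x - cdf X2 x|%E | x in [set: R]].

Definition Gamma_fun (R : realType) (a : R) : R :=
  \int[lebesgue_measure]_(x in `]0, +oo[) (x `^ (a - 1) * expR (- x)).

Definition gamma_pdf (R : realType) (a x : R) : R :=
  x `^ (a - 1) * expR (- x) * (Gamma_fun a)^-1 * \1_(`]0, +oo[) x.

Definition gamma_law (R : realType) (a : R) (A : set R) : \bar R :=
  (\int[lebesgue_measure]_(x in A) (gamma_pdf a x)%:E)%E.

(* The image of gamma_law (nu / 2) under x |-> 2 x - nu. *)
Definition centered_gamma (R : realType) (nu : R) (A : set R) : \bar R :=
  gamma_law (nu / 2) ((fun x => 2 * x - nu) @^-1` A).

(* Main.v *)
(** Let [nu] be the parameter and [Y = F + nu].  For a smoothed indicator [h] of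
    []-oo, a]] at scale [eps], Stein's equation
    [2 y f'(y) - (y - nu) f(y) = h(y) - E h(G + nu)] has a C^2 solution on the
    whole line with [f''] bounded and [|f'| <= K / eps].  The Malliavin
    integration by parts [E (F g(F)) = E (g'(F) Gamma_1(F))], applied to
    [g(x) = f(x + nu)] and to [g(x) = x], then gives
    [|E h(F + nu) - E h(G + nu)| <= (K / eps) Var(Gamma_1(F) - 2 F)^(1/2)].
    The distribution function of [G] is Lipschitz for [nu >= 2] and Hoelder of
    exponent 1/2 for [nu = 1]; optimizing in [eps] yields the exponents 1/4, 1/6.

    The integration by parts is first proved for cylindrical functionals and
    [H_p(X h)] in place of [F], then passed to the limit along the L^2
    approximations that define chaoses and Malliavin derivatives.  For
    cylindrical functionals it reduces to the Gaussian formula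
    [E (X(h) phi) = E <D phi, h>].  As only the laws of linear combinations of
    the [X h] are given, that formula is proved first for the sine and cosine of
    such a combination: if [<u, v> = 0] then [A + tB] and [A - tB] have the same
    law ([A = X u], [B = X v]), so [E (sin A sin tB) = 0] and, as [t -> 0],
    [E (B sin A) = 0].
    Bernstein polynomials in [sin (x_i / L)], [L -> oo], then reach every C^1
    function of polynomial growth. *)
Require Import Defs.
From HB Require Import structures.
From mathcomp Require Import all_boot all_order all_algebra.
From mathcomp Require Import all_classical all_reals all_analysis measurable_realfun.
From mathcomp Require Import ring lra.
Import Order.TTheory GRing.Theory Num.Theory.
Import numFieldNormedType.Exports.
Local Open Scope classical_set_scope.
Local Open Scope ring_scope.
Set Implicit Arguments.
Unset Strict Implicit.
Unset Printing Implicit Defensive.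

(** * Expectations of real functions *)

(** Malliavin derivatives and chaoses are known only as L^2 limits, so every limit is taken inside a
    pairing with one fixed variable having all moments. That variable is the divergence [N] of the
    gradient of [g(S)], with [S] cylindrical: the identity [E (H_p(X h) N) = p E (H_p(X h) g(S))]
    plays the part of [- L], and its factor [p] cancels the [1/p] of [L^-1]. As [N] involves [g''],
    the test function needs two derivatives, although only the bound on the first one enters the
    estimate. The other obstacle is that [F + nu] may charge the negative half-line, where the Gamma
    law gives no control. An integral over [[0, 1]] represents Stein's solution with bounds uniform
    on [y <= nu + 1]; beyond that point the Gamma tail bounds the solution, and the equation itself
    then bounds its derivatives. With [s = Var^(1/2)] the error is of order [eps + s / eps] for
    [nu >= 2], balanced at [eps = s^(1/2)], and [eps^(1/2) + s / eps] for [nu = 1], balanced at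
    [eps = s^(2/3)]. *)

Section real_expectation.
Context {R : realType} {d : measure_display} {T : measurableType d}.
Variable P : probability T R.
Implicit Types (f g : T -> R) (r : R).

Definition intg f := P.-integrable setT (EFin \o f).
Definition Ex f : R := \int[P]_w f w.

Lemma intg_meas f : intg f -> measurable_fun setT f.
Proof. by move=> /integrableP[/measurable_EFinP]. Qed.

Lemma intg_cst r : intg (fun=> r).
Proof. exact: finite_measure_integrable_cst. Qed.

Lemma intgD f g : intg f -> intg g -> intg (fun w => f w + g w).
Proof. by move=> fi gi; apply: (integrableD measurableT fi gi). Qed.

Lemma intgZ r f : intg f -> intg (fun w => r * f w).
Proof. by move=> fi; apply: (integrableZl measurableT r fi). Qed.

Lemma intgN f : intg f -> intg (fun w => - f w).
Proof.
by move=> /(intgZ (-1)); congr intg; apply/funext => w; rewrite mulN1r.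
Qed.

Lemma intgB f g : intg f -> intg g -> intg (fun w => f w - g w).
Proof. by move=> fi gi; apply: intgD => //; exact: intgN. Qed.

Lemma intg_sum (I : Type) (s : seq I) (f : I -> T -> R) :
  (forall i, intg (f i)) -> intg (fun w => \sum_(i <- s) f i w).
Proof.
move=> fi; elim: s => [|a s IH].
  by under eq_fun do rewrite big_nil; exact: intg_cst.
by under eq_fun do rewrite big_cons; exact: intgD.
Qed.

Lemma intg_dom f g : measurable_fun setT f -> (forall w, `|f w| <= g w) ->
  intg g -> intg f.
Proof.
move=> mf fg; apply: le_integrable => //; first exact/measurable_EFinP.
by move=> w _; rewrite /= lee_fin (le_trans (fg w))// ler_norm.
Qed.

Lemma intg_abs f : intg f -> intg (fun w => `|f w|).
Proof. by move=> /integrable_abse; congr (_.-integrable _ _). Qed.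

Lemma ExD f g : intg f -> intg g -> Ex (fun w => f w + g w) = Ex f + Ex g.
Proof. exact: RintegralD. Qed.

Lemma ExB f g : intg f -> intg g -> Ex (fun w => f w - g w) = Ex f - Ex g.
Proof. exact: RintegralB. Qed.

Lemma ExZ r f : intg f -> Ex (fun w => r * f w) = r * Ex f.
Proof. exact: RintegralZl. Qed.

Lemma ExN f : intg f -> Ex (fun w => - f w) = - Ex f.
Proof.
by move=> fi; under [LHS]eq_Rintegral do rewrite -mulN1r; rewrite [LHS]ExZ// mulN1r.
Qed.

Lemma Ex_cst r : Ex (fun=> r) = r.
Proof. by rewrite /Ex Rintegral_cst// [X in fine X]probability_setT mulr1. Qed.

Lemma Ex_sum (I : Type) (s : seq I) (f : I -> T -> R) :
  (forall i, intg (f i)) ->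
  Ex (fun w => \sum_(i <- s) f i w) = \sum_(i <- s) Ex (f i).
Proof.
move=> fi; elim: s => [|a s IH].
  by under [LHS]eq_Rintegral do rewrite big_nil; rewrite big_nil [LHS]Ex_cst.
under [LHS]eq_Rintegral do rewrite big_cons.
by rewrite [LHS]ExD// ?IH ?big_cons//; exact: intg_sum.
Qed.

Lemma Ex_ge0 f : (forall w, 0 <= f w) -> 0 <= Ex f.
Proof. by move=> f0; apply: Rintegral_ge0. Qed.

Lemma Ex_le f g : intg f -> intg g -> (forall w, f w <= g w) -> Ex f <= Ex g.
Proof. by move=> fi gi fg; apply: le_Rintegral. Qed.

Lemma Ex_abs f : intg f -> `|Ex f| <= Ex (fun w => `|f w|).
Proof. exact: le_normr_Rintegral. Qed.

Lemma eq_Ex f g : f =1 g -> Ex f = Ex g.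
Proof. by move=> fg; congr Ex; apply/funext. Qed.

Lemma eq_intg f g : f =1 g -> intg f -> intg g.
Proof. by move=> /funext ->. Qed.

Lemma ae_eq_Ex f g : measurable_fun setT f -> measurable_fun setT g ->
  {ae P, forall w, f w = g w} -> Ex f = Ex g.
Proof.
move=> mf mg fg; rewrite /Ex /Rintegral; congr fine.
apply: ae_eq_integral => //; try exact/measurable_EFinP.
by apply: filterS fg => w /= ->.
Qed.

Lemma Ex_dct (f_ : nat -> T -> R) f g : (forall n, measurable_fun setT (f_ n)) ->
  (forall w, f_ n w @[n --> \oo] --> f w) -> (forall n w, `|f_ n w| <= g w) ->
  intg g -> intg f /\ Ex (f_ n) @[n --> \oo] --> Ex f.
Proof.
move=> mf ff fg gi.
have := @dominated_convergence _ T R P setT measurableT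
  (fun n => EFin \o f_ n) (EFin \o f) (EFin \o g).
have mf' : measurable_fun setT f.
  by apply: (@measurable_fun_cvg _ _ _ _ f_ f) => // w _; exact: ff.
case.
- by move=> n; exact/measurable_EFinP.
- exact/measurable_EFinP.
- by apply/aeW => w _ /=; apply: cvg_EFin; [near=> n|exact: ff].
- exact: gi.
- by apply/aeW => w n _ /=; rewrite lee_fin.
move=> fi _ c; split => //.
by apply: fine_cvg; rewrite fineK//; exact: integrable_fin_num.
Unshelve. all: by end_near. Qed.

Definition L2 f := measurable_fun setT f /\ intg (fun w => f w ^+ 2).

Lemma L2_mul f g : L2 f -> L2 g -> intg (fun w => f w * g w).
Proof.
move=> [mf fi] [mg gi].
apply: (@intg_dom _ (fun w => f w ^+ 2 + g w ^+ 2)).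
- exact: measurable_funM.
- by move=> w; rewrite ler_norml; apply/andP; split; nra.
- exact: intgD.
Qed.

Lemma L2_cst r : L2 (fun=> r).
Proof. by split; [exact: measurable_cst|exact: intg_cst]. Qed.

Lemma L2_intg f : L2 f -> intg f.
Proof.
by move=> /L2_mul/(_ (L2_cst 1)); apply: eq_intg => w; rewrite mulr1.
Qed.

Lemma L2D f g : L2 f -> L2 g -> L2 (fun w => f w + g w).
Proof.
move=> [mf fi] [mg gi]; split; first exact: measurable_funD.
apply: (@eq_intg (fun w => f w ^+ 2 + g w ^+ 2 + 2 * (f w * g w))).
  by move=> w; ring.
by apply: intgD; [exact: intgD|apply: intgZ; exact: L2_mul].
Qed.

Lemma L2Z r f : L2 f -> L2 (fun w => r * f w).
Proof.
move=> [mf fi]; split; first exact: measurable_funM.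
by apply: (@eq_intg (fun w => r ^+ 2 * f w ^+ 2)); [move=> w; ring|exact: intgZ].
Qed.

Lemma eq_L2 f g : f =1 g -> L2 f -> L2 g.
Proof. by move=> /funext ->. Qed.

Lemma L2N f : L2 f -> L2 (fun w => - f w).
Proof. by move=> /(L2Z (-1)); apply: eq_L2 => w; rewrite mulN1r. Qed.

Lemma L2B f g : L2 f -> L2 g -> L2 (fun w => f w - g w).
Proof. by move=> fi gi; apply: L2D => //; exact: L2N. Qed.

Lemma L2_dom f g : measurable_fun setT f -> (forall w, `|f w| <= `|g w|) ->
  L2 g -> L2 f.
Proof.
move=> mf fg [mg gi]; split => //.
apply: intg_dom gi; first exact: measurable_funX.
by move=> w; rewrite ger0_norm ?sqr_ge0// -[leRHS]real_normK ?num_real//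
  -[leLHS]real_normK ?num_real// lerXn2r ?nnegrE.
Qed.

Lemma cauchy_schwarz f g : L2 f -> L2 g ->
  Ex (fun w => f w * g w) ^+ 2 <= Ex (fun w => f w ^+ 2) * Ex (fun w => g w ^+ 2).
Proof.
move=> f2 g2; set a := Ex (fun w => f w ^+ 2); set b := Ex (fun w => g w ^+ 2).
set c := Ex _.
have key s t : 0 <= s ^+ 2 * a - 2 * s * t * c + t ^+ 2 * b.
  have -> : s ^+ 2 * a - 2 * s * t * c + t ^+ 2 * b =
      Ex (fun w => (s * f w - t * g w) ^+ 2).
    rewrite -!ExZ; [|exact: g2.2|exact: L2_mul|exact: f2.2].
    rewrite -ExB; [|by apply: intgZ; exact: f2.2|by apply: intgZ; exact: L2_mul].
    rewrite -ExD; [|apply: intgB|by apply: intgZ; exact: g2.2].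
    - by apply: eq_Ex => w; ring.
    - by apply: intgZ; exact: f2.2.
    - by apply: intgZ; exact: L2_mul.
  by apply: Ex_ge0 => w; exact: sqr_ge0.
have a0 : 0 <= a by apply: Ex_ge0 => w; exact: sqr_ge0.
have b0 : 0 <= b by apply: Ex_ge0 => w; exact: sqr_ge0.
have [b1|] := ltP 0 b.
  have := key b c; rewrite (_ : _ + _ = b * (a * b - c ^+ 2)); last by ring.
  by rewrite pmulr_rge0// subr_ge0.
move=> b1; have b_eq : b = 0 by apply/le_anti/andP.
have := key 1 ((a + 1) * c); rewrite b_eq !mulr0 addr0 => H.
have [->|c0] := eqVneq c 0; first by rewrite expr0n.
have c2 : 0 < c ^+ 2 by rewrite exprn_even_gt0.
(* With [b = 0] and [s = 1] the form is affine in [t]; at [t = (a + 1) / c] it equals [- a - 2],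
   which is negative, so [c] must vanish. *)
by have := key 1 ((a + 1) / c); rewrite b_eq -[2 * 1 * _ * _]mulrA divfK//; nra.
Qed.

Lemma cauchy_schwarz_abs f g : L2 f -> L2 g ->
  Ex (fun w => `|f w| * `|g w|) <=
  Num.sqrt (Ex (fun w => f w ^+ 2)) * Num.sqrt (Ex (fun w => g w ^+ 2)).
Proof.
move=> f2 g2.
have L2a h : L2 h -> L2 (fun w => `|h w|).
  by move=> h2; apply: (L2_dom _ _ h2) => [|w]; [apply: measurableT_comp => //; exact: h2.1|rewrite normr_id].
rewrite -sqrtrM; last by apply: Ex_ge0 => w; exact: sqr_ge0.
rewrite -[leLHS]ger0_norm; last by apply: Ex_ge0 => w; rewrite mulr_ge0.
rewrite -sqrtr_sqr ler_wsqrtr//.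
have -> : Ex (fun w => f w ^+ 2) = Ex (fun w => `|f w| ^+ 2).
  by apply: eq_Ex => w; rewrite real_normK ?num_real.
have -> : Ex (fun w => g w ^+ 2) = Ex (fun w => `|g w| ^+ 2).
  by apply: eq_Ex => w; rewrite real_normK ?num_real.
by apply: cauchy_schwarz; exact: L2a.
Qed.

(** Cauchy-Schwarz against the fixed factor [g]. This pairing is how the L^2 approximations of
    chaoses and derivatives are used. *)
Lemma cvg_L2_Ex (f_ : nat -> T -> R) f g : (forall n, L2 (f_ n)) -> L2 f ->
  L2 g -> Ex (fun w => (f w - f_ n w) ^+ 2) @[n --> \oo] --> (0 : R) ->
  Ex (fun w => f_ n w * g w) @[n --> \oo] --> Ex (fun w => f w * g w).
Proof.
move=> fn f2 g2 c.
apply/cvgrPdist_le => e e0.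
have sq : (fun n => Num.sqrt (Ex (fun w => (f w - f_ n w) ^+ 2)) *
    Num.sqrt (Ex (fun w => g w ^+ 2))) @ \oo --> (0 : R).
  rewrite -[X in _ --> X](mul0r (Num.sqrt (Ex (fun w => g w ^+ 2)))).
  apply: cvgM; last exact: cvg_cst.
  by rewrite -[X in _ --> X](@sqrtr0 R); apply: continuous_cvg => //; exact: sqrt_continuous.
move/cvgrPdist_le : sq => /(_ e e0); apply: filterS => n.
rewrite sub0r normrN ger0_norm ?mulr_ge0 ?sqrtr_ge0//; apply: le_trans.
rewrite -ExB; [|exact: L2_mul..].
apply: le_trans (Ex_abs _) _; first by apply: intgB; exact: L2_mul.
apply: le_trans (cauchy_schwarz_abs (L2B f2 (fn n)) g2).
rewrite le_eqVlt; apply/orP; left; apply/eqP; apply: eq_Ex => w.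
by rewrite -mulrBl normrM.
Qed.

(** Finiteness of all moments is stable under products, which [L2] is not. Gaussian functionals of
    polynomial growth have it, so they can be multiplied freely before any L^2 limit. *)
Definition mom f := measurable_fun setT f /\ forall n, intg (fun w => f w ^+ n).

Lemma mom_L2 f : mom f -> L2 f.
Proof. by move=> [mf fi]; split => //; exact: fi. Qed.

Lemma mom_intg f : mom f -> intg f.
Proof. by move=> /mom_L2/L2_intg. Qed.

Lemma mom_dom f g : measurable_fun setT f -> (forall w, `|f w| <= `|g w|) ->
  mom g -> mom f.
Proof.
move=> mf fg [mg gi]; split => // n.
apply: intg_dom (intg_abs (gi n)); first exact: measurable_funX.
by move=> w; rewrite !normrX lerXn2r ?nnegrE.
Qed.

Lemma mom_cst r : mom (fun=> r).
Proof. by split => [|n]; [exact: measurable_cst|exact: intg_cst]. Qed.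

Lemma momM f g : mom f -> mom g -> mom (fun w => f w * g w).
Proof.
move=> [mf fi] [mg gi]; split; first exact: measurable_funM.
move=> n; apply: (@eq_intg (fun w => f w ^+ n * g w ^+ n)).
  by move=> w; rewrite exprMn.
apply: L2_mul; split.
- exact: measurable_funX.
- by apply: eq_intg (fi (n * 2)%N) => w; rewrite exprM.
- exact: measurable_funX.
- by apply: eq_intg (gi (n * 2)%N) => w; rewrite exprM.
Qed.

Lemma momX f n : mom f -> mom (fun w => f w ^+ n).
Proof.
move=> [mf fi]; split; first exact: measurable_funX.
by move=> k; apply: eq_intg (fi (n * k)%N) => w; rewrite exprM.
Qed.

Lemma momD f g : mom f -> mom g -> mom (fun w => f w + g w).
Proof.
move=> [mf fi] [mg gi]; split; first exact: measurable_funD.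
move=> n; apply: (@eq_intg (fun w =>
    \sum_(i < n.+1) (f w ^+ (n - i) * g w ^+ i) *+ 'C(n, i))).
  by move=> w; rewrite exprDn.
apply: intg_sum => i.
apply: (@eq_intg (fun w => 'C(n, i)%:R * (f w ^+ (n - i) * g w ^+ i))).
  by move=> w; rewrite mulr_natl.
apply: intgZ; apply: L2_mul; apply: mom_L2; exact: momX.
Qed.

Lemma momZ r f : mom f -> mom (fun w => r * f w).
Proof. by move=> fm; apply: momM => //; exact: mom_cst. Qed.

Lemma eq_mom f g : f =1 g -> mom f -> mom g.
Proof. by move=> /funext ->. Qed.

Lemma momN f : mom f -> mom (fun w => - f w).
Proof. by move=> /(momZ (-1)); apply: eq_mom => w; rewrite mulN1r. Qed.

Lemma momB f g : mom f -> mom g -> mom (fun w => f w - g w).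
Proof. by move=> fm gm; apply: momD => //; exact: momN. Qed.

Lemma mom_sum (I : Type) (s : seq I) (f : I -> T -> R) :
  (forall i, mom (f i)) -> mom (fun w => \sum_(i <- s) f i w).
Proof.
move=> fi; elim: s => [|a s IH].
  by under eq_fun do rewrite big_nil; exact: mom_cst.
by under eq_fun do rewrite big_cons; exact: momD.
Qed.

Lemma mom_abs f : mom f -> mom (fun w => `|f w|).
Proof.
move=> fm; apply: (mom_dom _ _ fm) => [|w]; last by rewrite normr_id.
by apply: measurableT_comp => //; exact: fm.1.
Qed.

End real_expectation.

(** * Normal laws *)

Section calculus.
Context {R : realType}.
Implicit Types (f F : R -> R) (a b x : R).

Local Notation mu := (@lebesgue_measure R).

Lemma is_derive_continuous f (df : R -> R) :
  (forall x, is_derive x 1 f (df x)) -> continuous f.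
Proof. by move=> h x; apply/differentiable_continuous/derivable1_diffP; have [] := h x. Qed.

Lemma FTC2_everywhere F f a b : a < b -> (forall x, is_derive x 1 F (f x)) ->
  continuous f -> (\int[mu]_(x in `[a, b]) (f x)%:E = (F b - F a)%:E)%E.
Proof.
move=> ab dF cf; rewrite EFinB; apply: continuous_FTC2 => //.
- exact: continuous_subspaceT.
- split.
  + by move=> x _; have [] := dF x.
  + by apply: cvg_at_right_filter; exact: is_derive_continuous dF a.
  + by apply: cvg_at_left_filter; exact: is_derive_continuous dF b.
- by move=> x _; rewrite derive1E; have [_ ->] := dF x.
Qed.

Lemma pow_le_expR n x : 0 <= x -> x ^+ n <= n`!%:R * expR x.
Proof.
move=> x0; have f0 : (0 : R) < n`!%:R by rewrite ltr0n fact_gt0.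
case: n f0 => [|n] f0.
  by rewrite expr0 mul1r -[leLHS]expR0 ler_expR.
rewrite -ler_pdivrMl// mulrC; apply: le_trans (expR_ge1Dxn n x0).
by rewrite lerDr.
Qed.

End calculus.

Section normal_law.
Context {R : realType}.
Variable s : R.
Hypothesis s0 : s != 0.

Local Notation mu := (@lebesgue_measure R).
Let gam : probability (measurableTypeR R) R := normal_prob 0 s.
Let p := normal_pdf 0 s.
Let p_ge0 x : 0 <= p x := normal_pdf_ge0 0 s x.

(** The Radon-Nikodym derivative and the density have the same integral over every measurable set,
    hence agree almost everywhere; integrals against [gam] thus become Lebesgue integrals. *)
Let ae_density : ae_eq mu setT (Radon_Nikodym_SigmaFinite.f gam mu) (EFin \o p).
Proof.
have dom : gam `<< mu by exact: normal_prob_dominates.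
apply: integral_ae_eq => //.
- exact: Radon_Nikodym_SigmaFinite.f_integrable.
- by apply/measurable_EFinP; exact: measurable_normal_pdf.
- by move=> E _ mE; rewrite -Radon_Nikodym_SigmaFinite.f_integral.
Qed.

Let ge0_normal_integral (f : R -> R) : measurable_fun setT f ->
  (forall x, 0 <= f x) ->
  (\int[gam]_x (f x)%:E = \int[mu]_x (f x * p x)%:E)%E.
Proof.
move=> mf f0; have dom : gam `<< mu by exact: normal_prob_dominates.
rewrite -(Radon_Nikodym_SigmaFinite.change_of_variables dom (f := EFin \o f))//.
- apply: ae_eq_integral => //.
  + apply: emeasurable_funM; first exact/measurable_EFinP.
    exact: measurable_int (Radon_Nikodym_SigmaFinite.f_integrable _).
  + apply/measurable_EFinP/measurable_funM => //; exact: measurable_normal_pdf.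
  + by apply: filterS ae_density => x /= ->.
exact/measurable_EFinP.
Qed.

Let mp : measurable_fun setT p := measurable_normal_pdf 0 s.

Let normal_intg (f : R -> R) : measurable_fun setT f ->
  mu.-integrable setT (fun x => (f x * p x)%:E) -> intg gam f.
Proof.
move=> mf /integrableP[_ fi]; apply/integrableP; split; first exact/measurable_EFinP.
have := @ge0_normal_integral (fun x => `|f x|); rewrite /= => ->//.
- move: fi; congr (_ < _)%E; apply: eq_integral => x _ /=.
  by rewrite normrM (ger0_norm (p_ge0 x)).
- exact: measurableT_comp.
Qed.

Let normal_int_pdf (f : R -> R) : intg gam f ->
  mu.-integrable setT (fun x => (f x * p x)%:E).
Proof.
move=> fi; apply/integrableP; split.
  by apply/measurable_EFinP/measurable_funM => //; exact: intg_meas fi.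
have mf := intg_meas fi.
have := @ge0_normal_integral (fun x => `|f x|); rewrite /= => h.
under eq_integral do rewrite /= normrM (ger0_norm (p_ge0 _)).
rewrite -h//; last exact: measurableT_comp.
by have /integrableP[] := fi.
Qed.

Let normal_Ex (f : R -> R) : intg gam f -> Ex gam f = \int[mu]_x (f x * p x).
Proof.
move=> fi; have dom : gam `<< mu by exact: normal_prob_dominates.
rewrite /Ex /Rintegral; congr fine.
rewrite -(Radon_Nikodym_change_of_variables dom measurableT fi).
apply: ae_eq_integral => //.
- by apply: emeasurable_funM; [exact: measurable_int fi|exact: measurable_int (Radon_Nikodym_integrable _)].
- by apply/measurable_EFinP/measurable_funM => //; exact: intg_meas fi.
- have h1 := ae_density.
  have h2 := ae_eq_Radon_Nikodym_SigmaFinite dom measurableT.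
  apply: filterS2 h1 h2 => x /= h1 h2 _.
  by rewrite -h2// h1.
Qed.

Let pdfE (t x : R) : t != 0 ->
  normal_pdf 0 t x = normal_peak t * expR (- x ^+ 2 / (t ^+ 2 * 2)).
Proof.
move=> t0; rewrite normal_pdfE//; congr (_ * _).
by rewrite /normal_fun subr0 mulr_natr.
Qed.

(** With [u = x^2 / (4 s^2)] the Gaussian exponent is [- 2 u]. One factor [e^(-u)] absorbs [x^(2k)]
    through [u^k <= k! e^u]; the other is, up to a constant, the density of deviation [s sqrt 2]. *)
Let pdf_even_bound k : exists2 C : R, 0 <= C &
  forall x, x ^+ (2 * k) * p x <= C * normal_pdf 0 (s * Num.sqrt 2) x.
Proof.
have s20 : 0 < s ^+ 2 by rewrite exprn_even_gt0.
have t0 : s * Num.sqrt 2 != 0 by rewrite mulf_neq0// gt_eqF// sqrtr_gt0.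
exists (k`!%:R * (4 * s ^+ 2) ^+ k * normal_peak s / normal_peak (s * Num.sqrt 2)).
  by rewrite !mulr_ge0 ?invr_ge0 ?normal_peak_ge0// exprn_ge0// mulr_ge0// ltW.
move=> x; rewrite /p !pdfE//.
rewrite [leRHS]mulrA divfK; last by rewrite gt_eqF// normal_peak_gt0.
rewrite mulrCA [leRHS]mulrAC [leRHS]mulrC ler_wpM2l ?normal_peak_ge0//.
rewrite (exprMn 2 s) sqr_sqrtr//.
set u := x ^+ 2 / (4 * s ^+ 2).
have -> : - x ^+ 2 / (s ^+ 2 * 2) = - u + - u.
  by rewrite /u; field.
have -> : - x ^+ 2 / (s ^+ 2 * 2 * 2) = - u.
  by rewrite /u; field.
rewrite expRD mulrA ler_wpM2r ?expR_ge0//.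
have u0 : 0 <= u by rewrite divr_ge0// ?sqr_ge0// mulr_ge0// ltW.
rewrite expRN ler_pdivrMr ?expR_gt0//.
rewrite exprM (_ : x ^+ 2 = 4 * s ^+ 2 * u); last by rewrite /u; field.
rewrite exprMn -mulrA [leRHS]mulrCA ler_wpM2l//; last exact: pow_le_expR.
by apply: exprn_ge0; rewrite mulr_ge0// ltW.
Qed.

Lemma normal_mom : mom gam (fun x => x).
Proof.
split=> // n.
have h k : intg gam (fun x => x ^+ (2 * k)).
  apply: normal_intg; first exact: measurable_funX.
  have [C C0 hC] := pdf_even_bound k.
  have := integrableZl measurableT C (integrable_normal_pdf 0 (s * Num.sqrt 2)).
  apply: le_integrable => //.
    by apply/measurable_EFinP/measurable_funM => //; exact: measurable_funX.
  move=> x _ /=; rewrite lee_fin ger0_norm; last first.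
    by rewrite mulr_ge0// exprM exprn_ge0// sqr_ge0.
  by rewrite ger0_norm// mulr_ge0// normal_pdf_ge0.
apply: (intg_dom (P := gam) (g := fun x => 1 + x ^+ (2 * n))).
- exact: measurable_funX.
- move=> x; have [x1|x1] := lerP `|x| 1.
    rewrite normrX (le_trans (exprn_ile1 _ (normr_ge0 _) x1))// lerDl exprM exprn_ge0//.
    exact: sqr_ge0.
  rewrite normrX exprM -real_normK ?num_real// -exprM.
  by rewrite (le_trans (ler_weXn2l (ltW x1) (leq_pmull n (isT : 0 < 2)%N)))// lerDr.
- by apply: intgD => //; exact: intg_cst.
Qed.

Let is_derive_pdf (x : R) : is_derive x 1 p (- (x / s ^+ 2) * p x).
Proof.
have -> : p = fun x => normal_peak s * expR (- x ^+ 2 / (s ^+ 2 * 2)).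
  by apply/funext => y; rewrite /p pdfE.
apply: is_derive_eq.
rewrite /GRing.scale /=.
have s2 : s ^+ 2 != 0 by rewrite expf_neq0.
by field.
Qed.

(** The integrand [(x g - s^2 g') p] is the derivative of [- s^2 g p]. Over growing symmetric
    intervals its integral reduces to boundary terms, which vanish because [x^2 p] is bounded while
    [g] grows at most linearly. *)
Lemma normal_stein (g dg : R -> R) (c : R) :
  (forall x : R, is_derive x 1 g (dg x)) -> continuous dg ->
  (forall x, `|g x| <= c * (1 + `|x|)) -> (forall x, `|dg x| <= c * (1 + `|x|)) ->
  Ex gam (fun x => x * g x) = s ^+ 2 * Ex gam dg.
Proof.
move=> Dg cdg bg bdg.
have cg := is_derive_continuous Dg.
have cid : continuous (fun x : R => x) by move=> x; exact: cvg_id.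
have mg : measurable_fun setT g by exact: continuous_measurable_fun.
have mdg : measurable_fun setT dg by exact: continuous_measurable_fun.
have mb : mom gam (fun x => c * (1 + `|x|)).
  by apply/momZ/momD; [exact: mom_cst|apply: mom_abs; exact: normal_mom].
have gm : mom gam g.
  by apply: mom_dom mb => // x; rewrite (le_trans (bg x))// ler_norm.
have dgm : mom gam dg.
  by apply: mom_dom mb => // x; rewrite (le_trans (bdg x))// ler_norm.
have xgi : intg gam (fun x => x * g x) by apply/mom_intg/momM => //; exact: normal_mom.
have dgi : intg gam (fun x => s ^+ 2 * dg x) by apply/mom_intg/momZ.
apply/eqP; rewrite -subr_eq0 -ExZ; last exact: mom_intg.
rewrite -ExB// normal_Ex; last exact: intgB.
set h := fun x => (x * g x - s ^+ 2 * dg x) * p x.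
have hi : mu.-integrable setT (EFin \o h) by apply: normal_int_pdf; exact: intgB.
have mh : measurable_fun setT (EFin \o h) by exact: measurable_int hi.
have cp : continuous p by apply: is_derive_continuous is_derive_pdf.
have Dh (x : R) : is_derive x 1 (fun x => - s ^+ 2 * (g x * p x)) (h x).
  have := Dg x; have := is_derive_pdf x => Dp Dgx.
  apply: is_derive_eq; rewrite /h /GRing.scale /=.
  by field.
have ch : continuous h.
  move=> x; rewrite /h; apply: cvgM; last exact: cp.
  apply: cvgB; apply: cvgM; [exact: cvg_id|exact: cg|exact: cvg_cst|exact: cdg].
pose I (n : nat) : set R := [set` `[- (n.+1%:R : R), n.+1%:R]].
have FT (n : nat) : (\int[mu]_(x in I n) (h x)%:E)%E =
    (- s ^+ 2 * (g n.+1%:R * p n.+1%:R) - - s ^+ 2 * (g (- n.+1%:R) * p (- n.+1%:R)))%:E.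
  by apply: FTC2_everywhere => //; rewrite -subr_gt0 opprK ltr_wpDl// ltr0n.
have [C C0 hC] := pdf_even_bound 1.
set M := C * normal_peak (s * Num.sqrt 2).
have M0 : 0 <= M by rewrite mulr_ge0// normal_peak_ge0.
have pM x : x ^+ 2 * p x <= M.
  by apply: le_trans (hC x) _; rewrite ler_wpM2l// normal_pdf_ub// mulf_neq0.
have c0 : 0 <= c.
  by have := bg 0; rewrite normr0 addr0 mulr1; apply: le_trans.
have gp x : 1 <= `|x| -> `|g x * p x| <= 2 * c * M / `|x|.
  move=> x1; have x0 : 0 < `|x| by exact: lt_le_trans x1.
  rewrite normrM (ger0_norm (p_ge0 x)) ler_pdivlMr//.
  apply: le_trans (_ : c * (2 * `|x|) * p x * `|x| <= _).
    rewrite ler_wpM2r// ler_wpM2r// (le_trans (bg x))// ler_wpM2l// mulr2n mulrDl mul1r.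
    by rewrite lerD2r.
  have -> : c * (2 * `|x|) * p x * `|x| = 2 * c * (`|x| ^+ 2 * p x) by ring.
  by rewrite real_normK ?num_real// ler_wpM2l// mulr_ge0.
have lim0 : (\int[mu]_(x in I n) (h x)%:E @[n --> \oo] --> 0)%E.
  under eq_fun do rewrite FT.
  apply: cvg_EFin; first by near=> n.
  apply: (@squeeze_cvgr _ _ _ _ (fun n => - (4 * s ^+ 2 * c * M * n.+1%:R^-1))
    (fun n => 4 * s ^+ 2 * c * M * n.+1%:R^-1)).
  - near=> n; rewrite -ler_norml.
    have n1 : 1 <= `|n.+1%:R : R| by rewrite ger0_norm// ler1n.
    have := gp n.+1%:R n1; have := gp (- n.+1%:R); rewrite normrN => /(_ n1).
    rewrite [`|n.+1%:R|]ger0_norm// => h1 h2.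
    rewrite /= (_ : _ - _ = s ^+ 2 * (g (- n.+1%:R) * p (- n.+1%:R) - g n.+1%:R * p n.+1%:R)); last by ring.
    rewrite normrM ger0_norm ?sqr_ge0//.
    rewrite (_ : 4 * s ^+ 2 * c * M / n.+1%:R = s ^+ 2 * (2 * c * M / n.+1%:R + 2 * c * M / n.+1%:R)); last by field.
    by rewrite ler_wpM2l ?sqr_ge0// (le_trans (ler_normB _ _))// lerD.
  - rewrite -oppr0; apply: cvgN; rewrite -[X in _ --> X](mulr0 (4 * s ^+ 2 * c * M)).
    by apply: cvgM; [exact: cvg_cst|exact: cvg_harmonic].
  - rewrite -[X in _ --> X](mulr0 (4 * s ^+ 2 * c * M)).
    by apply: cvgM; [exact: cvg_cst|exact: cvg_harmonic].
have [|||||_ _] := @dominated_convergence _ _ R mu setT measurableT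
   (fun n => (EFin \o h) \_ (I n)) (EFin \o h) (fun x => `|(h x)%:E|)%E.
- move=> n; apply/(measurable_restrictT _ _).1; first exact: measurable_itv.
  exact: measurable_funTS.
- by [].
- apply/aeW => x _; apply: cvg_near_cst.
  exists (Num.truncn `|x|) => // n /= xn; rewrite /patch ifT// inE/= /I/= in_itv/= -ler_norml.
  rewrite ltW// (lt_le_trans (truncnS_gt _))// ler_nat ltnS//.
- exact: integrable_abse.
- apply/aeW => x n _; rewrite /patch; case: ifPn => // _.
  by rewrite abse0 abse_ge0.
under eq_fun do rewrite -integral_mkcond.
move=> lim1; rewrite /Rintegral; apply/eqP.
have := cvg_unique _ lim1 lim0; rewrite /= => ->//.
Unshelve. all: by end_near. Qed.

End normal_law.

(** * Lipschitz bounds and rescaled sines *)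

Section calculus_more.
Context {R : realType}.

Lemma lipschitz_of_derive (f df : R -> R) (M : R) :
  (forall x : R, is_derive x 1 f (df x)) -> (forall x, `|df x| <= M) ->
  forall x y, `|f x - f y| <= M * `|x - y|.
Proof.
move=> Df bdf.
have cf := @is_derive_continuous R f df Df.
have h a b : a < b -> `|f b - f a| <= M * `|b - a|.
  move=> ab; have [c _ ->] := MVT ab (fun x _ => Df x) (continuous_subspaceT cf).
  by rewrite normrM ler_wpM2r.
move=> x y; have [xy|xy|->] := ltgtP x y.
- by rewrite distrC [`|x - y|]distrC; exact: h.
- exact: h.
- by rewrite !subrr normr0 mulr0.
Qed.

Lemma normr_sin_le (x : R) : `|sin x| <= `|x|.
Proof.
have := @lipschitz_of_derive sin cos 1 (fun x => is_derive_sin x) (@cos_max R) x 0.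
by rewrite sin0 !subr0 mul1r.
Qed.

Lemma is_derive_cvg_seq (f : R -> R) (x df : R) : is_derive x 1 f df ->
  n.+1%:R * (f (x + n.+1%:R^-1) - f x) @[n --> \oo] --> df.
Proof.
move=> [dfx <-].
have := dfx; rewrite /derivable => /cvg_ex[l hl].
have -> : 'D_1 f x = l by apply: cvg_lim.
have : (n.+1%:R^-1 : R) @[n --> \oo] --> 0^'.
  move=> A hA.
  have : \forall n \near \oo, (n.+1%:R^-1 : R) != 0 -> A (n.+1%:R^-1) := cvg_harmonic hA.
  by apply: filterS => n; apply; rewrite invr_eq0 pnatr_eq0.
move=> /cvg_comp/(_ hl); apply: cvg_trans; apply: near_eq_cvg; near=> n => /=.
by rewrite invrK /= /GRing.scale /= mulr1 [_^-1 + x]addrC.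
Unshelve. all: by end_near. Qed.

Lemma cvg_sin_scaled (x : R) : n.+1%:R * sin (n.+1%:R^-1 * x) @[n --> \oo] --> x.
Proof.
have : is_derive (0 : R) 1 (fun t : R => sin (t * x)) x.
  by apply: is_derive_eq; rewrite /GRing.scale /= mul0r cos0; ring.
move=> /is_derive_cvg_seq; apply: cvg_trans; apply: near_eq_cvg; near=> n.
by rewrite mul0r sin0 subr0 add0r.
Unshelve. all: by end_near. Qed.

End calculus_more.

(** * Isonormal families *)

Section transfer.
Context {R : realType} {d : measure_display} {T : measurableType d}.

(* [R] and [measurableTypeR R] carry the same sigma-algebra but have different
   displays; the identity moves laws from one to the other. *)
Definition idR : measurableTypeR R -> R := fun x => x.

Lemma measurable_idR : measurable_fun setT idR.
Proof. by move=> _ A mA; rewrite setTI. Qed.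

HB.instance Definition _ := isMeasurableFun.Build _ _ _ _ idR measurable_idR.

Variables (P : probability T R) (Q : probability (measurableTypeR R) R).
Variable Y : {RV P >-> R}.
Hypothesis lawY : forall A : set R, measurable A -> P (Y @^-1` A) = Q A.

Let Z : {RV Q >-> R} := idR.

Let transfer_integral (f : R -> \bar R) :
  (\int[distribution P Y]_y f y = \int[distribution Q Z]_y f y)%E.
Proof. by apply: eq_measure_integral => A mA _; exact: lawY. Qed.

Lemma transfer_intg (f : R -> R) : intg Q f -> intg P (f \o Y).
Proof.
move=> fi; have mf : measurable_fun setT f := intg_meas fi.
apply/integrableP; split.
  by apply/measurable_EFinP; exact: measurableT_comp.
have /integrableP[_] := fi; apply: le_lt_trans; rewrite le_eqVlt.
apply/orP; left; apply/eqP.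
have mfa : measurable_fun setT (fun y => `|(f y)%:E|%E).
  by apply/measurable_EFinP; exact: measurableT_comp.
rewrite -(ge0_integral_distribution Y (f := fun y => `|(f y)%:E|%E))//.
by rewrite transfer_integral ge0_integral_distribution.
Qed.

Lemma transfer_Ex (f : R -> R) : intg Q f -> Ex P (f \o Y) = Ex Q f.
Proof.
move=> fi; have mf : measurable_fun setT f := intg_meas fi.
rewrite /Ex /Rintegral; congr fine.
have mf' : measurable_fun setT (EFin \o f) by exact/measurable_EFinP.
rewrite -(integral_distribution (X := Y) (f := EFin \o f))//.
  by rewrite transfer_integral integral_distribution.
exact: transfer_intg.
Qed.

End transfer.

(** * Centered Gaussian laws on the line, degenerate case included *)

Section gaussian_probability.
Context {R : realType}.

(** For [s = 0] both sides of the Stein identity vanish under the Dirac mass, so later arguments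
    need not separate degenerate combinations of the [X h]. *)
Lemma gaussian_probability_exists (s : R) :
  exists Q : probability (measurableTypeR R) R,
  [/\ forall A : set R, measurable A -> centered_gaussian s A = Q A,
      mom Q (fun x : R => x) &
      forall (g dg : R -> R) (c : R),
        (forall x : R, is_derive x 1 g (dg x)) -> continuous dg ->
        (forall x, `|g x| <= c * (1 + `|x|)) ->
        (forall x, `|dg x| <= c * (1 + `|x|)) ->
        Ex Q (fun x => x * g x) = s ^+ 2 * Ex Q dg].
Proof.
have [->|s0] := eqVneq s 0; last first.
  exists (normal_prob 0 s); split.
  - by move=> A mA; rewrite /centered_gaussian (negbTE s0).
  - exact: normal_mom.
  - by move=> g dg c ? ? ? ?; apply: normal_stein.
pose Q : probability (measurableTypeR R) R := \d_(0 : measurableTypeR R).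
have ExQ f : measurable_fun setT f -> Ex Q f = f 0.
  move=> mf; rewrite /Ex /Rintegral integral_dirac//; last exact/measurable_EFinP.
  by rewrite diracT mul1e.
exists Q; split.
- by move=> A mA; rewrite /centered_gaussian eqxx.
- split => // n; apply/integrableP; split.
    by apply/measurable_EFinP; exact: measurable_funX.
  rewrite integral_dirac//; last first.
    by apply/measurable_EFinP; apply: measurableT_comp => //; exact: measurable_funX.
  by rewrite diracT mul1e ltry.
- move=> g dg c Dg cdg _ _; rewrite expr0n /= mul0r ExQ ?mul0r//.
  apply: measurable_funM => //; apply: continuous_measurable_fun.
  exact: is_derive_continuous Dg.
Qed.

End gaussian_probability.

(** * Sines and cosines of Gaussian linear combinations *)

Section gaussian_family.
Context {R : realType} {H : completeNormedModType R}.
Variable dot : {dot H for idfun}.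
Context {d : measure_display} {T : measurableType d} {P : probability T R}.
Variable X : H -> {RV P >-> R}.
Hypothesis isoX : isonormal dot X.

Lemma dotC x y : dot x y = dot y x.
Proof. by rewrite hermC /= expr0 mul1r. Qed.

Lemma dotDl x y z : dot (x + y) z = dot x z + dot y z.
Proof. by rewrite linearDl. Qed.

Lemma dotDr x y z : dot x (y + z) = dot x y + dot x z.
Proof. by rewrite linearDr. Qed.

Lemma dotZl a x y : dot (a *: x) y = a * dot x y.
Proof. by rewrite linearZl_LR. Qed.

Lemma dotZr a x y : dot x (a *: y) = a * dot x y.
Proof. by rewrite linearZr_LR. Qed.

Lemma dot_ge0 x : 0 <= dot x x.
Proof.
have [->|] := eqVneq x 0; first by rewrite linear0l.
by move=> x0; exact/ltW/(@neq0_dnorm_gt0 _ _ _ dot).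
Qed.

Lemma dot_eq0 x : dot x x = 0 -> x = 0.
Proof.
by move=> x0; apply/eqP; apply: contraT => /(@neq0_dnorm_gt0 _ _ _ dot); rewrite x0 ltxx.
Qed.

Implicit Types l : seq (R * H).
(** Linearity of [X] holds only almost surely, so [lc l] is kept apart from [X (lv l)]: formal
    combinations make identities such as [lc_cat] and [lc_scale] hold at every point. *)
Definition lc l (w : T) : R := \sum_(k <- l) k.1 * X k.2 w.
Definition lv l : H := \sum_(k <- l) k.1 *: k.2.

Lemma measurable_lc l : measurable_fun setT (lc l).
Proof.
apply: measurable_sum => k; apply: measurable_funM => //; exact: measurable_funPT.
Qed.

HB.instance Definition _ l := isMeasurableFun.Build _ _ _ _ (lc l) (measurable_lc l).

Lemma lc_law l : exists s : R, 0 <= s /\ exists Q : probability (measurableTypeR R) R,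
  [/\ forall A : set R, measurable A -> centered_gaussian s A = Q A,
      forall A : set R, measurable A -> P (lc l @^-1` A) = Q A,
      mom Q (fun x : R => x) &
      forall (g dg : R -> R) (c : R),
        (forall x : R, is_derive x 1 g (dg x)) -> continuous dg ->
        (forall x, `|g x| <= c * (1 + `|x|)) ->
        (forall x, `|dg x| <= c * (1 + `|x|)) ->
        Ex Q (fun x => x * g x) = s ^+ 2 * Ex Q dg].
Proof.
pose t := in_tuple l.
have [s s0 hs] := isoX.1 (size l) (fun i => (tnth t i).2) (fun i => (tnth t i).1).
have [Q [QE Qm Qs]] := gaussian_probability_exists s.
exists s; split => //; exists Q; split => // A mA.
rewrite -QE// -hs//; congr (P _); apply/seteqP.
by split => w /=; rewrite /lc (big_tnth _ _ l).
Qed.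

Lemma lc_mom l : mom P (lc l).
Proof.
have [s [_ [Q [_ lawl Qm _]]]] := lc_law l.
split; first exact: measurable_lc.
by move=> n; apply: (transfer_intg lawl (Qm.2 n)).
Qed.

Lemma lc1 h : lc [:: (1, h)] = X h.
Proof. by apply/funext => w; rewrite /lc big_seq1 mul1r. Qed.

Lemma X_mom h : mom P (X h).
Proof. by rewrite -lc1; exact: lc_mom. Qed.

Lemma ExXX g h : Ex P (fun w => X g w * X h w) = dot g h.
Proof.
have := isoX.2 g h; rewrite unlock => hE.
by rewrite /Ex /Rintegral [X in fine X](_ : _ = (dot g h)%:E).
Qed.

Lemma Ex_lc_lc l l' : Ex P (fun w => lc l w * lc l' w) = dot (lv l) (lv l').
Proof.
have XX g h : intg P (fun w => X g w * X h w).
  by apply/mom_intg/momM; exact: X_mom.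
transitivity (Ex P (fun w => \sum_(k <- l) \sum_(k' <- l')
    (k.1 * k'.1) * (X k.2 w * X k'.2 w))).
  apply: eq_Ex => w; rewrite /lc mulr_suml; apply: eq_bigr => k _.
  by rewrite mulr_sumr; apply: eq_bigr => k' _; ring.
rewrite Ex_sum; last by move=> k; apply: intg_sum => k'; exact: intgZ.
rewrite linear_sumlz; apply: eq_bigr => k _.
rewrite Ex_sum; last by move=> k'; exact: intgZ.
rewrite linear_sumr /=; apply: eq_bigr => k' _.
by rewrite ExZ// ExXX dotZl dotZr mulrA.
Qed.

(** The Stein identity for [g(x) = x] says that the second moment is [s^2]. *)
Lemma lc_sd l (s : R) (Q : probability (measurableTypeR R) R) :
  (forall A : set R, measurable A -> P (lc l @^-1` A) = Q A) ->
  mom Q (fun x : R => x) ->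
  (forall (g dg : R -> R) (c : R),
        (forall x : R, is_derive x 1 g (dg x)) -> continuous dg ->
        (forall x, `|g x| <= c * (1 + `|x|)) ->
        (forall x, `|dg x| <= c * (1 + `|x|)) ->
        Ex Q (fun x => x * g x) = s ^+ 2 * Ex Q dg) ->
  s ^+ 2 = dot (lv l) (lv l).
Proof.
move=> lawl Qm Qs.
have idle (x : R) : `|x| <= 1 * (1 + `|x|) by rewrite mul1r lerDr.
have := Qs (fun x => x) (fun=> 1) 1 (fun x => is_derive_id x 1) (@cst_continuous _ _ _).
rewrite Ex_cst mulr1 => <-//; last first.
  by move=> x; rewrite normr1 mul1r lerDl.
rewrite -Ex_lc_lc -(transfer_Ex lawl)//.
by apply: mom_intg; exact: momM.
Qed.

Lemma lc_stein l (g dg : R -> R) (c : R) :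
  (forall x : R, is_derive x 1 g (dg x)) -> continuous dg ->
  (forall x, `|g x| <= c * (1 + `|x|)) -> (forall x, `|dg x| <= c * (1 + `|x|)) ->
  Ex P (fun w => lc l w * g (lc l w)) =
  dot (lv l) (lv l) * Ex P (fun w => dg (lc l w)).
Proof.
move=> Dg cdg bg bdg; have [s [s0 [Q [_ lawl Qm Qs]]]] := lc_law l.
have mb : mom Q (fun x => c * (1 + `|x|)).
  by apply/momZ/momD; [exact: mom_cst|exact: mom_abs].
have cg := is_derive_continuous (df := dg) Dg.
have gm : mom Q g.
  apply: mom_dom mb; first exact: continuous_measurable_fun.
  by move=> x; rewrite (le_trans (bg x))// ler_norm.
have dgm : mom Q dg.
  apply: mom_dom mb; first exact: continuous_measurable_fun.
  by move=> x; rewrite (le_trans (bdg x))// ler_norm.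
rewrite -(lc_sd lawl Qm Qs).
have := transfer_Ex lawl (mom_intg dgm); rewrite /comp => ->.
rewrite -(Qs g dg c)//.
by rewrite -(transfer_Ex lawl (mom_intg (momM Qm gm))).
Qed.

(** A centered Gaussian law is determined by its deviation, which is the norm of [lv l] by
    [lc_sd]. *)
Lemma lc_same_law l l' (f : R -> R) : dot (lv l) (lv l) = dot (lv l') (lv l') ->
  continuous f -> (forall x, `|f x| <= 1) ->
  Ex P (fun w => f (lc l w)) = Ex P (fun w => f (lc l' w)).
Proof.
move=> ll' cf bf.
have [s [s0 [Q [QE lawl Qm Qs]]]] := lc_law l.
have [s' [s'0 [Q' [QE' lawl' Qm' Qs']]]] := lc_law l'.
have ss' : s = s'.
  apply/eqP; rewrite -(eqrXn2 (isT : 0 < 2)%N)//.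
  by rewrite (lc_sd lawl Qm Qs) (lc_sd lawl' Qm' Qs') ll'.
have lawl'2 (A : set R) : measurable A -> P (lc l' @^-1` A) = Q A.
  by move=> mA; rewrite lawl'// -QE'// -ss' QE.
have fi : intg Q f.
  apply: (intg_dom (P := Q) (g := fun=> 1)) => //; last exact: intg_cst.
  exact: continuous_measurable_fun.
have := transfer_Ex lawl fi; rewrite /comp => ->.
by have := transfer_Ex lawl'2 fi; rewrite /comp => ->.
Qed.

Definition lscale (t : R) l := [seq (t * k.1, k.2) | k <- l].

Lemma lc_cat l l' w : lc (l ++ l') w = lc l w + lc l' w.
Proof. by rewrite /lc big_cat. Qed.

Lemma lv_cat l l' : lv (l ++ l') = lv l + lv l'.
Proof. by rewrite /lv big_cat. Qed.

Lemma lc_scale t l w : lc (lscale t l) w = t * lc l w.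
Proof. by rewrite /lc big_map mulr_sumr; apply: eq_bigr => k _; rewrite /= mulrA. Qed.

Lemma lv_scale t l : lv (lscale t l) = t *: lv l.
Proof. by rewrite /lv big_map scaler_sumr; apply: eq_bigr => k _; rewrite /= scalerA. Qed.

(** [(n + 1) sin (B / (n + 1))] tends to [B] and is dominated by [|B|], so orthogonality of [A] to
    every [sin (t B)] passes to [B] itself. *)
Let cvg_scaled (A B : T -> R) : measurable_fun setT A -> mom P B ->
  (forall w, `|A w| <= 1) ->
  (forall t, Ex P (fun w => A w * sin (t * B w)) = 0) ->
  Ex P (fun w => A w * B w) = 0.
Proof.
move=> mA Bm bA h.
have := @Ex_dct _ _ _ P (fun n w => A w * (n.+1%:R * sin (n.+1%:R^-1 * B w)))
  (fun w => A w * B w) (fun w => `|B w|).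
have mB : measurable_fun setT B by exact: Bm.1.
have msin t : measurable_fun setT (fun w => sin (t * B w)).
  apply: (measurableT_comp (f := sin)).
    by apply: continuous_measurable_fun; exact: continuous_sin.
  exact: measurable_funM.
case=> [n|w|n w||_ c].
- by apply: measurable_funM => //; apply: measurable_funM.
- by apply: cvgM; [exact: cvg_cst|exact: cvg_sin_scaled].
- rewrite normrM -[leRHS]mul1r ler_pM// normrM [`|n.+1%:R|]ger0_norm//.
  by rewrite -ler_pdivlMl ?ltr0n// (le_trans (normr_sin_le _))// normrM ger0_norm// invr_ge0.
- exact/intg_abs/mom_intg.
have : (0 : R) @[n --> \oo] --> Ex P (fun w => A w * B w).
  move: c; under eq_fun => n.
    rewrite (_ : Ex P _ = 0); first over.
    rewrite -(mulr0 n.+1%:R) -(h n.+1%:R^-1) -ExZ.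
      by apply: eq_Ex => w; ring.
    apply: (@intg_dom _ _ _ _ _ (fun=> 1)); last exact: intg_cst.
    - exact: measurable_funM.
    - by move=> w; rewrite normrM -[leRHS]mul1r ler_pM// sin_max.
  by [].
by move=> /(cvg_unique _)/(_ (@cvg_cst _ _ _ _ _)) <-.
Qed.

Let msin l : measurable_fun setT (fun w => sin (lc l w)).
Proof.
apply: (measurableT_comp (f := sin)); last exact: measurable_lc.
by apply: continuous_measurable_fun; exact: continuous_sin.
Qed.

Let mcos l : measurable_fun setT (fun w => cos (lc l w)).
Proof.
apply: (measurableT_comp (f := cos)); last exact: measurable_lc.
by apply: continuous_measurable_fun; exact: continuous_cos.
Qed.

Lemma Ex_sin_lc l : Ex P (fun w => sin (lc l w)) = 0.
Proof.
have h : Ex P (fun w => sin (lc l w)) = - Ex P (fun w => sin (lc l w)).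
  rewrite -ExN.
    rewrite (@lc_same_law l (lscale (-1) l) sin).
    - by apply: eq_Ex => w; rewrite lc_scale mulN1r sinN.
    - by rewrite lv_scale dotZl dotZr; ring.
    - exact: continuous_sin.
    - exact: sin_max.
  apply: (@intg_dom _ _ _ _ _ (fun=> 1)) => //; last exact: intg_cst.
  by move=> w; exact: sin_max.
lra.
Qed.

Let intg_b (f : T -> R) : measurable_fun setT f -> (forall w, `|f w| <= 1) -> intg P f.
Proof. by move=> mf fb; apply: intg_dom mf fb _; exact: intg_cst. Qed.

(** [cos A sin (t B)] is half of [sin (A + t B) - sin (A - t B)], and both sines have mean zero by
    symmetry. *)
Lemma Ex_cos_lc_lc l l' : Ex P (fun w => cos (lc l w) * lc l' w) = 0.
Proof.
apply: cvg_scaled => //; [exact: lc_mom|by move=> w; exact: cos_max|].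
move=> t; have h1 := Ex_sin_lc (l ++ lscale t l').
have h2 := Ex_sin_lc (l ++ lscale (- t) l').
have -> : Ex P (fun w => cos (lc l w) * sin (t * lc l' w)) =
   2^-1 * (Ex P (fun w => sin (lc (l ++ lscale t l') w)) -
           Ex P (fun w => sin (lc (l ++ lscale (- t) l') w))).
  rewrite -ExB -?ExZ; last 3 first.
  - by apply: intgB; apply: intg_b => // w; exact: sin_max.
  - by apply: intg_b => // w; exact: sin_max.
  - by apply: intg_b => // w; exact: sin_max.
  apply: eq_Ex => w; rewrite !lc_cat !lc_scale mulNr sinD sinB.
  by field.
by rewrite h1 h2 subrr mulr0.
Qed.

Let Ex_sin_orth l l' : dot (lv l) (lv l') = 0 ->
  Ex P (fun w => sin (lc l w) * lc l' w) = 0.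
Proof.
move=> ort; apply: cvg_scaled => //; [exact: lc_mom|by move=> w; exact: sin_max|].
move=> t.
have h : Ex P (fun w => cos (lc (l ++ lscale t l') w)) =
         Ex P (fun w => cos (lc (l ++ lscale (- t) l') w)).
  apply: lc_same_law; [|exact: continuous_cos|exact: cos_max].
  rewrite !lv_cat !lv_scale !(dotDl, dotDr, dotZl, dotZr) (dotC (lv l')) ort.
  by ring.
have -> : Ex P (fun w => sin (lc l w) * sin (t * lc l' w)) =
   2^-1 * (Ex P (fun w => cos (lc (l ++ lscale (- t) l') w)) -
           Ex P (fun w => cos (lc (l ++ lscale t l') w))).
  rewrite -ExB -?ExZ; last 3 first.
  - by apply: intgB; apply: intg_b => // w; exact: cos_max.
  - by apply: intg_b => // w; exact: cos_max.
  - by apply: intg_b => // w; exact: cos_max.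
  apply: eq_Ex => w; rewrite !lc_cat !lc_scale mulNr cosB cosD.
  by field.
by rewrite h subrr mulr0.
Qed.

(** The second combination splits into a part orthogonal to the first, which contributes nothing,
    and a multiple of the first, for which the one-dimensional Stein identity with [g = sin]
    applies. *)
Lemma Ex_sin_lc_lc l l' : Ex P (fun w => sin (lc l w) * lc l' w) =
  dot (lv l) (lv l') * Ex P (fun w => cos (lc l w)).
Proof.
(* Coefficient of the orthogonal projection; when [lv l = 0] the division returns 0, which is still
   a correct choice. *)
set be := dot (lv l) (lv l') / dot (lv l) (lv l).
have ort : dot (lv l) (lv (l' ++ lscale (- be) l)) = 0.
  rewrite lv_cat lv_scale dotDr dotZr.
  have [/dot_eq0 l0|l0] := eqVneq (dot (lv l) (lv l)) 0.
    by rewrite l0 !linear0l mulr0 addr0.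
  by rewrite /be mulNr divfK// subrr.
have bel : be * dot (lv l) (lv l) = dot (lv l) (lv l').
  move: ort; rewrite lv_cat lv_scale dotDr dotZr mulNr => /eqP.
  by rewrite subr_eq0 => /eqP.
have sl : Ex P (fun w => lc l w * sin (lc l w)) =
    dot (lv l) (lv l) * Ex P (fun w => cos (lc l w)).
  apply: (@lc_stein l sin cos 1) => //.
  - exact: continuous_cos.
  - by move=> x; rewrite mul1r (le_trans (sin_max _))// lerDl.
  - by move=> x; rewrite mul1r (le_trans (cos_max _))// lerDl.
have smom : mom P (fun w => sin (lc l w)).
  by apply: mom_dom (mom_cst P 1) => // w; rewrite normr1; exact: sin_max.
transitivity (Ex P (fun w => sin (lc l w) * lc (l' ++ lscale (- be) l) w) +
   be * Ex P (fun w => lc l w * sin (lc l w))).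
  rewrite -ExZ; last by apply/mom_intg/momM => //; exact: lc_mom.
  rewrite -ExD; last 2 first.
  - by apply/mom_intg/momM => //; exact: lc_mom.
  - by apply/intgZ/mom_intg/momM => //; exact: lc_mom.
  by apply: eq_Ex => w; rewrite lc_cat lc_scale; ring.
by rewrite Ex_sin_orth// add0r sl mulrA bel.
Qed.

(** The phase [b] makes one family of cosines contain the sines as well, hence products of sines and
    cosines too. *)
Lemma trig_ibp l (b : R) h : Ex P (fun w => cos (lc l w + b) * X h w) =
  - (dot (lv l) h * Ex P (fun w => sin (lc l w + b))).
Proof.
have smom : mom P (fun w => sin (lc l w)).
  by apply: mom_dom (mom_cst P 1) => // w; rewrite normr1; exact: sin_max.
have cmom : mom P (fun w => cos (lc l w)).
  by apply: mom_dom (mom_cst P 1) => // w; rewrite normr1; exact: cos_max.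
have X1 : X h = lc [:: (1, h)] :> (T -> R) by rewrite lc1.
have lv1 : lv [:: (1, h)] = h by rewrite /lv big_seq1 scale1r.
transitivity (cos b * Ex P (fun w => cos (lc l w) * lc [:: (1, h)] w) -
   sin b * Ex P (fun w => sin (lc l w) * lc [:: (1, h)] w)).
  rewrite -!ExZ; [|by apply/mom_intg/momM => //; exact: lc_mom..].
  rewrite -ExB; [|by apply/intgZ/mom_intg/momM => //; exact: lc_mom..].
  by apply: eq_Ex => w; rewrite X1 cosD; ring.
have -> : Ex P (fun w => sin (lc l w + b)) = cos b * Ex P (fun w => sin (lc l w)) +
   sin b * Ex P (fun w => cos (lc l w)).
  rewrite -!ExZ; [|exact: mom_intg..].
  rewrite -ExD; [|by apply/intgZ; exact: mom_intg..].
  by apply: eq_Ex => w; rewrite sinD; ring.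
by rewrite Ex_cos_lc_lc Ex_sin_lc_lc Ex_sin_lc lv1; ring.
Qed.

End gaussian_family.

(** * Bernstein operators *)

Section bernstein.
Context {R : realType}.
Implicit Types (g : nat -> R) (x M : R).

(* The Bernstein operator, written as the expectation of [g] over [n] coin
   tosses with success probability [x], conditioning on the first toss. *)
Fixpoint bern n g x : R :=
  if n is n'.+1 then x * bern n' (fun l => g l.+1) x + (1 - x) * bern n' g x
  else g 0%N.

(** The derivative of [bern n g]: [n] times the Bernstein operator of order [n - 1] on forward
    differences. At [n = 0] the factor [n] makes it 0. *)
Definition dbern n g x : R := n%:R * bern n.-1 (fun l => g l.+1 - g l) x.

Lemma eq_bern n g g' x : (forall l, (l <= n)%N -> g l = g' l) ->
  bern n g x = bern n g' x.
Proof.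
elim: n g g' => [|n IH] g g' h /=; first exact: h.
by rewrite (IH _ (fun l => g' l.+1)) 1?(IH g g')// => l ln; apply: h => //; exact: leqW.
Qed.

Lemma bern_lin n a b g g' x :
  bern n (fun l => a * g l + b * g' l) x = a * bern n g x + b * bern n g' x.
Proof.
elim: n g g' => [//|n IH] g g' /=.
by rewrite (IH (fun l => g l.+1)) IH; ring.
Qed.

Lemma bern_cst n a x : bern n (fun=> a) x = a.
Proof. by elim: n => //= n ->; ring. Qed.

Lemma bernB n g g' x : bern n (fun l => g l - g' l) x = bern n g x - bern n g' x.
Proof.
rewrite -[bern n g x]mul1r -[- bern n g' x]mulN1r -bern_lin.
by apply: eq_bern => l _; ring.
Qed.

Lemma bern_le n g g' x : 0 <= x <= 1 -> (forall l, (l <= n)%N -> g l <= g' l) ->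
  bern n g x <= bern n g' x.
Proof.
move=> /andP[x0 x1]; elim: n g g' => [|n IH] g g' h /=; first exact: h.
by apply: lerD; apply: ler_wpM2l; rewrite ?subr_ge0//; apply: IH => l ln; apply: h => //; exact: leqW.
Qed.

Lemma normr_bern_le n g g' x : 0 <= x <= 1 ->
  (forall l, (l <= n)%N -> `|g l| <= g' l) -> `|bern n g x| <= bern n g' x.
Proof.
move=> x01 h; rewrite ler_norml; apply/andP; split; last first.
  by apply: bern_le => // l ln; rewrite (le_trans (ler_norm _))// h.
rewrite -[- _]mulN1r -[leLHS]addr0 -[X in _ + X](mul0r (bern n (fun=> 0) x)) -bern_lin.
apply: bern_le => // l ln; rewrite mulN1r mul0r addr0 lerNl.
by rewrite (le_trans (ler_norm _))// normrN h.
Qed.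

Lemma normr_bern_ub n g x M : 0 <= x <= 1 ->
  (forall l, (l <= n)%N -> `|g l| <= M) -> `|bern n g x| <= M.
Proof. by move=> x01 h; rewrite -[leRHS](bern_cst n M x); exact: normr_bern_le. Qed.

(** This is the product rule applied to the recursion that defines [bern]; it lets the gradient
    follow the tosses one by one. *)
Lemma dbernS n g x : dbern n.+1 g x =
  bern n (fun l => g l.+1) x - bern n g x +
  x * dbern n (fun l => g l.+1) x + (1 - x) * dbern n g x.
Proof.
rewrite /dbern /=; case: n => [|n] /=; first by ring.
by rewrite !bernB /= -!natr1; ring.
Qed.

(** The shift [c] is what the induction needs, a successful toss replacing [c] by [c + 1]. At
    [c = - n x] it is the binomial variance. *)
Lemma bern_var n x c : bern n (fun l => (l%:R + c) ^+ 2) x =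
  (n%:R * x + c) ^+ 2 + n%:R * x * (1 - x).
Proof.
elim: n c => [|n IH] c /=; first by rewrite !mul0r !add0r addr0.
rewrite (eq_bern (g' := fun l => (l%:R + (c + 1)) ^+ 2)); last first.
  by move=> l _; rewrite -natr1; ring.
by rewrite !IH -natr1; ring.
Qed.

(** Allowing [g n l] to be the value of [F] at a point close to [l / n] covers both the samples of a
    function and, by the mean value theorem, the difference quotients in [dbern]. The proof is
    Chebyshev's inequality. *)
Lemma bern_cvg (F : R -> R) (g : nat -> nat -> R) M x : 0 <= x <= 1 ->
  (forall y, 0 <= y <= 1 -> `|F y| <= M) -> {for x, continuous F} ->
  (forall n l, (l <= n)%N -> exists2 y, 0 <= y <= 1 &
     `|y - l%:R / n%:R| <= n.+1%:R^-1 /\ g n l = F y) ->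
  bern n (g n) x @[n --> \oo] --> F x.
Proof.
move=> x01 FM cF hg.
have M0 : 0 <= M by apply: le_trans (FM _ x01).
apply/cvgrPdist_le => e e0.
have e20 : 0 < e / 2 by rewrite divr_gt0.
have /cvgrPdist_le/(_ _ e20) := cF.
rewrite nearE /= => /nbhs_ballP[del /= del0 hdel].
have near1 : \forall n \near \oo, (n.+1%:R^-1 : R) < del / 2.
  have := @cvg_harmonic R; move=> /cvgrPdist_lt/(_ _ (divr_gt0 del0 (ltr0n _ 2))).
  by apply: filterS => n; rewrite sub0r normrN ger0_norm// invr_ge0.
(* Chosen so that [K (del / 2)^2 = 2 M], the largest possible deviation of [F]. *)
pose K := 8 * M / del ^+ 2.
have K0 : 0 <= K by rewrite divr_ge0 ?sqr_ge0// mulr_ge0.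
have near2 : \forall n \near \oo, K * (n.+1%:R^-1 : R) < e / 4.
  have : (K * (n.+1%:R^-1 : R)) @[n --> \oo] --> (0 : R).
    by rewrite -[X in _ --> X](mulr0 K); apply: cvgM; [exact: cvg_cst|exact: cvg_harmonic].
  move=> /cvgrPdist_lt/(_ _ (divr_gt0 e0 (ltr0n _ 4))).
  by apply: filterS => n; rewrite sub0r normrN ger0_norm// mulr_ge0// invr_ge0.
near=> n.
have n0 : (0 < n)%N by near: n; exists 1%N.
have nR0 : 0 < n%:R :> R by rewrite ltr0n.
rewrite -{1}(bern_cst n (F x) x) -bernB.
(* Pointwise bound by [e / 2] near [x] plus [K (l / n - x)^2] away from it; the average of the
   second term is [K x (1 - x) / n]. *)
apply: (@le_trans _ _ (bern n (fun l => e / 2 * 1 + K / n%:R ^+ 2 * (l%:R + - (n%:R * x)) ^+ 2) x)).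
  apply: normr_bern_le => // l ln.
  have [y y01 [yl ->]] := hg _ _ ln.
  have -> : K / n%:R ^+ 2 * (l%:R + - (n%:R * x)) ^+ 2 = K * (l%:R / n%:R - x) ^+ 2.
    by field; rewrite gt_eqF.
  rewrite mulr1.
  have [lx|lx] := ltP `|l%:R / n%:R - x| (del / 2).
    apply: (@le_trans _ _ (e / 2)); last by rewrite lerDl mulr_ge0// sqr_ge0.
    apply: hdel; rewrite /ball /= distrC.
    have -> : y - x = (y - l%:R / n%:R) + (l%:R / n%:R - x) by ring.
    rewrite (le_lt_trans (ler_normD _ _))// [ltRHS]splitr ltrD//.
    by rewrite (le_lt_trans yl)//; near: n.
  apply: (@le_trans _ _ (K * (l%:R / n%:R - x) ^+ 2)); last by rewrite lerDr ltW.
  apply: (@le_trans _ _ (2 * M)).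
    by rewrite (le_trans (ler_normB _ _))// mulr2n mulrDl mul1r lerD// FM.
  rewrite -[X in K * X]real_normK ?num_real//.
  apply: (@le_trans _ _ (K * (del / 2) ^+ 2)).
    rewrite /K (_ : 8 * M / del ^+ 2 * (del / 2) ^+ 2 = 2 * M)//.
    by field; rewrite gt_eqF.
  by rewrite ler_wpM2l// lerXn2r ?nnegrE// divr_ge0// ltW.
rewrite bern_lin bern_cst bern_var subrr expr0n /= add0r mulr1.
rewrite [leRHS]splitr lerD2l.
apply: (@le_trans _ _ (2 * (K * n.+1%:R^-1))).
  have -> : K / n%:R ^+ 2 * (n%:R * x * (1 - x)) = K * (x * (1 - x)) / n%:R.
    by field; rewrite gt_eqF.
  have -> : 2 * (K / n.+1%:R) = K * (2 / n.+1%:R) by rewrite mulrCA.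
  rewrite -mulrA; apply: ler_wpM2l => //.
  rewrite ler_pdivrMr// mulrAC ler_pdivlMr ?ltr0n//.
  have x41 : x * (1 - x) <= 1 by move: x01 => /andP[? ?]; nra.
  have n1 : 1 <= n%:R :> R by rewrite ler1n.
  by move: x01 => /andP[? ?]; rewrite -natr1; nra.
have : K * n.+1%:R^-1 < e / 4 by near: n.
by move=> h; apply: (@le_trans _ _ (2 * (e / 4))); [rewrite ler_wpM2l// ltW|lra].
Unshelve. all: by end_near. Qed.

Lemma bern_cvg_fun (F : R -> R) M x : 0 <= x <= 1 ->
  (forall y, 0 <= y <= 1 -> `|F y| <= M) -> {for x, continuous F} ->
  bern n (fun l => F (l%:R / n%:R)) x @[n --> \oo] --> F x.
Proof.
move=> x01 FM cF; apply: bern_cvg FM cF _ => // n l ln.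
exists (l%:R / n%:R); last by rewrite subrr normr0 invr_ge0.
rewrite divr_ge0//=; case: n ln => [|n] ln; first by rewrite invr0 mulr0.
by rewrite ler_pdivrMr ?ltr0n// mul1r ler_nat.
Qed.

(** For [l <= n] the fraction [l / n] lies between [l / (n + 1)] and [(l + 1) / (n + 1)], like the
    mean value point, so the two are within [1 / (n + 1)] of each other. *)
Let slope (F dF : R -> R) (n l : nat) : (forall y : R, is_derive y 1 F (dF y)) ->
  (l <= n)%N ->
  exists2 y, 0 <= y <= 1 & `|y - l%:R / n%:R| <= n.+1%:R^-1 /\
    n.+1%:R * (F (l.+1%:R / n.+1%:R) - F (l%:R / n.+1%:R)) = dF y.
Proof.
move=> DF ln.
have n0 : 0 < n.+1%:R :> R by rewrite ltr0n.
have ab : l%:R / n.+1%:R < l.+1%:R / n.+1%:R :> R by rewrite ltr_pM2r ?invr_gt0// ltr_nat.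
have [y] := MVT ab (fun y _ => DF y) (continuous_subspaceT (@is_derive_continuous _ F dF DF)).
rewrite in_itv /= => /andP[ly yl] Fy.
exists y.
  rewrite (le_trans _ (ltW ly)) ?divr_ge0//= (le_trans (ltW yl))//.
  by rewrite ler_pdivrMr// mul1r ler_nat.
split; last by rewrite Fy -natr1; field; rewrite natr1 gt_eqF.
have h1 : l%:R / n.+1%:R <= l%:R / n%:R :> R.
  case: n ln {n0 ab ly yl Fy} => [|n] ln.
    by move: ln; rewrite leqn0 => /eqP ->; rewrite !mul0r.
  by rewrite ler_wpM2l// lef_pV2 ?posrE ?ltr0n// ler_nat.
have h2 : l%:R / n%:R <= l.+1%:R / n.+1%:R :> R.
  case: n ln n0 {ab ly yl Fy h1} => [|n] ln n0.
    by move: ln; rewrite leqn0 => /eqP ->; rewrite mul0r divr_ge0.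
  rewrite ler_pdivrMr ?ltr0n// mulrAC ler_pdivlMr// -!natrM ler_nat.
  by rewrite mulSn mulnS leq_add2r.
have h3 : l.+1%:R / n.+1%:R = l%:R / n.+1%:R + n.+1%:R^-1 :> R by rewrite -natr1 mulrDl mul1r.
have key (a b c e z : R) : b = a + e -> a <= c -> c <= b -> a < z -> z < b ->
    `|z - c| <= e.
  by move=> -> ? ? ? ?; rewrite ler_norml; apply/andP; split; lra.
exact: key h3 h1 h2 ly yl.
Qed.

Lemma dbern_cvg_fun (F dF : R -> R) M x : 0 <= x <= 1 ->
  (forall y : R, is_derive y 1 F (dF y)) ->
  (forall y, 0 <= y <= 1 -> `|dF y| <= M) -> {for x, continuous dF} ->
  dbern n (fun l => F (l%:R / n%:R)) x @[n --> \oo] --> dF x.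
Proof.
move=> x01 DF dFM cdF; rewrite -cvg_shiftS /=.
have := @bern_cvg dF (fun n l => n.+1%:R * (F (l.+1%:R / n.+1%:R) - F (l%:R / n.+1%:R))) M x.
move=> /(_ x01 dFM cdF (fun n l ln => slope DF ln)).
apply: cvg_trans; apply: near_eq_cvg; near=> n.
rewrite /dbern /= -[RHS]addr0 -(mul0r (bern n (fun=> 0) x)) -bern_lin.
by apply: eq_bern => l _; ring.
Unshelve. all: by end_near. Qed.

Lemma dbern_ub (F dF : R -> R) M x n : 0 <= x <= 1 -> 0 <= M ->
  (forall y : R, is_derive y 1 F (dF y)) ->
  (forall y, 0 <= y <= 1 -> `|dF y| <= M) ->
  `|dbern n (fun l => F (l%:R / n%:R)) x| <= M.
Proof.
move=> x01 M0 DF dFM; rewrite /dbern; case: n => [|n]; first by rewrite mul0r normr0.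
rewrite -[X in `|X|]addr0 -(mul0r (bern n (fun=> 0) x)) -bern_lin /=.
apply: normr_bern_ub => // l ln; rewrite mul0r addr0.
by have [y y01 [_ ->]] := slope DF ln; exact: dFM.
Qed.

End bernstein.

Lemma cvg_sum_seq (R : realType) (I : Type) (s : seq I) (f : I -> nat -> R) (l : I -> R) :
  (forall i, f i n @[n --> \oo] --> l i) ->
  \sum_(i <- s) f i n @[n --> \oo] --> \sum_(i <- s) l i.
Proof.
move=> fl; elim: s => [|a s IH].
  by under eq_fun do rewrite big_nil; rewrite big_nil; exact: cvg_cst.
by under eq_fun do rewrite big_cons; rewrite big_cons; exact: cvgD.
Qed.

(** * Gaussian integration by parts *)

Section row_vectors.
Context {R : realType} {k : nat}.
Implicit Types (x v : 'rV[R]_k).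

Lemma row_norm_le x (M : R) : 0 <= M -> (forall i, `|x 0 i| <= M) -> `|x| <= M.
Proof.
move=> M0 h; rewrite /Num.norm /= mx_normrE; apply/bigmax_leP; split => //.
by move=> [i j] _ /=; rewrite (ord1 i).
Qed.

Lemma row_coord_le x i : `|x 0 i| <= `|x|.
Proof.
rewrite [leRHS]/Num.norm /= mx_normrE.
exact: (le_bigmax _ (fun ij : 'I_1 * 'I_k => `|x ij.1 ij.2|) (0, i)).
Qed.

Lemma cvg_row (f : nat -> 'rV[R]_k) x :
  (forall i, f n 0 i @[n --> \oo] --> x 0 i) -> f n @[n --> \oo] --> x.
Proof.
move=> h; apply/cvgrPdist_le => e e0.
have : \forall n \near \oo, forall i, `|x 0 i - f n 0 i| <= e.
  by apply: filter_forall => i; have /cvgrPdist_le/(_ e e0) := h i.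
apply: filterS => n hn; apply: row_norm_le; first exact: ltW.
by move=> i; rewrite !mxE.
Qed.

Lemma is_derive_along (f : 'rV[R]_k -> R) x v (t df : R) :
  is_derive (x + t *: v) v f df -> is_derive t 1 (fun t => f (x + t *: v)) df.
Proof.
move=> [dfx dfE].
have E : (fun h : R => h^-1 *: (((fun t => f (x + t *: v)) \o shift t) (h *: 1) - f (x + t *: v))) =
    (fun h : R => h^-1 *: ((f \o shift (x + t *: v)) (h *: v) - f (x + t *: v))).
  apply/funext => h; congr (_ *: (_ - _)) => /=; congr (f _).
  by rewrite [h *: 1]mulr1 scalerDl addrCA.
by split; [rewrite /derivable E|rewrite -dfE /derive E].
Qed.

End row_vectors.

Definition c1pg (R : realType) (k : nat) (phi : 'rV[R]_k -> R)
    (dphi : 'I_k -> 'rV[R]_k -> R) : Prop :=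
  [/\ forall x i, is_derive x (delta_mx 0 i) phi (dphi i x),
      continuous phi, (forall i, continuous (dphi i)) &
      exists (c : R) (m : nat), 0 <= c /\ forall x,
        `|phi x| <= c * (1 + `|x|) ^+ m /\
        forall i, `|dphi i x| <= c * (1 + `|x|) ^+ m].

Lemma dot_suml (R : realType) (H : completeNormedModType R) (dot : {dot H for idfun})
    (I : Type) (s : seq I) (f : I -> H) (y : H) :
  dot (\sum_(i <- s) f i) y = \sum_(i <- s) dot (f i) y.
Proof. by rewrite linear_sumlz. Qed.

Section gaussian_ibp.
Context {R : realType} {H : completeNormedModType R}.
Variable dot : {dot H for idfun}.
Context {d : measure_display} {T : measurableType d} {P : probability T R}.
Variable X : H -> {RV P >-> R}.
Hypothesis isoX : isonormal dot X.
Context {k : nat}.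
Variables (hs : 'I_k -> H) (h : H).

Let Y (w : T) : 'rV[R]_k := \row_i X (hs i) w.

(** [D i] stands for the partial derivatives, but nothing ties it to [Phi]. The relation is
    therefore linear and closed under dominated pointwise limits of the pair; [Z] supplies the
    domination. *)
Definition ibp (Phi : T -> R) (D : 'I_k -> T -> R) : Prop :=
  [/\ measurable_fun setT Phi, (forall i, measurable_fun setT (D i)),
      exists2 Z, mom P Z & forall w, `|Phi w| <= Z w /\ forall i, `|D i w| <= Z w &
      Ex P (fun w => Phi w * X h w) = \sum_i dot (hs i) h * Ex P (D i)].

Lemma ibp_mom Phi D : ibp Phi D -> mom P Phi /\ forall i, mom P (D i).
Proof.
move=> [mPhi mD [Z Zm hZ] _]; split => [|i]; apply: mom_dom Zm => // w.
  by rewrite (le_trans (hZ w).1)// ler_norm.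
by rewrite (le_trans ((hZ w).2 i))// ler_norm.
Qed.

Lemma eq_ibp Phi D Phi' D' : Phi =1 Phi' -> (forall i, D i =1 D' i) ->
  ibp Phi D -> ibp Phi' D'.
Proof.
move=> /funext -> DD'.
by have -> : D = D' by apply/funext => i; exact/funext/DD'.
Qed.

Lemma ibp_lin (a b : R) Phi D Phi' D' : ibp Phi D -> ibp Phi' D' ->
  ibp (fun w => a * Phi w + b * Phi' w) (fun i w => a * D i w + b * D' i w).
Proof.
move=> IP IP'; have [Pm Dm] := ibp_mom IP; have [Pm' Dm'] := ibp_mom IP'.
have Xm := X_mom isoX h.
move: IP IP' => [mP mD [Z Zm hZ] IP] [mP' mD' [Z' Zm' hZ'] IP'].
split.
- by apply: measurable_funD; exact: measurable_funM.
- by move=> i; apply: measurable_funD; exact: measurable_funM.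
- exists (fun w => `|a| * Z w + `|b| * Z' w); first by apply: momD; exact: momZ.
  move=> w; split=> [|i]; rewrite (le_trans (ler_normD _ _))// !normrM lerD// ler_wpM2l//.
  + exact: (hZ w).1.
  + exact: (hZ' w).1.
  + exact: (hZ w).2.
  + exact: (hZ' w).2.
- transitivity (a * Ex P (fun w => Phi w * X h w) + b * Ex P (fun w => Phi' w * X h w)).
    rewrite -!ExZ; [|by apply/mom_intg/momM..].
    rewrite -ExD; [|by apply/intgZ/mom_intg/momM..].
    by apply: eq_Ex => w; ring.
  rewrite IP IP' !mulr_sumr -big_split; apply: eq_bigr => i _ /=.
  rewrite ExD; [|by apply/intgZ/mom_intg..].
  by rewrite !ExZ; [ring|exact: mom_intg..].
Qed.

Lemma ibp_lim (Phi_ : nat -> T -> R) (D_ : nat -> 'I_k -> T -> R) Phi D Z :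
  (forall n, ibp (Phi_ n) (D_ n)) -> mom P Z ->
  (forall n w, `|Phi_ n w| <= Z w) -> (forall n i w, `|D_ n i w| <= Z w) ->
  (forall w, Phi_ n w @[n --> \oo] --> Phi w) ->
  (forall i w, D_ n i w @[n --> \oo] --> D i w) -> ibp Phi D.
Proof.
move=> In Zm bP bD cP cD.
have Xm := X_mom isoX h.
have mP : measurable_fun setT Phi.
  by apply: (@measurable_fun_cvg _ _ _ _ Phi_) => [n|w _]; [by case: (In n)|exact: cP].
have mD i : measurable_fun setT (D i).
  by apply: (@measurable_fun_cvg _ _ _ _ (fun n => D_ n i)) => [n|w _]; [by case: (In n)|exact: cD].
split => //.
  exists Z => // w; split => [|i].
    by apply: (cvgr_to_le (cvg_norm (cP w))); near=> n; exact: bP.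
  by apply: (cvgr_to_le (cvg_norm (cD i w))); near=> n; exact: bD.
have [|w|n w||_ c1] := @Ex_dct _ _ _ P (fun n w => Phi_ n w * X h w)
    (fun w => Phi w * X h w) (fun w => Z w * `|X h w|).
- by move=> n; apply: measurable_funM; [by case: (In n)|exact: Xm.1].
- by apply: cvgM; [exact: cP|exact: cvg_cst].
- by rewrite normrM ler_wpM2r.
- by apply/mom_intg/momM => //; exact: mom_abs.
have c2 : \sum_i dot (hs i) h * Ex P (D_ n i) @[n --> \oo] -->
    \sum_i dot (hs i) h * Ex P (D i).
  apply: cvg_sum_seq => i; apply: cvgM; first exact: cvg_cst.
  have [n|w|n w||//] := @Ex_dct _ _ _ P (fun n => D_ n i) (D i) Z.
  - by case: (In n).
  - exact: cD.
  - exact: bD.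
  - exact: mom_intg.
apply: cvg_unique c1 _ => //.
by move: c2; apply: cvg_trans; apply: near_eq_cvg; near=> n; case: (In n).
Unshelve. all: by end_near. Qed.

(** Linear combinations of cosines of affine forms, paired with their gradients so that a single
    induction treats both. *)
Inductive trig : ('rV[R]_k -> R) -> ('I_k -> 'rV[R]_k -> R) -> Prop :=
| trig0 : trig (fun=> 0) (fun _ _ => 0)
| trig_cos (a : 'I_k -> R) (b : R) :
    trig (fun x => cos (\sum_i a i * x 0 i + b))
         (fun i x => - (a i * sin (\sum_i a i * x 0 i + b)))
| trig_lin (r : R) Th dTh Th' dTh' : trig Th dTh -> trig Th' dTh' ->
    trig (fun x => r * Th x + Th' x) (fun i x => r * dTh i x + dTh' i x).

Lemma eq_trig Th dTh Th' dTh' : Th =1 Th' -> (forall i, dTh i =1 dTh' i) ->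
  trig Th dTh -> trig Th' dTh'.
Proof.
move=> /funext -> DD'.
by have -> : dTh = dTh' by apply/funext => i; exact/funext/DD'.
Qed.

Lemma trig_bound Th dTh : trig Th dTh -> exists2 K, 0 <= K &
  forall x, `|Th x| <= K /\ forall i, `|dTh i x| <= K.
Proof.
elim=> [|a b|r {}Th {}dTh Th' dTh' _ [K K0 hK] _ [K' K'0 hK']].
- by exists 0 => // x; split=> [|i]; rewrite normr0.
- exists (1 + \sum_i `|a i|); first by rewrite addr_ge0// sumr_ge0.
  move=> x; split => [|i].
    by rewrite (le_trans (cos_max _))// lerDl sumr_ge0.
  rewrite normrN normrM (le_trans (ler_piMr _ (sin_max _)))//.
  by rewrite (bigD1 i)//= addrCA lerDl addr_ge0// sumr_ge0.
- exists (`|r| * K + K'); first by rewrite addr_ge0// mulr_ge0.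
  move=> x; split => [|i]; rewrite (le_trans (ler_normD _ _))// normrM lerD// ?ler_wpM2l//.
  + exact: (hK x).1.
  + exact: (hK' x).1.
  + exact: (hK x).2.
  + exact: (hK' x).2.
Qed.

Lemma trig_ibpP Th dTh : trig Th dTh -> ibp (fun w => Th (Y w)) (fun i w => dTh i (Y w)).
Proof.
elim=> [|a b|r {}Th {}dTh Th' dTh' _ I1 _ I2].
- split => //; first by exists (fun=> 0); [exact: mom_cst|move=> w; split=> [|i]; rewrite normr0].
  rewrite big1 => [|i _]; last by rewrite Ex_cst mulr0.
  by rewrite -[RHS](Ex_cst P); apply: eq_Ex => w; rewrite mul0r.
- pose l := [seq (a i, hs i) | i <- enum 'I_k].
  have lE w : \sum_i a i * (Y w) 0 i = lc X l w.
    rewrite /lc /l big_map enumT; apply: eq_bigr => i _; by rewrite mxE.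
  have lvE : lv l = \sum_i a i *: hs i by rewrite /lv /l big_map enumT.
  have ml : measurable_fun setT (fun w => lc X l w + b).
    by apply: measurable_funD => //; exact: measurable_lc.
  have mc : measurable_fun setT (fun w => cos (\sum_i a i * (Y w) 0 i + b)).
    under eq_fun do rewrite lE.
    by apply: (measurableT_comp (f := cos)) => //; apply: continuous_measurable_fun; exact: continuous_cos.
  have ms : measurable_fun setT (fun w => sin (\sum_i a i * (Y w) 0 i + b)).
    under eq_fun do rewrite lE.
    by apply: (measurableT_comp (f := sin)) => //; apply: continuous_measurable_fun; exact: continuous_sin.
  have sint : intg P (fun w => sin (\sum_i a i * (Y w) 0 i + b)).
    by apply: (@intg_dom _ _ _ _ _ (fun=> 1)) => //; [move=> w; exact: sin_max|exact: intg_cst].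
  split => //.
  + by move=> i; apply: measurable_funN; apply: measurable_funM.
  + have [K K0 hK] := trig_bound (trig_cos a b).
    by exists (fun=> K); [exact: mom_cst|move=> w; exact: hK].
  + transitivity (Ex P (fun w => cos (lc X l w + b) * X h w)).
      by apply: eq_Ex => w; rewrite lE.
    rewrite (trig_ibp isoX) lvE dot_suml mulr_suml -sumrN; apply: eq_bigr => i _.
    rewrite dotZl ExN; last exact: intgZ.
    rewrite ExZ// (_ : Ex P (fun w => sin (lc X l w + b)) = Ex P (fun w => sin (\sum_i a i * (Y w) 0 i + b))).
      by ring.
    by apply: eq_Ex => w; rewrite lE.
- apply: eq_ibp (ibp_lin r 1 I1 I2) => [w|i w]; by rewrite mul1r.
Qed.

(** [s] takes values in [[0, 1]], so it can serve as the success probability of a Bernstein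
    operator; [ds] is its partial derivative in coordinate [j]. *)
Let s (L : R) (j : 'I_k) (x : 'rV[R]_k) : R := (1 + sin (x 0 j / L)) / 2.
Let ds (L : R) (j : 'I_k) (x : 'rV[R]_k) : R := cos (x 0 j / L) / (2 * L).

Let s01 L j x : 0 <= s L j x <= 1.
Proof.
have := sin_max (x 0 j / L); rewrite ler_norml => /andP[? ?].
by apply/andP; split; rewrite /s; lra.
Qed.

(** Product formula: [cos a (1 + sin b) / 2] is [cos a / 2] plus a quarter of [cos (a + b - pi / 2)
    + cos (a - b + pi / 2)]. *)
Lemma trig_mul_sin (L : R) (j : 'I_k) Th dTh : trig Th dTh ->
  trig (fun x => Th x * s L j x)
    (fun i x => dTh i x * s L j x + Th x * (if i == j then ds L j x else 0)).
Proof.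
have sumE (a : 'I_k -> R) (e : R) (x : 'rV[R]_k) :
    \sum_i (a i + (if i == j then e / L else 0)) * x 0 i =
    \sum_i a i * x 0 i + e * (x 0 j / L).
  under eq_bigr do rewrite mulrDl.
  rewrite big_split /=; congr (_ + _).
  rewrite (bigD1 j)//= eqxx big1 ?addr0 => [|i /negbTE ->]; last by rewrite mul0r.
  by rewrite mulrAC mulrA.
elim=> [|a b|r {}Th {}dTh Th' dTh' _ I1 _ I2].
- by apply: eq_trig trig0 => [x|i x]; rewrite !mul0r ?addr0.
- pose a1 i := a i + (if i == j then 1 / L else 0).
  pose a2 i := a i + (if i == j then (- 1) / L else 0).
  have := trig_lin 2^-1 (trig_cos a b) (trig_lin 4^-1 (trig_cos a1 (b - pi / 2))
    (trig_lin 4^-1 (trig_cos a2 (b + pi / 2)) trig0)).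
  have E1 (al be : R) : al + be + (b - pi / 2) = (al + b) + be - pi / 2 by ring.
  have E2 (al be : R) : al + be + (b + pi / 2) = (al + b) + be + pi / 2 by ring.
  apply: eq_trig => [x|i x]; rewrite !sumE E1 E2 !(cosBpihalf, cosDpihalf, sinBpihalf, sinDpihalf)
    mul1r mulN1r !(sinD, cosD, sinN, cosN) /s /ds /a1 /a2.
    by field.
  case: eqP => _; last by field.
  have [->|L0] := eqVneq L 0; first by rewrite mulr0 invr0 !mulr0; field.
  by field.
- apply: eq_trig (trig_lin r I1 I2) => [x|i x]; ring.
Qed.

Lemma trig_mul_onem_sin (L : R) (j : 'I_k) Th dTh : trig Th dTh ->
  trig (fun x => Th x * (1 - s L j x))
    (fun i x => dTh i x * (1 - s L j x) - Th x * (if i == j then ds L j x else 0)).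
Proof.
move=> t; have := trig_lin (-1) (trig_mul_sin L j t) t.
by apply: eq_trig => [x|i x]; ring.
Qed.

Variables (phi : 'rV[R]_k -> R) (dphi : 'I_k -> 'rV[R]_k -> R).
Hypothesis phi_c1 : c1pg phi dphi.

(** The first [j] coordinates of [x] are replaced by [L sin (x_i / L)], the others by those of [v];
    increasing [j] frees the coordinates one at a time. *)
Let u (L : R) (j : nat) (x v : 'rV[R]_k) : 'rV[R]_k :=
  \row_i if (i < j)%N then L * sin (x 0 i / L) else v 0 i.
Let upd (v : 'rV[R]_k) (j : 'I_k) (t : R) : 'rV[R]_k :=
  \row_i if i == j then t else v 0 i.

(** The multiplier [Th] is part of the statement because each toss in the Bernstein recursion
    multiplies it by [s] or [1 - s]. The factor [cos (x_i / L)] is the derivative of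
    [L sin (x_i / L)]. *)
Let Q L j := forall Th dTh v, trig Th dTh ->
  ibp (fun w => Th (Y w) * phi (u L j (Y w) v))
      (fun i w => dTh i (Y w) * phi (u L j (Y w) v) +
         Th (Y w) * (if (i < j)%N then dphi i (u L j (Y w) v) * cos ((Y w) 0 i / L) else 0)).

Let Q0 L : Q L 0.
Proof.
move=> Th dTh v t; have u0 x : u L 0 x v = v by apply/rowP => i; rewrite mxE.
apply: eq_ibp (ibp_lin (phi v) 0 (trig_ibpP t) (trig_ibpP t)) => [w|i w]; rewrite u0.
  by ring.
by rewrite ltn0 mulr0 addr0; ring.
Qed.

Let Q_bern L (j : 'I_k) : Q L j -> forall n (V : nat -> 'rV[R]_k) Th dTh,
  trig Th dTh ->
  ibp (fun w => Th (Y w) * bern n (fun l => phi (u L j (Y w) (V l))) (s L j (Y w)))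
      (fun i w => dTh i (Y w) * bern n (fun l => phi (u L j (Y w) (V l))) (s L j (Y w)) +
         Th (Y w) *
         ((if (i < j)%N then bern n (fun l => dphi i (u L j (Y w) (V l))) (s L j (Y w))
              * cos ((Y w) 0 i / L) else 0) +
          (if i == j then ds L j (Y w) *
            dbern n (fun l => phi (u L j (Y w) (V l))) (s L j (Y w)) else 0))).
Proof.
move=> Qj; elim=> [|n IH] V Th dTh t.
  apply: eq_ibp (Qj _ _ (V 0%N) t) => [w|i w] //=.
  by rewrite /dbern mul0r mulr0 if_same addr0.
have I1 := IH (fun l => V l.+1) _ _ (trig_mul_sin L j t).
have I2 := IH V _ _ (trig_mul_onem_sin L j t).
apply: eq_ibp (ibp_lin 1 1 I1 I2) => [w|i w] /=; first by ring.
by rewrite dbernS; case: (i < j)%N; case: (i == j); ring.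
Qed.

Let path_line L (j : 'I_k) x v t :
  u L j x (upd v j t) = u L j x (upd v j 0) + t *: delta_mx 0 j.
Proof.
apply/rowP => i; rewrite !mxE eqxx /= eq_sym.
by case: eqP => [->|_]; rewrite ?ltnn ?mulr1 ?add0r// mulr0 addr0.
Qed.

Let path_next L (j : 'I_k) x v :
  u L j x (upd v j (L * sin (x 0 j / L))) = u L j.+1 x v.
Proof.
apply/rowP => i; rewrite !mxE ltnS [in RHS]leq_eqVlt.
have [->|ij] := eqVneq i j; first by rewrite ltnn eqxx.
by rewrite (_ : (i == j :> nat) = false)//; exact/negbTE.
Qed.

Let path_bound L (j : 'I_k) x v tau : 0 < L -> 0 <= tau <= 1 ->
  `|u L j x (upd v j (L * (2 * tau - 1)))| <= L + `|v|.
Proof.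
move=> L0 /andP[t0 t1]; apply: row_norm_le; first by rewrite addr_ge0// ltW.
move=> i; rewrite !mxE; case: ifP => _.
  rewrite normrM gtr0_norm// (le_trans (ler_piMr (ltW L0) (sin_max _)))//.
  by rewrite lerDl.
case: eqP => _; last by rewrite (le_trans (row_coord_le v i))// lerDr ltW.
rewrite normrM gtr0_norm// -[leLHS]addr0 lerD// ler_piMr ?(ltW L0)//.
by rewrite ler_norml; apply/andP; split; lra.
Qed.

(** Coordinate [j] is freed by approximating [phi] along it with Bernstein polynomials in [s]. These
    converge together with their derivatives, and all values stay bounded because the coordinate
    remains in [[- L, L]]. *)
Let Q_step L (j : 'I_k) : 0 < L -> Q L j -> Q L j.+1.
Proof.
move=> L0 Qj Th dTh v t.
have [Dphi cphi cdphi [c [m [c0 bphi]]]] := phi_c1.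
have [K K0 hK] := trig_bound t.
pose M := c * (1 + (L + `|v|)) ^+ m.
have pow_le (x : 'rV[R]_k) : `|x| <= L + `|v| -> c * (1 + `|x|) ^+ m <= M.
  move=> xL; rewrite ler_wpM2l// lerXn2r ?nnegrE ?addr_ge0//; last by rewrite lerD2l.
  exact: ltW.
have M0 : 0 <= M by rewrite mulr_ge0// exprn_ge0// !addr_ge0// ltW.
(* As [tau] runs over [[0, 1]] coordinate [j] runs over [[- L, L]]; at [tau = s L j x] it equals
   [L sin (x_j / L)], the value wanted for [j + 1]. *)
pose pth x tau := u L j x (upd v j (L * (2 * tau - 1))).
have bF x tau : 0 <= tau <= 1 -> `|phi (pth x tau)| <= M.
  by move=> t01; rewrite (le_trans (bphi _).1)// pow_le// path_bound.
have bdF i x tau : 0 <= tau <= 1 -> `|dphi i (pth x tau)| <= M.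
  by move=> t01; rewrite (le_trans ((bphi _).2 i))// pow_le// path_bound.
have cpth x : continuous (pth x).
  have -> : pth x = fun tau => u L j x (upd v j 0) + (L * (2 * tau - 1)) *: delta_mx 0 j.
    by apply/funext => tau; rewrite /pth path_line.
  move=> tau; apply: cvgD; first exact: cvg_cst.
  apply: cvgZr_tmp.
  by apply: cvgM; [exact: cvg_cst|apply: cvgB; [apply: cvgM; [exact: cvg_cst|exact: cvg_id]|exact: cvg_cst]].
have DF x (tau : R) : is_derive tau 1 (fun tau => phi (pth x tau)) (2 * L * dphi j (pth x tau)).
  have -> : (fun tau => phi (pth x tau)) =
      (fun r => phi (u L j x (upd v j 0) + r *: delta_mx 0 j)) \o (fun tau => L * (2 * tau - 1)).
    by apply/funext => y; rewrite /pth /= path_line.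
  have D1 : is_derive (L * (2 * tau - 1)) 1
      (fun r => phi (u L j x (upd v j 0) + r *: delta_mx 0 j)) (dphi j (pth x tau)).
    by apply: is_derive_along; rewrite -path_line; exact: Dphi.
  apply: is_derive_eq; rewrite /GRing.scale /=; ring.
have pthS x : pth x (s L j x) = u L j.+1 x v.
  rewrite /pth -path_next /s; congr (u _ _ _ (upd _ _ (L * _))).
  by field.
(* The nodes of the Bernstein grid on this path. *)
pose V n l := upd v j (L * (2 * (l%:R / n%:R) - 1)).
have frac01 n l : (l <= n)%N -> 0 <= l%:R / n%:R <= (1 : R).
  move=> ln; rewrite divr_ge0//=; case: n ln => [|n] ln; first by rewrite invr0 mulr0.
  by rewrite ler_pdivrMr ?ltr0n// mul1r ler_nat.
have L20 : 0 <= 2 * L by rewrite mulr_ge0// ltW.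
have bdF2 x y : 0 <= y <= 1 -> `|2 * L * dphi j (pth x y)| <= 2 * L * M.
  by move=> y01; rewrite normrM (ger0_norm L20) ler_wpM2l// bdF.
have bb n x : `|bern n (fun l => phi (u L j x (V n l))) (s L j x)| <= M.
  by apply: normr_bern_ub => // l ln; apply: bF; exact: frac01.
have bbd n i x : `|bern n (fun l => dphi i (u L j x (V n l))) (s L j x)| <= M.
  by apply: normr_bern_ub => // l ln; apply: bdF; exact: frac01.
have bdb n x : `|ds L j x * dbern n (fun l => phi (u L j x (V n l))) (s L j x)| <= M.
  rewrite normrM.
  apply: (@le_trans _ _ ((2 * L)^-1 * (2 * L * M))).
    apply: ler_pM => //.
      rewrite /ds normrM normfV (ger0_norm L20) ler_piMl ?invr_ge0//.
      exact: cos_max.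
    apply: (@dbern_ub _ (fun tau => phi (pth x tau)) (fun tau => 2 * L * dphi j (pth x tau))) => //.
    - by rewrite mulr_ge0.
    - exact: bdF2.
  by rewrite mulKf// mulf_neq0// gt_eqF.
apply: (@ibp_lim
  (fun n w => Th (Y w) * bern n (fun l => phi (u L j (Y w) (V n l))) (s L j (Y w)))
  (fun n i w => dTh i (Y w) * bern n (fun l => phi (u L j (Y w) (V n l))) (s L j (Y w)) +
         Th (Y w) *
         ((if (i < j)%N then bern n (fun l => dphi i (u L j (Y w) (V n l))) (s L j (Y w))
              * cos ((Y w) 0 i / L) else 0) +
          (if i == j then ds L j (Y w) *
            dbern n (fun l => phi (u L j (Y w) (V n l))) (s L j (Y w)) else 0)))
  _ _ (fun=> K * M + K * (M + M))).
- by move=> n; exact: Q_bern.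
- exact: mom_cst.
- move=> n w; rewrite normrM (@le_trans _ _ (K * M))//.
    by apply: ler_pM => //; exact: (hK _).1.
  by rewrite lerDl mulr_ge0// addr_ge0.
- move=> n i w; rewrite (le_trans (ler_normD _ _))// lerD//.
    by rewrite normrM; apply: ler_pM => //; exact: (hK _).2.
  rewrite normrM; apply: ler_pM => //; first exact: (hK _).1.
  rewrite (le_trans (ler_normD _ _))// lerD//.
    case: ifP => _; last by rewrite normr0.
    rewrite normrM -[leRHS]mulr1; apply: ler_pM => //; exact: cos_max.
  by case: ifP => _; [exact: bdb|rewrite normr0].
- move=> w; apply: cvgM; first exact: cvg_cst.
  rewrite -pthS; apply: (@bern_cvg_fun _ (fun tau => phi (pth (Y w) tau)) M) => //.
  + exact: bF.
  + by apply: continuous_comp; [exact: cpth|exact: cphi].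
- move=> i w; apply: cvgD; apply: cvgM; try exact: cvg_cst.
    rewrite -pthS; apply: (@bern_cvg_fun _ (fun tau => phi (pth (Y w) tau)) M) => //.
    + exact: bF.
    + by apply: continuous_comp; [exact: cpth|exact: cphi].
  rewrite -pthS (_ : (i < j.+1)%N = (i == j) || (i < j)%N); last by rewrite ltnS leq_eqVlt.
  have [->|ij] := eqVneq i j.
    rewrite ltnn /=; under eq_fun do rewrite add0r.
    have -> : dphi j (pth (Y w) (s L j (Y w))) * cos (Y w 0 j / L) =
        ds L j (Y w) * (2 * L * dphi j (pth (Y w) (s L j (Y w)))).
      by rewrite /ds; field; rewrite gt_eqF.
    apply: cvgM; first exact: cvg_cst.
    apply: (@dbern_cvg_fun _ (fun tau => phi (pth (Y w) tau))
      (fun tau => 2 * L * dphi j (pth (Y w) tau)) (2 * L * M)) => //.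
    + exact: bdF2.
    + apply: cvgM; first exact: cvg_cst.
      by apply: continuous_comp; [exact: cpth|exact: cdphi].
  rewrite /=.
  under eq_fun do rewrite addr0.
  case: ifP => _; last exact: cvg_cst.
  apply: cvgM; last exact: cvg_cst.
  apply: (@bern_cvg_fun _ (fun tau => dphi i (pth (Y w) tau)) M) => //.
  + exact: bdF.
  + by apply: continuous_comp; [exact: cpth|exact: cdphi].
Qed.

(** Since [|L sin (t / L)| <= |t|], the growth bound on [phi] and its gradient, taken at the
    Gaussian vector itself, dominates every approximation uniformly in [L]. *)
Theorem gaussian_ibp : ibp (fun w => phi (Y w)) (fun i w => dphi i (Y w)).
Proof.
have [Dphi cphi cdphi [c [m [c0 bphi]]]] := phi_c1.
have QL L j : 0 < L -> (j <= k)%N -> Q L j.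
  move=> L0; elim: j => [_|j IH jk]; first exact: Q0.
  exact: (Q_step (j := Ordinal jk) L0 (IH (ltnW jk))).
have t1 : trig (fun=> 1) (fun _ _ => 0).
  apply: eq_trig (trig_cos (fun=> 0) 0) => [x|i x].
    by rewrite big1 ?addr0 ?cos0// => i _; rewrite mul0r.
  by rewrite mul0r oppr0.
pose N (w : T) : R := c * (1 + \sum_i `|X (hs i) w|) ^+ m.
have YN (w : T) (x : 'rV[R]_k) : (forall i, `|x 0 i| <= `|X (hs i) w|) ->
    c * (1 + `|x|) ^+ m <= N w.
  move=> xX; have sum0 : 0 <= \sum_i `|X (hs i) w| by exact: sumr_ge0.
  rewrite ler_wpM2l// lerXn2r ?nnegrE ?addr_ge0// lerD2l.
  apply: row_norm_le => // i; rewrite (le_trans (xX i))// (bigD1 i)//= lerDl.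
  exact: sumr_ge0.
have Yv L j w : (j <= k)%N -> 0 < L -> forall i, `|u L k (Y w) 0 0 i| <= `|X (hs i) w|.
  move=> jk L0 i; rewrite !mxE ltn_ord normrM gtr0_norm// -ler_pdivlMl//.
  by rewrite (le_trans (normr_sin_le _))// normrM normfV (gtr0_norm L0) mulrC.
have L0 n : 0 < n.+1%:R :> R by rewrite ltr0n.
have cu w : u n.+1%:R k (Y w) 0 @[n --> \oo] --> Y w.
  apply: cvg_row => i.
  have -> : (fun n => u n.+1%:R k (Y w) 0 0 i) = (fun n => n.+1%:R * sin (n.+1%:R^-1 * (Y w) 0 i)).
    by apply/funext => n; rewrite !mxE ltn_ord [X in sin X]mulrC.
  exact: cvg_sin_scaled.
apply: (@ibp_lim (fun n w => phi (u n.+1%:R k (Y w) 0))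
  (fun n i w => dphi i (u n.+1%:R k (Y w) 0) * cos ((Y w) 0 i / n.+1%:R)) _ _ N).
- move=> n; apply: eq_ibp (QL n.+1%:R k (L0 n) (leqnn k) _ _ 0 t1) => [w|i w].
    by rewrite mul1r.
  by rewrite ltn_ord mul0r add0r mul1r.
- apply/momZ/momX/momD; first exact: mom_cst.
  by apply: mom_sum => i; apply: mom_abs; exact: X_mom isoX _.
- move=> n w; rewrite (le_trans (bphi _).1)//; apply: YN.
  exact: Yv (leqnn k) (L0 n).
- move=> n i w; rewrite normrM (le_trans (ler_piMr _ (cos_max _)))//.
  rewrite (le_trans ((bphi _).2 i))//; apply: YN.
  exact: Yv (leqnn k) (L0 n).
- by move=> w; apply: (cvg_comp _ _ (cu w)); exact: cphi.
- move=> i w; rewrite -[X in _ --> X]mulr1; apply: cvgM.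
    by apply: (cvg_comp _ _ (cu w)); exact: cdphi.
  rewrite -[X in _ --> X](@cos0 R); have : (Y w) 0 i / n.+1%:R @[n --> \oo] --> (0 : R).
    rewrite -[X in _ --> X](mulr0 ((Y w) 0 i)).
    by apply: cvgM; [exact: cvg_cst|exact: cvg_harmonic].
  by move=> /cvg_comp; apply; exact: continuous_cos.
Qed.

End gaussian_ibp.

(** * Cylindrical functionals *)

Section polynomial_growth.
Context {R : realType} {k : nat}.
Implicit Types (f g : 'rV[R]_k -> R).

Definition pgrowth f := exists (c : R) (m : nat),
  0 <= c /\ forall x, `|f x| <= c * (1 + `|x|) ^+ m.

Let ge1 (x : 'rV[R]_k) : 1 <= 1 + `|x|. Proof. by rewrite lerDl. Qed.

Let pow_ge0 (x : 'rV[R]_k) m : 0 <= (1 + `|x|) ^+ m.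
Proof. by rewrite exprn_ge0// addr_ge0. Qed.

Lemma pgrowth_cst (a : R) : pgrowth (fun=> a).
Proof. by exists `|a|, 0%N; split => // x; rewrite expr0 mulr1. Qed.

Lemma pgrowthD f g : pgrowth f -> pgrowth g -> pgrowth (fun x => f x + g x).
Proof.
move=> [c [m [c0 fc]]] [c' [m' [c'0 gc']]].
exists (c + c'), (m + m')%N; split; first exact: addr_ge0.
move=> x; rewrite (le_trans (ler_normD _ _))// mulrDl lerD//.
  by rewrite (le_trans (fc x))// ler_wpM2l// ler_weXn2l// leq_addr.
by rewrite (le_trans (gc' x))// ler_wpM2l// ler_weXn2l// leq_addl.
Qed.

Lemma pgrowthM f g : pgrowth f -> pgrowth g -> pgrowth (fun x => f x * g x).
Proof.
move=> [c [m [c0 fc]]] [c' [m' [c'0 gc']]].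
exists (c * c'), (m + m')%N; split; first exact: mulr_ge0.
by move=> x; rewrite normrM exprD mulrACA; exact: ler_pM.
Qed.

Lemma pgrowth_coord i : pgrowth (fun x => x 0 i).
Proof.
exists 1, 1%N; split => // x; rewrite mul1r expr1 (le_trans (row_coord_le x i))//.
by rewrite lerDr.
Qed.

Lemma c1pgI f (df : 'I_k -> 'rV[R]_k -> R) :
  (forall x i, is_derive x (delta_mx 0 i) f (df i x)) -> continuous f ->
  (forall i, continuous (df i)) -> pgrowth f -> (forall i, pgrowth (df i)) ->
  c1pg f df.
Proof.
move=> Df cf cdf [c [m [c0 fc]]] pdf; split => //.
have [c' hc'] := choice pdf; have [m' hm'] := choice hc'.
exists (c + \sum_i c' i), (m + \sum_i m' i)%N.
have s0 : 0 <= \sum_i c' i by apply: sumr_ge0 => i _; exact: (hm' i).1.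
split; first exact: addr_ge0.
move=> x; split => [|i].
  rewrite (le_trans (fc x))// ler_pM//; first by rewrite lerDl.
  by rewrite ler_weXn2l// leq_addr.
rewrite (le_trans ((hm' i).2 x))// ler_pM//; first exact: (hm' i).1.
  rewrite (bigD1 i)//= addrCA lerDl addr_ge0// sumr_ge0// => j _.
  exact: (hm' j).1.
by rewrite ler_weXn2l// (bigD1 i)//= addnCA leq_addr.
Qed.

Lemma c1pgE f df : c1pg f df ->
  [/\ forall x i, is_derive x (delta_mx 0 i) f (df i x), continuous f,
      (forall i, continuous (df i)), pgrowth f & forall i, pgrowth (df i)].
Proof.
move=> [Df cf cdf [c [m [c0 h]]]]; split => // [|i]; exists c, m; split => // x.
  exact: (h x).1.
exact: (h x).2.
Qed.

Lemma c1pg_cst (a : R) : c1pg (fun _ : 'rV[R]_k => a) (fun _ _ => 0).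
Proof.
have D (x : 'rV[R]_k) (i : 'I_k) : is_derive x (delta_mx 0 i) (fun _ : 'rV[R]_k => a) 0.
  exact: is_derive_cst.
apply: (c1pgI D).
- exact: cst_continuous.
- by move=> i; exact: cst_continuous.
- exact: pgrowth_cst.
- by move=> i; exact: pgrowth_cst.
Qed.

Lemma c1pgD f df g dg : c1pg f df -> c1pg g dg ->
  c1pg (fun x => f x + g x) (fun i x => df i x + dg i x).
Proof.
move=> /c1pgE[Df cf cdf pf pdf] /c1pgE[Dg cg cdg pg pdg].
have D x i : is_derive x (delta_mx 0 i) (fun x => f x + g x) (df i x + dg i x).
  by have := Df x i; have := Dg x i => ? ?; exact: is_deriveD.
apply: (c1pgI D) => [|i||i].
- by move=> x; apply: (@continuousD _ _ _ f g x); [exact: cf|exact: cg].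
- by move=> x; apply: (@continuousD _ _ _ (df i) (dg i) x); [exact: cdf|exact: cdg].
- exact: pgrowthD.
- exact: pgrowthD.
Qed.

Lemma c1pgM f df g dg : c1pg f df -> c1pg g dg ->
  c1pg (fun x => f x * g x) (fun i x => f x * dg i x + g x * df i x).
Proof.
move=> /c1pgE[Df cf cdf pf pdf] /c1pgE[Dg cg cdg pg pdg].
have D x i : is_derive x (delta_mx 0 i) (fun x => f x * g x) (f x * dg i x + g x * df i x).
  by have := Df x i; have := Dg x i => ? ?; exact: is_deriveM.
apply: (c1pgI D) => [|i||i].
- by move=> x; apply: (@continuousM _ _ f g x); [exact: cf|exact: cg].
- move=> x; apply: (@continuousD _ _ _ (fun x => f x * dg i x) (fun x => g x * df i x) x).
    by apply: (@continuousM _ _ f (dg i) x); [exact: cf|exact: cdg].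
  by apply: (@continuousM _ _ g (df i) x); [exact: cg|exact: cdf].
- exact: pgrowthM.
- by apply: pgrowthD; exact: pgrowthM.
Qed.

Lemma c1pg_coord j : c1pg (fun x : 'rV[R]_k => x 0 j) (fun i _ => (i == j)%:R).
Proof.
apply: c1pgI => [x i||i||i].
- split.
    apply/cvg_ex; exists ((i == j)%:R : R).
    apply: cvg_near_cst; rewrite nearE; exists 1 => //= h _ h0.
    by rewrite !mxE eqxx /= [j == i]eq_sym addrK /GRing.scale /= mulKf.
  rewrite /derive; apply: cvg_lim => //.
  apply: cvg_near_cst; rewrite nearE; exists 1 => //= h _ h0.
  by rewrite !mxE eqxx /= [j == i]eq_sym addrK /GRing.scale /= mulKf.
- exact: coord_continuous.
- exact: cst_continuous.
- exact: pgrowth_coord.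
- exact: pgrowth_cst.
Qed.

Lemma c1pg_comp f df (g dg : R -> R) (M : R) : c1pg f df ->
  (forall t : R, is_derive t 1 g (dg t)) -> continuous dg ->
  (forall t, `|dg t| <= M) ->
  c1pg (fun x => g (f x)) (fun i x => dg (f x) * df i x).
Proof.
move=> /c1pgE[Df cf cdf pf pdf] Dg cdg bdg.
have cg := is_derive_continuous (df := dg) Dg.
have pdg : pgrowth (fun x => dg (f x)).
  exists M, 0%N; split; first by apply: le_trans (bdg 0).
  by move=> x; rewrite expr0 mulr1.
apply: c1pgI => [x i||i||i].
- have Dl : is_derive (0 : R) 1 (fun t : R => f (x + t *: delta_mx 0 i)) (df i x).
    by apply: is_derive_along; rewrite scale0r addr0; exact: Df.
  have Dg' : is_derive (f (x + 0 *: delta_mx 0 i)) 1 g (dg (f x)).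
    by rewrite scale0r addr0; exact: Dg.
  have Dc : is_derive (0 : R) 1 (g \o (fun t : R => f (x + t *: delta_mx 0 i))) (dg (f x) * df i x).
    by apply: is_derive_eq; rewrite /GRing.scale /= mulrC.
  have E : (fun h : R => h^-1 *: (((g \o (fun t : R => f (x + t *: delta_mx 0 i))) \o shift 0) (h *: 1)
        - (g \o (fun t : R => f (x + t *: delta_mx 0 i))) 0)) =
     (fun h : R => h^-1 *: (((fun x => g (f x)) \o shift x) (h *: delta_mx 0 i) - g (f x))).
    apply/funext => h; congr (_ *: (_ - _)) => /=; last by rewrite scale0r addr0.
    by rewrite addr0 [h *: 1]mulr1 addrC.
  by case: Dc => d1 d2; split; [rewrite /derivable -E|rewrite -d2 /derive -E].
- by move=> x; apply: continuous_comp; [exact: cf|exact: cg].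
- move=> x; apply: (@continuousM _ _ (fun x => dg (f x)) (df i) x); last exact: cdf.
  by apply: continuous_comp; [exact: cf|exact: cdg].
- have [c [m [c0 fc]]] := pf.
  have M0 : 0 <= M by apply: le_trans (bdg 0).
  (* Only [dg] is bounded; the growth of [g] along [f] comes from [|g(t)| <= |g(0)| + M |t|]. *)
  have [c' [m' [c'0 hc']]] : pgrowth (fun x => `|g 0| + M * `|f x|).
    apply: pgrowthD; first exact: pgrowth_cst.
    apply: pgrowthM; first exact: pgrowth_cst.
    by exists c, m; split => // y; rewrite normr_id.
  exists c', m'; split => // y; apply: le_trans (hc' y).
  rewrite [leRHS]ger0_norm ?addr_ge0// ?mulr_ge0//.
  have -> : g (f y) = g 0 + (g (f y) - g 0) by rewrite addrC subrK.
  rewrite (le_trans (ler_normD _ _))// lerD2l.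
  by have := lipschitz_of_derive Dg bdg (f y) 0; rewrite subr0.
- exact: pgrowthM.
Qed.

End polynomial_growth.

Section reindexing.
Context {R : realType} {k k' : nat}.
Variable e : 'I_k -> 'I_k'.
Hypothesis e_inj : injective e.

Let sub (x : 'rV[R]_k') : 'rV[R]_k := \row_a x 0 (e a).

(** Serves to write two cylindrical functionals over the concatenation of their lists of vectors. By
    injectivity at most one term of each gradient sum is nonzero, and none when [i] is outside the
    image of [e]. *)
Lemma c1pg_reindex (f : 'rV[R]_k -> R) df : c1pg f df ->
  c1pg (fun x => f (\row_a x 0 (e a)))
       (fun i x => \sum_a (e a == i)%:R * df a (\row_a x 0 (e a))).
Proof.
move=> /c1pgE[Df cf cdf pf pdf].
have csub (x : 'rV[R]_k') : sub y @[y --> x] --> sub x.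
  move=> A [B hB sB].
  exists (fun i j' => [set t | forall a, e a = j' -> B i a t]) => [i j'|y hy] /=.
    have : \forall t \near x i j', forall a, e a = j' -> B i a t.
      have FF : Filter (nbhs (x i j' : R)) by exact: nbhs_filter.
      apply: (@filter_forall R 'I_k (fun a t => e a = j' -> B i a t) _ FF) => a.
      have := hB i a; rewrite mxE (ord1 i).
      case: (e a =P j') => [<-|ne] hBa; first by apply: filterS hBa => t Bt _.
      by apply: nearW => t /ne.
    exact.
  by apply: sB => i a; rewrite mxE (ord1 i); exact: hy.
have nsub x : `|sub x| <= `|x|.
  by apply: row_norm_le => // a; rewrite mxE row_coord_le.
have pg_sub g : pgrowth g -> pgrowth (g \o sub).
  move=> [c [m [c0 gc]]]; exists c, m; split => // x.
  by rewrite (le_trans (gc _))// ler_wpM2l// lerXn2r ?nnegrE ?addr_ge0// lerD2l.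
apply: c1pgI => [x i||i||i].
- have subD (h : R) : sub (h *: delta_mx 0 i + x) = h *: sub (delta_mx 0 i) + sub x.
    by apply/rowP => a; rewrite !mxE.
  have E : (fun h : R => h^-1 *: (((fun x => f (sub x)) \o shift x) (h *: delta_mx 0 i) - f (sub x))) =
     (fun h : R => h^-1 *: ((f \o shift (sub x)) (h *: sub (delta_mx 0 i)) - f (sub x))).
    by apply/funext => h; rewrite /= subD.
  suff [d1 d2] : is_derive (sub x) (sub (delta_mx 0 i)) f (\sum_a (e a == i)%:R * df a (sub x)).
    by split; [rewrite /derivable E|rewrite -d2 /derive E].
  have [[a ea]|/forallNP nea] := pselect (exists a, e a = i).
    have -> : sub (delta_mx 0 i) = delta_mx 0 a.
      by apply/rowP => b; rewrite !mxE -ea (inj_eq e_inj).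
    rewrite (bigD1 a)//= ea eqxx mul1r big1 ?addr0; first exact: Df.
    by move=> b ba; rewrite -ea (inj_eq e_inj) (negbTE ba) mul0r.
  have -> : sub (delta_mx 0 i) = 0.
    by apply/rowP => b; rewrite !mxE eqxx /=; case: eqP => // /nea.
  rewrite big1 => [|b _]; last by case: eqP => [/nea//|]; rewrite mul0r.
  have E0 : (fun h : R => h^-1 *: ((f \o shift (sub x)) (h *: 0) - f (sub x))) = (fun=> 0).
    by apply/funext => h; rewrite /= scaler0 add0r subrr scaler0.
  split; rewrite /derivable /derive E0; first exact: is_cvg_cst.
  exact: lim_cst.
- by move=> x; apply: (continuous_comp (csub x)); exact: cf.
- have gen (s : seq 'I_k) : continuous (fun x => \sum_(a <- s) (e a == i)%:R * df a (sub x)).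
    elim: s => [|a s IH] x.
      by under eq_fun do rewrite big_nil; exact: cst_continuous.
    under eq_fun do rewrite big_cons.
    apply: (@continuousD _ _ _ (fun x => (e a == i)%:R * df a (sub x)) _ x); last exact: IH.
    apply: (@continuousM _ _ (fun=> (e a == i)%:R) (fun x => df a (sub x)) x).
      exact: cst_continuous.
    by apply: (continuous_comp (csub x)); exact: cdf.
  exact: gen.
- exact: pg_sub.
- have gen (s : seq 'I_k) : pgrowth (fun x => \sum_(a <- s) (e a == i)%:R * df a (sub x)).
    elim: s => [|a s IH].
      by under eq_fun do rewrite big_nil; exact: pgrowth_cst.
    under eq_fun do rewrite big_cons; apply: pgrowthD => //.
    by apply: pgrowthM; [exact: pgrowth_cst|exact: pg_sub (pdf a)].
  exact: gen.
Qed.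

End reindexing.

Lemma hermiteS (R : realType) q :
  hermite R q.+1 = 'X * hermite R q - (hermite R q)^`().
Proof. by []. Qed.

(** The factor [q + 1] is the eigenvalue that later cancels the [1/p] of [L^-1]. *)
Lemma deriv_hermite (R : realType) q :
  (hermite R q.+1)^`() = q.+1%:R * hermite R q.
Proof.
elim: q => [|q IH].
  by rewrite hermiteS /hermite /= mulr1 -[1]/(1%:P) derivC subr0 derivX mul1r.
rewrite [in LHS]hermiteS derivB derivM derivX mul1r IH.
have -> : (q.+1%:R * hermite R q)^`() = q.+1%:R * (hermite R q)^`().
  by rewrite !mulr_natl derivMn.
rewrite mulrCA -addrA -mulrBr -hermiteS -[q.+2%:R]natr1 mulrDl mul1r.
by rewrite addrC.
Qed.

Section cylindrical.
Context {R : realType} {H : completeNormedModType R}.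
Variable dot : {dot H for idfun}.
Context {d : measure_display} {T : measurableType d} {P : probability T R}.
Variable X : H -> {RV P >-> R}.
Hypothesis isoX : isonormal dot X.
Implicit Types (F G : T -> R) (DF DG : T -> H).

Let row k (hs : 'I_k -> H) (w : T) : 'rV[R]_k := \row_i X (hs i) w.

(** The gradient is carried as data and no uniqueness is claimed, since it may depend on the
    representation. Asking only for C^1 lets the class contain [g(S)] for [g] that is not smooth,
    which [cylinder] excludes. *)
Definition cyl1 F DF := exists (k : nat) (hs : 'I_k -> H) (f : 'rV[R]_k -> R)
    (df : 'I_k -> 'rV[R]_k -> R),
  [/\ c1pg f df, (forall w, F w = f (row hs w)) &
      forall w, DF w = \sum_i df i (row hs w) *: hs i].

Lemma cyl1_ibp F DF h : cyl1 F DF ->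
  Ex P (fun w => F w * X h w) = Ex P (fun w => dot (DF w) h).
Proof.
move=> [k [hs [f [df [c1 FE DFE]]]]].
have Ib := gaussian_ibp isoX hs h c1; have [_ dm] := ibp_mom Ib.
case: Ib => _ _ _ IE.
rewrite (_ : F = fun w => f (row hs w)); last exact/funext.
rewrite IE; under [RHS]eq_Ex => w do [rewrite DFE dot_suml; under eq_bigr => i _ do rewrite dotZl mulrC].
rewrite Ex_sum => [|i]; last exact/intgZ/mom_intg.
by apply: eq_bigr => i _; rewrite ExZ//; exact: mom_intg.
Qed.

Lemma cyl1_mom F DF : cyl1 F DF -> mom P F.
Proof.
move=> [k [hs [f [df [c1 FE DFE]]]]].
have [fm _] := ibp_mom (gaussian_ibp isoX hs 0 c1).
by apply: eq_mom fm => w; rewrite FE.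
Qed.

Lemma cyl1_mom_dot F DF h : cyl1 F DF -> mom P (fun w => dot (DF w) h).
Proof.
move=> [k [hs [f [df [c1 FE DFE]]]]].
have [_ dm] := ibp_mom (gaussian_ibp isoX hs 0 c1).
apply: (@eq_mom _ _ _ _ (fun w => \sum_i df i (row hs w) * dot (hs i) h)).
  by move=> w; rewrite DFE dot_suml; apply: eq_bigr => i _; rewrite dotZl.
by apply: mom_sum => i; apply: momM => //; exact: mom_cst.
Qed.

Lemma cyl1_mom_dot2 F DF G DG : cyl1 F DF -> cyl1 G DG ->
  mom P (fun w => dot (DF w) (DG w)).
Proof.
move=> [k [hs [f [df [c1 FE DFE]]]]] cG.
have [_ dm] := ibp_mom (gaussian_ibp isoX hs 0 c1).
apply: (@eq_mom _ _ _ _ (fun w => \sum_i df i (row hs w) * dot (DG w) (hs i))).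
  by move=> w; rewrite DFE dot_suml; apply: eq_bigr => i _; rewrite dotZl (dotC dot (hs i)).
by apply: mom_sum => i; apply: momM => //; exact: cyl1_mom_dot cG.
Qed.

Lemma eq_cyl1 F DF G DG : F =1 G -> DF =1 DG -> cyl1 F DF -> cyl1 G DG.
Proof. by move=> /funext -> /funext ->. Qed.

Lemma cyl1_pair F DF G DG : cyl1 F DF -> cyl1 G DG ->
  exists (k : nat) (hs : 'I_k -> H) (f g : 'rV[R]_k -> R)
    (df dg : 'I_k -> 'rV[R]_k -> R),
  [/\ c1pg f df /\ c1pg g dg, (forall w, F w = f (row hs w)),
      (forall w, DF w = \sum_i df i (row hs w) *: hs i),
      (forall w, G w = g (row hs w)) &
      forall w, DG w = \sum_i dg i (row hs w) *: hs i].
Proof.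
move=> [k1 [h1 [f [df [cf FE DFE]]]]] [k2 [h2 [g [dg [cg GE DGE]]]]].
pose hs (i : 'I_(k1 + k2)) := match fintype.split i with inl a => h1 a | inr b => h2 b end.
have hl a : hs (lshift k2 a) = h1 a by rewrite /hs (unsplitK (inl a)).
have hr a : hs (rshift k1 a) = h2 a by rewrite /hs (unsplitK (inr a)).
have rl w : \row_a (row hs w) 0 (lshift k2 a) = row h1 w.
  by apply/rowP => a; rewrite !mxE hl.
have rr w : \row_a (row hs w) 0 (rshift k1 a) = row h2 w.
  by apply/rowP => a; rewrite !mxE hr.
exists (k1 + k2)%N, hs, (fun x => f (\row_a x 0 (lshift k2 a))),
  (fun x => g (\row_a x 0 (rshift k1 a))),
  (fun i x => \sum_a (lshift k2 a == i)%:R * df a (\row_a x 0 (lshift k2 a))),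
  (fun i x => \sum_a (rshift k1 a == i)%:R * dg a (\row_a x 0 (rshift k1 a))).
have sumE k (e : 'I_k -> 'I_(k1 + k2)) (D : 'I_k -> R) :
    \sum_i (\sum_a (e a == i)%:R * D a) *: hs i = \sum_a D a *: hs (e a).
  under eq_bigr do rewrite scaler_suml.
  rewrite exchange_big /=; apply: eq_bigr => a _.
  rewrite (bigD1 (e a))//= eqxx mul1r big1 ?addr0// => i.
  by rewrite eq_sym => /negbTE ->; rewrite mul0r scale0r.
split.
- by split; apply: c1pg_reindex => //; [exact: lshift_inj|exact: rshift_inj].
- by move=> w; rewrite rl.
- by move=> w; rewrite sumE rl DFE; apply: eq_bigr => a _; rewrite hl.
- by move=> w; rewrite rr.
- by move=> w; rewrite sumE rr DGE; apply: eq_bigr => a _; rewrite hr.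
Qed.

Lemma cyl1M F DF G DG : cyl1 F DF -> cyl1 G DG ->
  cyl1 (fun w => F w * G w) (fun w => F w *: DG w + G w *: DF w).
Proof.
move=> cF cG; have [k [hs [f [g [df [dg [[c1 c2] FE DFE GE DGE]]]]]]] := cyl1_pair cF cG.
exists k, hs, (fun x => f x * g x), (fun i x => f x * dg i x + g x * df i x).
split; [exact: c1pgM|by move=> w; rewrite FE GE|move=> w].
rewrite FE GE DFE DGE !scaler_sumr -big_split; apply: eq_bigr => i _ /=.
by rewrite !scalerA scalerDl.
Qed.

Lemma cyl1D F DF G DG : cyl1 F DF -> cyl1 G DG ->
  cyl1 (fun w => F w + G w) (fun w => DF w + DG w).
Proof.
move=> cF cG; have [k [hs [f [g [df [dg [[c1 c2] FE DFE GE DGE]]]]]]] := cyl1_pair cF cG.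
exists k, hs, (fun x => f x + g x), (fun i x => df i x + dg i x).
split; [exact: c1pgD|by move=> w; rewrite FE GE|move=> w].
by rewrite DFE DGE -big_split; apply: eq_bigr => i _ /=; rewrite scalerDl.
Qed.

Lemma cyl1_cst (a : R) : cyl1 (fun=> a) (fun=> 0).
Proof.
exists 0%N, (fun=> 0), (fun=> a), (fun _ _ => 0); split => //; first exact: c1pg_cst.
by move=> w; rewrite big_ord0.
Qed.

Lemma cyl1_X h : cyl1 (X h) (fun=> h).
Proof.
exists 1%N, (fun=> h), (fun x => x 0 0), (fun i _ => (i == 0)%:R).
split; first exact: c1pg_coord.
- by move=> w; rewrite mxE.
- by move=> w; rewrite big_ord1 eqxx scale1r.
Qed.

Lemma cyl1_comp F DF (g dg : R -> R) (M : R) : cyl1 F DF ->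
  (forall t : R, is_derive t 1 g (dg t)) -> continuous dg ->
  (forall t, `|dg t| <= M) ->
  cyl1 (fun w => g (F w)) (fun w => dg (F w) *: DF w).
Proof.
move=> [k [hs [f [df [c1 FE DFE]]]]] Dg cdg bdg.
exists k, hs, (fun x => g (f x)), (fun i x => dg (f x) * df i x).
split; [exact: c1pg_comp bdg|by move=> w; rewrite FE|move=> w].
by rewrite FE DFE scaler_sumr; apply: eq_bigr => i _; rewrite scalerA.
Qed.

Lemma cyl1_poly (p : {poly R}) h :
  cyl1 (fun w => p.[X h w]) (fun w => p^`().[X h w] *: h).
Proof.
elim/poly_ind: p => [|p c IH].
  by apply: eq_cyl1 (cyl1_cst 0) => w; rewrite ?deriv0 horner0 ?scale0r.
apply: eq_cyl1 (cyl1D (cyl1M IH (cyl1_X h)) (cyl1_cst c)) => w.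
  by rewrite hornerMXaddC.
rewrite derivMXaddC hornerD hornerMX addr0 scalerDl scalerA.
by rewrite [X h w * _]mulrC.
Qed.

Lemma cyl1_cylinder (S : cylinder H) : cyl1 (cyl_rv X S) (cyl_grad X S).
Proof.
exists (cyl_dim S), (cyl_vec S), (cyl_fun S),
  (fun i x => 'D_(delta_mx 0 i) (cyl_fun S) x).
split => //.
have [d0 c0 [a0 [m0 b0]]] := @cyl_smooth R H S [::].
have p0 : pgrowth (cyl_fun S).
  exists `|a0|, m0; split => // x; rewrite (le_trans (b0 x))//.
  by rewrite ler_wpM2r ?ler_norm// exprn_ge0// addr_ge0.
have D (x : 'rV[R]_(cyl_dim S)) i :
    is_derive x (delta_mx 0 i) (cyl_fun S) ('D_(delta_mx 0 i) (cyl_fun S) x).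
  by split => //; exact: (d0 x i).
apply: (c1pgI D) => // i; have [_ c1 [a1 [m1 b1]]] := @cyl_smooth R H S [:: i]; first exact: c1.
exists `|a1|, m1; split => // x; rewrite (le_trans (b1 x))//.
by rewrite ler_wpM2r ?ler_norm// exprn_ge0// addr_ge0.
Qed.

(** The divergence differentiates the coefficients of a gradient, so each partial derivative has to
    be cylindrical again. *)
Lemma cyl1_partial (S : cylinder H) (i : 'I_(cyl_dim S)) : exists D,
  cyl1 (fun w => 'D_(delta_mx 0 i) (cyl_fun S) (row (cyl_vec S) w)) D.
Proof.
pose f := 'D_(delta_mx 0 i) (cyl_fun S).
exists (fun w => \sum_j 'D_(delta_mx 0 j) f (row (cyl_vec S) w) *: cyl_vec S j).
exists (cyl_dim S), (cyl_vec S), f, (fun j x => 'D_(delta_mx 0 j) f x).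
split => //.
have [d0 c0 [a0 [m0 b0]]] := @cyl_smooth R H S [:: i].
have p0 : pgrowth f.
  exists `|a0|, m0; split => // x; rewrite (le_trans (b0 x))//.
  by rewrite ler_wpM2r ?ler_norm// exprn_ge0// addr_ge0.
have D (x : 'rV[R]_(cyl_dim S)) j : is_derive x (delta_mx 0 j) f ('D_(delta_mx 0 j) f x).
  by split => //; exact: (d0 x j).
apply: (c1pgI D) => // j; have [_ c1 [a1 [m1 b1]]] := @cyl_smooth R H S [:: j; i]; first exact: c1.
exists `|a1|, m1; split => // x; rewrite (le_trans (b1 x))//.
by rewrite ler_wpM2r ?ler_norm// exprn_ge0// addr_ge0.
Qed.

Section chain.
Variables (g g1 g2 : R -> R) (M1 M2 : R).
Hypotheses (Dg : forall t : R, is_derive t 1 g (g1 t))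
  (Dg1 : forall t : R, is_derive t 1 g1 (g2 t)) (cg2 : continuous g2).
Hypotheses (bg1 : forall t, `|g1 t| <= M1) (bg2 : forall t, `|g2 t| <= M2).
Variable S : cylinder H.

(* [N] is the divergence of the gradient of [g(S)]. *)
Lemma divergence_grad_comp : exists2 N, mom P N & forall Psi DPsi, cyl1 Psi DPsi ->
  Ex P (fun w => Psi w * N w) =
  Ex P (fun w => g1 (cyl_rv X S w) * dot (DPsi w) (cyl_grad X S w)).
Proof.
have cS := cyl1_cylinder S.
have cg1S := cyl1_comp cS Dg1 cg2 bg2.
pose dS i w := 'D_(delta_mx 0 i) (cyl_fun S) (row (cyl_vec S) w).
have [DdS hDdS] := choice (@cyl1_partial S).
(* The coefficient of [cyl_vec S i] in the gradient of [g(S)]; the divergence of [\sum_i th_i v_i]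
   is [\sum_i (th_i X(v_i) - <D th_i, v_i>)]. *)
pose th i w := g1 (cyl_rv X S w) * dS i w.
have exth i : exists D, cyl1 (th i) D by eexists; exact: (cyl1M cg1S (hDdS i)).
have [Dth hth] := choice exth.
exists (fun w => \sum_i (th i w * X (cyl_vec S i) w - dot (Dth i w) (cyl_vec S i))).
  apply: mom_sum => i; apply: momB; last exact: cyl1_mom_dot (hth i).
  by apply: momM; [exact: cyl1_mom (hth i)|exact: X_mom isoX _].
move=> Psi DPsi cPsi.
have mPsi := cyl1_mom cPsi.
have mXv i : mom P (X (cyl_vec S i)) := X_mom isoX _.
transitivity (Ex P (fun w => \sum_i (Psi w * th i w * X (cyl_vec S i) w
    - Psi w * dot (Dth i w) (cyl_vec S i)))).
  by apply: eq_Ex => w; rewrite mulr_sumr; apply: eq_bigr => i _; ring.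
have m1 i : mom P (fun w => Psi w * th i w * X (cyl_vec S i) w).
  by apply: momM => //; apply: momM => //; exact: cyl1_mom (hth i).
have m2 i : mom P (fun w => Psi w * dot (Dth i w) (cyl_vec S i)).
  by apply: momM => //; exact: cyl1_mom_dot (hth i).
have m3 i : mom P (fun w => th i w * dot (DPsi w) (cyl_vec S i)).
  by apply: momM; [exact: cyl1_mom (hth i)|exact: cyl1_mom_dot cPsi].
rewrite Ex_sum => [|i]; last by apply: intgB; exact: mom_intg.
transitivity (\sum_i Ex P (fun w => th i w * dot (DPsi w) (cyl_vec S i))).
  apply: eq_bigr => i _.
  rewrite ExB; [|exact: mom_intg..].
  (* Integration by parts for the product of [Psi] and [th i]: the term that differentiates [th i]
     cancels the correction in [N]. *)
  rewrite (cyl1_ibp _ (cyl1M cPsi (hth i))).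
  rewrite (_ : Ex P (fun w => dot _ _) = Ex P (fun w => Psi w * dot (Dth i w) (cyl_vec S i)) +
      Ex P (fun w => th i w * dot (DPsi w) (cyl_vec S i))); first by ring.
  rewrite -ExD; [|exact: mom_intg..].
  by apply: eq_Ex => w; rewrite dotDl !dotZl.
rewrite -Ex_sum => [|i]; last exact: mom_intg.
apply: eq_Ex => w; rewrite (dotC dot (DPsi w)) /cyl_grad dot_suml mulr_sumr.
by apply: eq_bigr => i _; rewrite dotZl (dotC dot (DPsi w)) mulrA.
Qed.

(** Pairing with [N] differentiates [H_(p+1)(X h)] into [(p + 1) H_p(X h) h]. Integrating by parts
    back in the direction [h] restores [X(h) H_p - H_p' = H_(p+1)], so the net effect is
    multiplication by [p + 1]. *)
Lemma hermite_duality N p h : dot h h = 1 -> mom P N ->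
  (forall Psi DPsi, cyl1 Psi DPsi -> Ex P (fun w => Psi w * N w) =
     Ex P (fun w => g1 (cyl_rv X S w) * dot (DPsi w) (cyl_grad X S w))) ->
  Ex P (fun w => (hermite R p.+1).[X h w] * N w) =
  p.+1%:R * Ex P (fun w => (hermite R p.+1).[X h w] * g (cyl_rv X S w)).
Proof.
move=> h1 Nm NE.
have cg1 : continuous g1 := is_derive_continuous (df := g2) Dg1.
have cgS := cyl1_comp (cyl1_cylinder S) Dg cg1 bg1.
have cH := cyl1_poly (hermite R p) h.
have cHS := cyl1_poly (hermite R p.+1) h.
have mX := X_mom isoX h.
rewrite (NE _ _ cHS) deriv_hermite.
have := cyl1_ibp h (cyl1M cH cgS).
rewrite (_ : Ex P (fun w => dot _ _) =
    Ex P (fun w => g1 (cyl_rv X S w) * ((hermite R p).[X h w] * dot h (cyl_grad X S w))) +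
    Ex P (fun w => (hermite R p)^`().[X h w] * g (cyl_rv X S w))); last first.
  rewrite -ExD.
  - apply: eq_Ex => w; rewrite dotDl !dotZl h1 (dotC dot (cyl_grad X S w)).
    ring.
  - apply: mom_intg; apply: (@eq_mom _ _ _ _ (fun w => (hermite R p).[X h w] *
      dot (g1 (cyl_rv X S w) *: cyl_grad X S w) h)).
      by move=> w; rewrite dotZl (dotC dot (cyl_grad X S w)); ring.
    by apply: momM; [exact: cyl1_mom cH|exact: cyl1_mom_dot cgS].
  - apply: mom_intg; apply: momM; last exact: cyl1_mom cgS.
    exact: cyl1_mom (cyl1_poly _ h).
move=> /eqP; rewrite -subr_eq => /eqP E.
have I1 : intg P (fun w => g1 (cyl_rv X S w) * ((hermite R p).[X h w] * dot h (cyl_grad X S w))).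
  apply: mom_intg; apply: (@eq_mom _ _ _ _ (fun w => (hermite R p).[X h w] *
      dot (g1 (cyl_rv X S w) *: cyl_grad X S w) h)).
    by move=> w; rewrite dotZl (dotC dot (cyl_grad X S w)); ring.
  by apply: momM; [exact: cyl1_mom cH|exact: cyl1_mom_dot cgS].
transitivity (p.+1%:R * Ex P (fun w => g1 (cyl_rv X S w) *
    ((hermite R p).[X h w] * dot h (cyl_grad X S w)))).
  rewrite -ExZ//; apply: eq_Ex => w.
  by rewrite -[p.+1%:R]polyC_natr hornerM hornerC dotZl; ring.
congr (_ * _); rewrite -E -ExB.
- by apply: eq_Ex => w; rewrite hermiteS hornerD hornerN hornerM hornerX; ring.
- apply: mom_intg; apply: momM => //; apply: momM; [exact: cyl1_mom cH|exact: cyl1_mom cgS].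
- apply: mom_intg; apply: momM; last exact: cyl1_mom cgS.
  exact: cyl1_mom (cyl1_poly _ h).
Qed.

End chain.

End cylindrical.

(** * Malliavin integration by parts on finite chaoses *)

Section real_limits.
Context {R : realType}.

Lemma cvg0_le (a b : nat -> R) : (forall n, `|a n| <= b n) ->
  b n @[n --> \oo] --> (0 : R) -> a n @[n --> \oo] --> (0 : R).
Proof.
move=> ab b0; apply/cvgrPdist_le => e e0.
have /cvgrPdist_le/(_ e e0) := b0; apply: filterS => n.
rewrite !sub0r !normrN => h; rewrite (le_trans (ab n))// (le_trans _ h)//.
exact: ler_norm.
Qed.

Lemma cvg_sqrt0 (a : nat -> R) : a n @[n --> \oo] --> (0 : R) ->
  Num.sqrt (a n) @[n --> \oo] --> (0 : R).
Proof.
by move=> a0; rewrite -[X in _ --> X](@sqrtr0 R); apply: continuous_cvg => //; exact: sqrt_continuous.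
Qed.

Context {d : measure_display} {T : measurableType d} {P : probability T R}.

(** Convergence in the extended reals leaves finitely many terms possibly infinite; the shift by [N]
    discards them. *)
Lemma expectation_cvg0 (f : nat -> T -> R) :
  (forall n, measurable_fun setT (f n)) -> (forall n w, 0 <= f n w) ->
  ('E_P[f n] @[n --> \oo] --> 0)%E ->
  exists N, (forall n, intg P (f (n + N)%N)) /\ Ex P (f (n + N)%N) @[n --> \oo] --> (0 : R).
Proof.
move=> mf f0 h.
have E n : ('E_P[f n] = \int[P]_w (f n w)%:E)%E by rewrite unlock.
have : \forall n \near \oo, ('E_P[f n] < +oo)%E.
  have := h => /fine_cvgP[+ _]; apply: filterS => n; rewrite fin_numElt => /andP[] //.
move=> [N _ hN]; exists N; split.
  move=> n; apply/integrableP; split; first exact/measurable_EFinP.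
  rewrite (eq_integral (EFin \o f (n + N)%N)) => [|w _] /=; last by rewrite ger0_norm.
  by have := hN (n + N)%N; rewrite /= leq_addl E; exact.
have /fine_cvgP[_] := h; rewrite -(cvg_shiftn N).
by apply: cvg_trans; apply: near_eq_cvg; near=> n; rewrite /= E.
Unshelve. all: by end_near. Qed.

Lemma L2_lipschitz (u : R -> R) (K : R) (f : T -> R) : measurable_fun setT u ->
  (forall x y, `|u x - u y| <= K * `|x - y|) -> L2 P f -> L2 P (fun w => u (f w)).
Proof.
move=> mu lu f2; have muf : measurable_fun setT (fun w => u (f w)).
  by apply: measurableT_comp => //; exact: f2.1.
apply: (@eq_L2 _ _ _ _ (fun w => (u (f w) - u 0) + u 0)) => [w|]; first by rewrite subrK.
apply: L2D; last exact: L2_cst.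
apply: (L2_dom _ _ (L2Z K f2)); first exact: measurable_funB.
by move=> w; rewrite normrM (le_trans (lu _ _))// subr0 ler_wpM2r// ler_norm.
Qed.

Lemma cvg_L2_lipschitz (u : R -> R) (K : R) (f_ : nat -> T -> R) (f : T -> R) :
  measurable_fun setT u -> (forall x y, `|u x - u y| <= K * `|x - y|) ->
  (forall n, L2 P (f_ n)) -> L2 P f ->
  Ex P (fun w => (f w - f_ n w) ^+ 2) @[n --> \oo] --> (0 : R) ->
  Ex P (fun w => (u (f w) - u (f_ n w)) ^+ 2) @[n --> \oo] --> (0 : R).
Proof.
move=> mu lu fn2 f2 c.
have d2 n : L2 P (fun w => f w - f_ n w) by exact: L2B.
have du2 n : L2 P (fun w => u (f w) - u (f_ n w)).
  by apply: L2B; [exact: L2_lipschitz f2|exact: L2_lipschitz (fn2 n)].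
apply: (@cvg0_le _ (fun n => K ^+ 2 * Ex P (fun w => (f w - f_ n w) ^+ 2))).
  move=> n; rewrite ger0_norm; last by apply: Ex_ge0 => w; exact: sqr_ge0.
  rewrite -ExZ; last exact: (d2 n).2.
  apply: Ex_le => [||w]; first exact: (du2 n).2.
    by apply: intgZ; exact: (d2 n).2.
  rewrite -exprMn -real_normK ?num_real// -[leRHS]real_normK ?num_real//.
  by rewrite lerXn2r ?nnegrE// normrM (le_trans (lu _ _))// ler_wpM2r// ler_norm.
rewrite -[X in _ --> X](mulr0 (K ^+ 2)).
by apply: cvgM => //; exact: cvg_cst.
Qed.

End real_limits.

Section malliavin.
Context {R : realType} {H : completeNormedModType R}.
Variable dot : {dot H for idfun}.
Hypothesis sepH : separable_hilbert dot.
Context {d : measure_display} {T : measurableType d} {P : probability T R}.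
Variable X : H -> {RV P >-> R}.
Hypothesis isoX : isonormal dot X.

Lemma dotNl x y : dot (- x) y = - dot x y.
Proof. by rewrite -scaleN1r dotZl mulN1r. Qed.

Lemma dotNr x y : dot x (- y) = - dot x y.
Proof. by rewrite -scaleN1r dotZr mulN1r. Qed.

Lemma dotBl x y z : dot (x - y) z = dot x z - dot y z.
Proof. by rewrite dotDl dotNl. Qed.

Lemma dotBr x y z : dot x (y - z) = dot x y - dot x z.
Proof. by rewrite dotDr dotNr. Qed.

Lemma dot_normr_le x y : `|dot x y| <= Num.sqrt (dot x x) * Num.sqrt (dot y y).
Proof.
have xx := dot_ge0 dot x; have yy := dot_ge0 dot y.
rewrite -sqrtrM// -sqrtr_sqr ler_wsqrtr//.
have [/dot_eq0 ->|y0] := eqVneq (dot y y) 0; first by rewrite linear0r !linear0l expr0n mulr0.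
have := dot_ge0 dot (dot y y *: x - dot x y *: y).
rewrite dotBl !dotBr !dotZl !dotZr (dotC dot y x).
move=> h.
have : 0 <= dot y y * (dot x x * dot y y - dot x y ^+ 2).
  by apply: (le_trans h); rewrite le_eqVlt; apply/orP; left; apply/eqP; ring.
by rewrite pmulr_rge0 ?subr_ge0// lt_def y0.
Qed.

Definition weakly_measurable (U : T -> H) :=
  forall h, measurable_fun setT (fun w => dot (U w) h).

Lemma weakly_measurableD U V : weakly_measurable U -> weakly_measurable V ->
  weakly_measurable (fun w => U w + V w).
Proof.
by move=> mU mV h; under eq_fun do rewrite dotDl; exact: measurable_funD.
Qed.

Lemma weakly_measurableN U : weakly_measurable U -> weakly_measurable (fun w => - U w).
Proof.
by move=> mU h; under eq_fun do rewrite dotNl; exact: measurable_funN.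
Qed.

(* For a dense set [S], [|u|^2] is the supremum over [x] in [S] of
   [2 <u, x> - |x|^2 = |u|^2 - |u - x|^2]. *)
Lemma measurable_sqnorm U : weakly_measurable U ->
  measurable_fun setT (fun w => dot (U w) (U w)).
Proof.
move=> mU; have [normE [S cS dS]] := sepH.
apply: (measurability _ (RGenOInfty.measurableE R)) => _ [_ [a ->] <-].
rewrite setTI.
pose A x := [set w | a < 2 * dot (U w) x - dot x x].
have mA x : measurable (A x).
  have m : measurable_fun setT (fun w => 2 * dot (U w) x - dot x x).
    by apply: measurable_funB => //; exact: measurable_funM.
  have := m measurableT _ (measurable_itv `]a, +oo[); rewrite setTI.
  by congr measurable; apply/seteqP; split => w /=; rewrite in_itv/= andbT.
have /countable_injP[f finj] := cS.
pose B n := [set w | exists x, [/\ S x, f x = n & A x w]].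
have mB n : measurable (B n).
  have [[x [Sx fx]]|nx] := pselect (exists x, S x /\ f x = n).
    rewrite (_ : B n = A x)//; apply/seteqP; split => w; last by exists x.
    move=> [y [Sy fy Ay]]; rewrite (_ : x = y)//.
    by apply: finj; rewrite ?inE// fx fy.
  rewrite (_ : B n = set0)//; apply/seteqP; split => w //.
  by move=> [y [Sy fy Ay]]; apply: nx; exists y.
rewrite (_ : _ @^-1` _ = \bigcup_n B n); first exact: bigcupT_measurable.
apply/seteqP; split => w /=; rewrite in_itv/= andbT.
  move=> aU; pose r := Num.sqrt (dot (U w) (U w) - a).
  have r0 : 0 < r by rewrite sqrtr_gt0 subr_gt0.
  have [x [Ux Sx]] : ball (U w) r `&` S !=set0.
    by apply: dS; [exists (U w); exact: ballxx|exact: ball_open].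
  exists (f x) => //; exists x; split => //; rewrite /A /=.
  have : `|U w - x| ^+ 2 < dot (U w) (U w) - a.
    rewrite -[ltRHS]sqr_sqrtr ?subr_ge0 ?(ltW aU)//.
    by rewrite ltrXn2r ?nnegrE ?sqrtr_ge0//; move: Ux; rewrite -ball_normE.
  rewrite normE dotBl !dotBr (dotC dot x (U w)).
  by move=> ?; lra.
move=> [n _ [x [Sx _]]]; rewrite /A /= => h; apply: (lt_le_trans h).
have := dot_ge0 dot (U w - x); rewrite dotBl !dotBr (dotC dot x (U w)).
by move=> ?; lra.
Qed.

(** Polarization reduces the inner product to squared norms. *)
Lemma measurable_dot U V : weakly_measurable U -> weakly_measurable V ->
  measurable_fun setT (fun w => dot (U w) (V w)).
Proof.
move=> mU mV.
have -> : (fun w => dot (U w) (V w)) = (fun w => 4^-1 *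
    (dot (U w + V w) (U w + V w) - dot (U w - V w) (U w - V w))).
  apply/funext => w; rewrite dotBl !dotBr dotDl !dotDr (dotC dot (V w) (U w)).
  by field.
apply: measurable_funM => //; apply: measurable_funB; apply: measurable_sqnorm.
  exact: weakly_measurableD.
by apply: weakly_measurableD => //; exact: weakly_measurableN.
Qed.

Definition vL2 U := weakly_measurable U /\ intg P (fun w => dot (U w) (U w)).

Let L2_norm U : vL2 U -> L2 P (fun w => Num.sqrt (dot (U w) (U w))).
Proof.
move=> [mU iU]; split.
  apply: (@measurableT_comp _ _ _ _ _ _ (@Num.sqrt R)); last exact: measurable_sqnorm.
  by apply: continuous_measurable_fun; exact: sqrt_continuous.
by apply: eq_intg iU => w; rewrite sqr_sqrtr// dot_ge0.
Qed.

Lemma vL2_dot U V : vL2 U -> vL2 V -> intg P (fun w => dot (U w) (V w)).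
Proof.
move=> U2 V2; apply: intg_dom (L2_mul (L2_norm U2) (L2_norm V2)).
  by apply: measurable_dot; [exact: U2.1|exact: V2.1].
by move=> w; exact: dot_normr_le.
Qed.

Lemma vL2N U : vL2 U -> vL2 (fun w => - U w).
Proof.
move=> [mU iU]; split; first exact: weakly_measurableN.
by apply: eq_intg iU => w; rewrite dotNl dotNr opprK.
Qed.

Lemma vL2D U V : vL2 U -> vL2 V -> vL2 (fun w => U w + V w).
Proof.
move=> U2 V2; split; first exact: weakly_measurableD U2.1 V2.1.
apply: (@eq_intg _ _ _ _ (fun w => dot (U w) (U w) + dot (V w) (V w) + 2 * dot (U w) (V w))).
  by move=> w; rewrite dotDl !dotDr (dotC dot (V w) (U w)); ring.
apply: intgD; first by apply: intgD; [exact: U2.2|exact: V2.2].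
by apply: intgZ; exact: vL2_dot.
Qed.

Lemma vL2_cauchy_schwarz U V : vL2 U -> vL2 V ->
  Ex P (fun w => `|dot (U w) (V w)|) <=
  Num.sqrt (Ex P (fun w => dot (U w) (U w))) * Num.sqrt (Ex P (fun w => dot (V w) (V w))).
Proof.
move=> U2 V2; have := cauchy_schwarz_abs (L2_norm U2) (L2_norm V2).
have sq W : Ex P (fun w => Num.sqrt (dot (W w) (W w)) ^+ 2) = Ex P (fun w => dot (W w) (W w)).
  by apply: eq_Ex => w; rewrite sqr_sqrtr// dot_ge0.
rewrite !sq; apply: le_trans; apply: Ex_le.
- by apply: intg_abs; exact: vL2_dot.
- apply: (@eq_intg _ _ _ _ (fun w => Num.sqrt (dot (U w) (U w)) * Num.sqrt (dot (V w) (V w)))).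
    by move=> w; rewrite !ger0_norm ?sqrtr_ge0.
  by apply: L2_mul; exact: L2_norm.
- by move=> w; rewrite (le_trans (dot_normr_le _ _))// !ger0_norm ?sqrtr_ge0.
Qed.

Lemma cyl1_vL2 F DF : cyl1 X F DF -> vL2 DF.
Proof.
move=> c; split; first by move=> h; exact: (cyl1_mom_dot isoX h c).1.
by apply/mom_intg; exact: (cyl1_mom_dot2 isoX c c).
Qed.

Lemma malliavin_approx (F : {RV P >-> R}) U : malliavin_derivative dot X F U ->
  [/\ L2 P F, vL2 U & exists S : nat -> cylinder H,
    Ex P (fun w => (F w - cyl_rv X (S n) w) ^+ 2) @[n --> \oo] --> (0 : R) /\
    Ex P (fun w => dot (U w - cyl_grad X (S n) w) (U w - cyl_grad X (S n) w))
      @[n --> \oo] --> (0 : R)].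
Proof.
move=> [mU [S [cF cU]]]; have [normE _] := sepH.
have mF : measurable_fun setT F by exact: measurable_funPT.
have cS n := cyl1_cylinder X (S n).
have mS n : mom P (cyl_rv X (S n)) := cyl1_mom isoX (cS n).
have vS n := cyl1_vL2 (cS n).
have [N1 [i1 c1]] := @expectation_cvg0 R _ _ P (fun n w => (F w - cyl_rv X (S n) w) ^+ 2)
  (fun n => measurable_funX 2 (measurable_funB mF (mS n).1)) (fun n w => sqr_ge0 _) cF.
have mUS n : weakly_measurable (fun w => U w - cyl_grad X (S n) w).
  by apply: weakly_measurableD => //; apply: weakly_measurableN; exact: (vS n).1.
have cU' : ('E_P[(fun w => dot (U w - cyl_grad X (S n) w) (U w - cyl_grad X (S n) w))%R]
    @[n --> \oo] --> 0)%E.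
  apply: cvg_trans cU; apply: near_eq_cvg; near=> n.
  by congr expectation; apply/funext => w; rewrite normE.
have [N2 [i2 c2]] := @expectation_cvg0 R _ _ P
  (fun n w => dot (U w - cyl_grad X (S n) w) (U w - cyl_grad X (S n) w))
  (fun n => measurable_sqnorm (mUS n)) (fun n w => dot_ge0 _ _) cU'.
split.
- apply: (@eq_L2 _ _ _ _ (fun w => (F w - cyl_rv X (S (0 + N1)%N) w) + cyl_rv X (S (0 + N1)%N) w)).
    by move=> w; rewrite subrK.
  apply: L2D; last exact: mom_L2.
  by split; [exact: (measurable_funB mF (mS _).1)|exact: i1].
- rewrite (_ : U = fun w => (U w - cyl_grad X (S (0 + N2)%N) w) + cyl_grad X (S (0 + N2)%N) w).
    by apply: vL2D; [split; [exact: mUS|exact: i2]|exact: vS].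
  by apply/funext => w; rewrite subrK.
(* The shift by [N1 + N2] makes both approximations finite at every index. *)
- exists (fun n => S (n + (N1 + N2))%N); split.
    move: c1; rewrite -(cvg_shiftn N2); apply: cvg_trans; apply: near_eq_cvg.
    by near=> n; rewrite /= addnA addnAC.
  move: c2; rewrite -(cvg_shiftn N1); apply: cvg_trans; apply: near_eq_cvg.
  by near=> n; rewrite /= addnA.
Unshelve. all: by end_near. Qed.

Lemma wiener_ito_approx q (f : ('I_q -> H) -> R) (J : {RV P >-> R}) :
  wiener_ito dot X f J ->
  L2 P J /\ exists c : nat -> seq (R * H),
    (forall n k, k \in c n -> q = 0%N \/ dot k.2 k.2 = 1) /\
    Ex P (fun w => (J w - \sum_(k <- c n) k.1 * (hermite R q).[X k.2 w]) ^+ 2)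
      @[n --> \oo] --> (0 : R).
Proof.
move=> [c [c1 _ cJ]]; have [normE _] := sepH.
have mJ : measurable_fun setT J by exact: measurable_funPT.
have mY n : mom P (fun w => \sum_(k <- c n) k.1 * (hermite R q).[X k.2 w]).
  apply: mom_sum => k; apply: momZ.
  exact: (cyl1_mom isoX (cyl1_poly X (hermite R q) k.2)).
have [N [iN cN]] := @expectation_cvg0 R _ _ P
  (fun n w => (J w - \sum_(k <- c n) k.1 * (hermite R q).[X k.2 w]) ^+ 2)
  (fun n => measurable_funX 2 (measurable_funB mJ (mY n).1)) (fun n w => sqr_ge0 _) cJ.
split.
  apply: (@eq_L2 _ _ _ _ (fun w => (J w - \sum_(k <- c (0 + N)%N) k.1 * (hermite R q).[X k.2 w]) +
     \sum_(k <- c (0 + N)%N) k.1 * (hermite R q).[X k.2 w])).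
    by move=> w; rewrite subrK.
  apply: L2D; last exact: mom_L2.
  by split; [exact: (measurable_funB mJ (mY _).1)|exact: iN].
exists (fun n => c (n + N)%N); split => // n k /c1[->|kn]; [by left|right].
by rewrite -normE kn expr1n.
Qed.

(** An identity that is linear in [H_p(X h)] extends to [I_p(f)] by L^2 approximation, [N] and [G]
    staying fixed. It is used with [r = p] for the duality, [r = 0] for the vanishing of means, and
    a mean as [r] for the chaos of order 0. *)
Lemma wiener_ito_duality p (f : ('I_p -> H) -> R) (J : {RV P >-> R}) (N G : T -> R) (r : R) :
  wiener_ito dot X f J -> mom P N -> mom P G ->
  (forall h, p = 0%N \/ dot h h = 1 ->
     Ex P (fun w => (hermite R p).[X h w] * N w) = r * Ex P (fun w => (hermite R p).[X h w] * G w)) ->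
  Ex P (fun w => J w * N w) = r * Ex P (fun w => J w * G w).
Proof.
move=> wJ Nm Gm dual; have [J2 [c [c1 cJ]]] := wiener_ito_approx wJ.
have mY n : mom P (fun w => \sum_(k <- c n) k.1 * (hermite R p).[X k.2 w]).
  apply: mom_sum => k; apply: momZ.
  exact: (cyl1_mom isoX (cyl1_poly X (hermite R p) k.2)).
have mH h : mom P (fun w => (hermite R p).[X h w]).
  exact: (cyl1_mom isoX (cyl1_poly X (hermite R p) h)).
have YE M n : mom P M -> Ex P (fun w => (\sum_(k <- c n) k.1 * (hermite R p).[X k.2 w]) * M w) =
    \sum_(k <- c n) k.1 * Ex P (fun w => (hermite R p).[X k.2 w] * M w).
  move=> Mm; transitivity (Ex P (fun w => \sum_(k <- c n) k.1 * ((hermite R p).[X k.2 w] * M w))).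
    by apply: eq_Ex => w; rewrite mulr_suml; apply: eq_bigr => k _; rewrite mulrA.
  rewrite Ex_sum => [|k]; last by apply/intgZ/mom_intg/momM.
  by apply: eq_bigr => k _; rewrite ExZ//; apply/mom_intg/momM.
have l1 := cvg_L2_Ex (fun n => mom_L2 (mY n)) J2 (mom_L2 Nm) cJ.
have l2 := cvg_L2_Ex (fun n => mom_L2 (mY n)) J2 (mom_L2 Gm) cJ.
apply: (cvg_unique _ l1) => //.
have l3 : r * Ex P (fun w => (\sum_(k <- c n) k.1 * (hermite R p).[X k.2 w]) * G w)
    @[n --> \oo] --> r * Ex P (fun w => J w * G w) by apply: cvgM => //; exact: cvg_cst.
move: l3; apply: cvg_trans; apply: near_eq_cvg; near=> n.
rewrite !YE// mulr_sumr; apply: eq_big_seq => k kc.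
by rewrite mulrCA (dual _ (c1 _ _ kc)).
Unshelve. all: by end_near. Qed.

Section chain_rule.
Variables (g g1 g2 : R -> R) (M1 M2 : R).
Hypotheses (Dg : forall t : R, is_derive t 1 g (g1 t))
  (Dg1 : forall t : R, is_derive t 1 g1 (g2 t)) (cg2 : continuous g2).
Hypotheses (bg1 : forall t, `|g1 t| <= M1) (bg2 : forall t, `|g2 t| <= M2).

(** With [N] the divergence of the gradient of [g(S)], the left side is [- E (V N)], that is
    [\sum_p (1/p) E (J_p N)], and [E (J_p N) = p E (J_p g(S))] removes the [1/p]. Only L^2
    approximations of [V] and of the [J_p] are involved, [N] being fixed. *)
Lemma malliavin_chain_duality m (f : forall q : nat, ('I_q -> H) -> R)
    (J : nat -> {RV P >-> R}) (F V : {RV P >-> R}) DV (S : cylinder H) :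
  chaos_expansion dot X m f J F ->
  {ae P, forall w, V w = - \sum_(1 <= p < m.+1) p%:R^-1 * J p w} ->
  malliavin_derivative dot X V DV ->
  Ex P (fun w => g1 (cyl_rv X S w) * dot (- DV w) (cyl_grad X S w)) =
  \sum_(1 <= p < m.+1) Ex P (fun w => J p w * g (cyl_rv X S w)).
Proof.
move=> [chJ _] VE mV.
have [V2 DV2 [W [cW cDW]]] := malliavin_approx mV.
have cS := cyl1_cylinder X S.
have cg1 : continuous g1 := is_derive_continuous (df := g2) Dg1.
have cgS := cyl1_comp cS Dg cg1 bg1.
have mgS := cyl1_mom isoX cgS.
have [N Nm NE] := divergence_grad_comp isoX Dg1 cg2 bg2 S.
have J2 p : (p <= m)%N -> L2 P (J p).
  by move=> pm; have [_ /wiener_ito_approx[]] := chJ p pm.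
have step1 : Ex P (fun w => V w * N w) =
    Ex P (fun w => g1 (cyl_rv X S w) * dot (DV w) (cyl_grad X S w)).
  have l1 := cvg_L2_Ex (fun n => mom_L2 (cyl1_mom isoX (cyl1_cylinder X (W n)))) V2 (mom_L2 Nm) cW.
  apply: (cvg_unique _ l1) => //.
  have gS2 : vL2 (fun w => g1 (cyl_rv X S w) *: cyl_grad X S w) := cyl1_vL2 cgS.
  have dW n : vL2 (cyl_grad X (W n)) := cyl1_vL2 (cyl1_cylinder X (W n)).
  have dd n : vL2 (fun w => DV w - cyl_grad X (W n) w) by apply: vL2D => //; exact: vL2N.
  have E U : Ex P (fun w => g1 (cyl_rv X S w) * dot (U w) (cyl_grad X S w)) =
      Ex P (fun w => dot (U w) (g1 (cyl_rv X S w) *: cyl_grad X S w)).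
    by apply: eq_Ex => w; rewrite dotZr.
  rewrite E.
  (* Cauchy-Schwarz for [H]-valued variables, against the fixed gradient of [g(S)]. *)
  have : Ex P (fun w => dot (DV w - cyl_grad X (W n) w) (g1 (cyl_rv X S w) *: cyl_grad X S w))
      @[n --> \oo] --> (0 : R).
    apply: (@cvg0_le _ _ (fun n =>
       Num.sqrt (Ex P (fun w => dot (DV w - cyl_grad X (W n) w) (DV w - cyl_grad X (W n) w))) *
       Num.sqrt (Ex P (fun w => dot (g1 (cyl_rv X S w) *: cyl_grad X S w) (g1 (cyl_rv X S w) *: cyl_grad X S w))))).
      move=> n; apply: le_trans (Ex_abs _) (vL2_cauchy_schwarz (dd n) gS2).
      exact: vL2_dot.
    rewrite -[X in _ --> X](mul0r (Num.sqrt (Ex P (fun w =>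
      dot (g1 (cyl_rv X S w) *: cyl_grad X S w) (g1 (cyl_rv X S w) *: cyl_grad X S w))))).
    by apply: cvgM; [exact: cvg_sqrt0|exact: cvg_cst].
  set A := Ex P (fun w => dot (DV w) (g1 (cyl_rv X S w) *: cyl_grad X S w)).
  move=> l0; have : A - Ex P (fun w => dot (DV w - cyl_grad X (W n) w)
      (g1 (cyl_rv X S w) *: cyl_grad X S w)) @[n --> \oo] --> A - 0.
    by apply: cvgB; [exact: cvg_cst|exact: l0].
  rewrite subr0; apply: cvg_trans; apply: near_eq_cvg; near=> n.
  rewrite (NE _ _ (cyl1_cylinder X (W n))) E /=.
  rewrite -ExB; [|exact: vL2_dot..].
  by apply: eq_Ex => w; rewrite dotBl subKr.
have step2 : Ex P (fun w => V w * N w) =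
    - \sum_(1 <= p < m.+1) Ex P (fun w => J p w * g (cyl_rv X S w)).
  have mJ p : measurable_fun setT (J p) by exact: measurable_funPT.
  have JN p : (p < m.+1)%N -> intg P (fun w => J p w * N w).
    by move=> pm; apply: L2_mul; [exact: J2|exact: mom_L2].
  transitivity (Ex P (fun w => - \sum_(1 <= p < m.+1) p%:R^-1 * (J p w * N w))).
    apply: ae_eq_Ex.
    - by apply: measurable_funM; [exact: V2.1|exact: Nm.1].
    - apply: measurable_funN; apply: measurable_sum => p; apply: measurable_funM => //.
      by apply: measurable_funM => //; exact: Nm.1.
    - apply: filterS VE => w ->; rewrite mulNr mulr_suml; congr (- _).
      by apply: eq_bigr => p _; rewrite mulrA.
  have -> : Ex P (fun w => - \sum_(1 <= p < m.+1) p%:R^-1 * (J p w * N w)) =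
     - \sum_(1 <= p < m.+1) p%:R^-1 * Ex P (fun w => J p w * N w).
    have gen (s : seq nat) : all (fun p => p < m.+1)%N s ->
        intg P (fun w => \sum_(p <- s) p%:R^-1 * (J p w * N w)) /\
        Ex P (fun w => \sum_(p <- s) p%:R^-1 * (J p w * N w)) =
        \sum_(p <- s) p%:R^-1 * Ex P (fun w => J p w * N w).
      elim: s => [_|p s IH /= /andP[pm /IH[i1 e1]]].
        split; first by under eq_fun do rewrite big_nil; exact: intg_cst.
        by under [LHS]eq_Ex => w do rewrite big_nil; rewrite Ex_cst big_nil.
      split; first by under eq_fun do rewrite big_cons; apply: intgD => //; apply: intgZ; exact: JN.
      under [LHS]eq_Ex => w do rewrite big_cons.
      by rewrite ExD// ?ExZ ?e1 ?big_cons//; [exact: JN|apply: intgZ; exact: JN].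
    have [|i1 e1] := gen (index_iota 1 m.+1).
      by apply/allP => p; rewrite mem_index_iota => /andP[].
    by rewrite ExN// e1.
  congr (- _); apply: eq_big_nat => p /andP[p1 pm].
  have [_ wJ] := chJ p pm.
  rewrite (wiener_ito_duality wJ Nm mgS (r := p%:R)).
    by rewrite mulKf// pnatr_eq0 -lt0n.
  move=> h [p0|h1]; first by rewrite p0 in p1.
  case: p p1 {pm wJ} => // p _.
  exact: (hermite_duality isoX Dg Dg1 bg1 _ h1 Nm NE).
apply: oppr_inj; rewrite -step2 step1 -ExN.
  by apply: eq_Ex => w; rewrite dotNl mulrN opprK.
apply: (@eq_intg _ _ _ _ (fun w => dot (- DV w) (g1 (cyl_rv X S w) *: cyl_grad X S w))).
  by move=> w; rewrite dotZr.
by apply: vL2_dot; [exact: vL2N|exact: cyl1_vL2 cgS].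
Unshelve. all: by end_near. Qed.

(** Inside [g] the variable [F] is replaced by its cylindrical approximations [S n], while the outer
    [F] keeps its chaos expansion. The limit in [n] is possible because [g] and [g1] are Lipschitz
    and [G] is in L^2. *)
Lemma malliavin_ibp (F G : {RV P >-> R}) : ('E_P[F] = 0)%E -> Gamma1 dot X F G -> L2 P G ->
  Ex P (fun w => F w * g (F w)) = Ex P (fun w => g1 (F w) * G w).
Proof.
move=> EF0 [V [DF [DV [[m [f [J [chF VE]]]] mF mV GE]]]] G2.
have [F2 DF2 [S [cS cDS]]] := malliavin_approx mF.
have [V2 DV2 _] := malliavin_approx mV.
have cg1 : continuous g1 := is_derive_continuous (df := g2) Dg1.
have cg : continuous g := is_derive_continuous (df := g1) Dg.
have mgS n : mom P (fun w => g (cyl_rv X (S n) w)).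
  exact: (cyl1_mom isoX (cyl1_comp (cyl1_cylinder X (S n)) Dg cg1 bg1)).
have J2 p : (p <= m)%N -> L2 P (J p).
  by move=> pm; have [_ /wiener_ito_approx[]] := chF.1 p pm.
have mJ p : measurable_fun setT (J p) by exact: measurable_funPT.
have FJ M : mom P M -> Ex P (fun w => F w * M w) =
    Ex P (fun w => J 0%N w * M w) + \sum_(1 <= p < m.+1) Ex P (fun w => J p w * M w).
  move=> Mm; transitivity (\sum_(p < m.+1) Ex P (fun w => J p w * M w)).
    rewrite -Ex_sum => [|p]; last by apply: L2_mul; [apply: J2; rewrite -ltnS|exact: mom_L2].
    apply: ae_eq_Ex.
    - by apply: measurable_funM; [exact: F2.1|exact: Mm.1].
    - by apply: measurable_sum => p; apply: measurable_funM => //; exact: Mm.1.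
    - by apply: filterS chF.2 => w ->; rewrite mulr_suml.
  by rewrite -(big_mkord xpredT (fun p => Ex P (fun w => J p w * M w))) big_nat_recl// big_add1.
(* [I_0(c)] is constant: as [H_0 = 1], the duality applies with ratio [E M] and the test variable
   1. *)
have J0E M : mom P M -> Ex P (fun w => J 0%N w * M w) = Ex P (J 0%N) * Ex P M.
  move=> Mm; have [_ wJ0] := chF.1 0%N (leq0n m).
  have := wiener_ito_duality wJ0 Mm (mom_cst P 1) (r := Ex P M).
  rewrite (_ : (fun w => J 0%N w * 1) = J 0%N); last by apply/funext => w; rewrite mulr1.
  move=> ->; first by rewrite mulrC.
  move=> h _; rewrite /hermite /=.
  under eq_Ex => w do rewrite hornerC mul1r.
  under [X in _ = _ * X]eq_Ex => w do rewrite hornerC mul1r.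
  by rewrite Ex_cst mulr1.
(* Chaoses of positive order are centered: with [g = 1] and [N = 0] the Hermite duality reads
   [0 = p E (H_p(X h))]. *)
have Jcst p : (1 <= p < m.+1)%N -> Ex P (fun w => J p w * 1) = 0.
  case: p => // p pm; have [_ wJ] := chF.1 p.+1 pm.
  have D0 (t : R) : is_derive t 1 (fun _ : R => (1 : R)) 0 by exact: is_derive_cst.
  have D1 (t : R) : is_derive t 1 (fun _ : R => (0 : R)) 0 by exact: is_derive_cst.
  have b0 (t : R) : `|0 : R| <= 0 by rewrite normr0.
  have H0 h : dot h h = 1 -> Ex P (fun w => (hermite R p.+1).[X h w] * 1) = 0.
    move=> h1.
    have := @hermite_duality _ _ _ _ _ _ _ isoX (fun=> 1) (fun=> 0) (fun=> 0) 0
      D0 D1 b0 (S 0%N) (fun=> 0) p h h1 (mom_cst P 0).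
    have z (M : T -> R) : Ex P (fun w => M w * 0) = 0.
      by rewrite -[RHS](Ex_cst P); apply: eq_Ex => w; rewrite mulr0.
    have z' (M : T -> R) : Ex P (fun w => 0 * M w) = 0.
      by rewrite -[RHS](Ex_cst P); apply: eq_Ex => w; rewrite mul0r.
    rewrite z => Hd; have := Hd (fun Psi DPsi _ => etrans (z Psi) (esym (z' _))).
    by move/esym/eqP; rewrite mulf_eq0 pnatr_eq0/= => /eqP.
  have := wiener_ito_duality wJ (mom_cst P 1) (mom_cst P 1) (r := 0).
  rewrite mul0r => -> // h [//|/H0 ->]; by rewrite mul0r.
(* Testing the expansion of [F] against 1 leaves only the chaos of order 0, whose mean is therefore
   [E F = 0]; it then drops out of [step]. *)
have ExJ0 : Ex P (J 0%N) = 0.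
  have := FJ _ (mom_cst P 1).
  rewrite big1_seq ?addr0 => [|p]; last by rewrite mem_index_iota => /andP[_]; exact: Jcst.
  rewrite J0E; last exact: mom_cst.
  rewrite Ex_cst mulr1 => <-.
  rewrite (_ : (fun w => F w * 1) = F); last by apply/funext => w; rewrite mulr1.
  by move: EF0; rewrite unlock /Ex /Rintegral => ->.
have step n : Ex P (fun w => F w * g (cyl_rv X (S n) w)) =
    Ex P (fun w => g1 (cyl_rv X (S n) w) * dot (- DV w) (cyl_grad X (S n) w)).
  rewrite FJ// J0E// ExJ0 mul0r add0r.
  by rewrite (malliavin_chain_duality (S n) chF VE mV).
have lipg x y : `|g x - g y| <= M1 * `|x - y| by exact: lipschitz_of_derive.
have lipg1 x y : `|g1 x - g1 y| <= M2 * `|x - y| by exact: lipschitz_of_derive.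
have mF' : measurable_fun setT F by exact: measurable_funPT.
have mg : measurable_fun setT g := continuous_measurable_fun cg.
have mg1 : measurable_fun setT g1 := continuous_measurable_fun cg1.
have gF2 : L2 P (fun w => g (F w)) by exact: L2_lipschitz F2.
have g1F2 : L2 P (fun w => g1 (F w)) by exact: L2_lipschitz F2.
have S2 n : L2 P (cyl_rv X (S n)) by apply/mom_L2/(cyl1_mom isoX (cyl1_cylinder X (S n))).
have cgF := cvg_L2_lipschitz mg lipg S2 F2 cS.
have cg1F := cvg_L2_lipschitz mg1 lipg1 S2 F2 cS.
have g1S2 n : L2 P (fun w => g1 (cyl_rv X (S n) w)) by exact: L2_lipschitz (S2 n).
have l1 := cvg_L2_Ex (fun n => mom_L2 (mgS n)) gF2 F2 cgF.
have l2 := cvg_L2_Ex g1S2 g1F2 G2 cg1F.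
have vS n := cyl1_vL2 (cyl1_cylinder X (S n)).
have vD n : vL2 (fun w => DF w - cyl_grad X (S n) w) by apply: vL2D => //; exact: vL2N.
have NV2 := vL2N DV2.
have bdd n W : vL2 W -> intg P (fun w => g1 (cyl_rv X (S n) w) * dot (- DV w) (W w)).
  move=> W2; apply: intg_dom (intgZ M1 (intg_abs (vL2_dot NV2 W2))).
    by apply: measurable_funM; [exact: (g1S2 n).1|apply: measurable_dot; [exact: NV2.1|exact: W2.1]].
  by move=> w; rewrite normrM ler_wpM2r.
(* [G] is [<DF, - DV>], whereas the cylindrical identity produces the gradient of [S n] in place of
   [DF]; this is the vanishing discrepancy. *)
have l3 : Ex P (fun w => g1 (cyl_rv X (S n) w) * dot (- DV w) (DF w - cyl_grad X (S n) w))
    @[n --> \oo] --> (0 : R).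
  apply: (@cvg0_le _ _ (fun n => M1 * (Num.sqrt (Ex P (fun w => dot (- DV w) (- DV w))) *
     Num.sqrt (Ex P (fun w => dot (DF w - cyl_grad X (S n) w) (DF w - cyl_grad X (S n) w)))))).
    move=> n; apply: le_trans (Ex_abs (bdd _ _ (vD n))) _.
    apply: le_trans (ler_wpM2l (le_trans (normr_ge0 _) (bg1 0)) (vL2_cauchy_schwarz NV2 (vD n))).
    rewrite -ExZ; last exact: intg_abs (vL2_dot NV2 (vD n)).
    apply: Ex_le => [||w].
    - exact: intg_abs (bdd _ _ (vD n)).
    - exact: intgZ (intg_abs (vL2_dot NV2 (vD n))).
    - by rewrite normrM ler_wpM2r.
  rewrite -[X in _ --> X](mulr0 M1) -[X in _ --> M1 * X](mulr0 (Num.sqrt (Ex P (fun w => dot (- DV w) (- DV w))))).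
  by apply: cvgM; [exact: cvg_cst|apply: cvgM; [exact: cvg_cst|exact: cvg_sqrt0]].
have -> : Ex P (fun w => F w * g (F w)) = Ex P (fun w => g (F w) * F w).
  by apply: eq_Ex => w; rewrite mulrC.
suff l5 : Ex P (fun w => g (cyl_rv X (S n) w) * F w) @[n --> \oo] -->
    Ex P (fun w => g1 (F w) * G w) by exact: (cvg_unique _ l1 l5).
have l4 := cvgB (FF := eventually_filter) l2 l3; rewrite subr0 in l4.
apply: cvg_trans l4; apply: near_eq_cvg.
near=> n.
have -> : Ex P (fun w => g (cyl_rv X (S n) w) * F w) = Ex P (fun w => F w * g (cyl_rv X (S n) w)).
  by apply: eq_Ex => w; rewrite mulrC.
rewrite step !fctE.
have -> : Ex P (fun w => g1 (cyl_rv X (S n) w) * G w) =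
   Ex P (fun w => g1 (cyl_rv X (S n) w) * dot (- DV w) (DF w)).
  apply: ae_eq_Ex.
  - by apply: measurable_funM; [exact: (g1S2 n).1|exact: G2.1].
  - exact: intg_meas (bdd n _ DF2).
  - apply: filterS GE => w ->; rewrite dotC//.
rewrite -ExB; [|exact: bdd..].
by apply: eq_Ex => w; rewrite -mulrBr dotBr subKr.
Unshelve. all: by end_near. Qed.

End chain_rule.

End malliavin.

(** * Stein's equation for the Gamma law *)

Section stein_integral.
Context {R : realType}.
Local Notation mu := (@lebesgue_measure R).
Implicit Types (u b : R -> R) (y v : R).

(* For [y > 0] and [b = v^(nu-1)], the substitution [s = y v^2] turns this into
   [y^(-nu/2) e^(y/2) / 2] times the integral over [0, y] of
   [u(s) s^(nu/2-1) e^(-s/2)], the usual solution of Stein's equation; the present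
   form is smooth through [y = 0], as needed since [F + nu] may be negative. *)
Definition stein_int u b y : R :=
  \int[mu]_(v in `[0, 1]) (u (y * v ^+ 2) * b v * expR (y * ((1 - v ^+ 2) / 2))).

Lemma continuous_integrable01 (f : R -> R) : continuous f ->
  mu.-integrable `[0, 1] (EFin \o f).
Proof.
move=> cf; apply: continuous_compact_integrable; first exact: segment_compact.
exact: continuous_subspaceT.
Qed.

Lemma continuous_integrable01Z (c : R) (f : R -> R) : continuous f ->
  mu.-integrable `[0, 1] (EFin \o (fun v => c * f v)).
Proof.
by move=> cf; apply: continuous_integrable01 => v; apply: cvgM; [exact: cvg_cst|exact: cf].
Qed.

Let cpoly (p : {poly R}) : continuous (fun v => p.[v]).
Proof. exact: continuous_horner. Qed.

Lemma stein_integrand_continuous u b y : continuous u -> continuous b ->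
  continuous (fun v => u (y * v ^+ 2) * b v * expR (y * ((1 - v ^+ 2) / 2))).
Proof.
move=> cu cb.
have c1 : continuous (fun v => y * v ^+ 2).
  rewrite (_ : (fun v => _) = fun v => (y *: 'X^2).[v]); first exact: cpoly.
  by apply/funext => v; rewrite hornerZ hornerXn.
have c2 : continuous (fun v => y * ((1 - v ^+ 2) / 2)).
  rewrite (_ : (fun v => _) = fun v => ((y / 2) *: (1 - 'X^2)).[v]); first exact: cpoly.
  by apply/funext => v; rewrite hornerZ hornerD hornerN hornerXn hornerC; ring.
move=> v; apply: cvgM; first (apply: cvgM; last exact: cb).
  exact: (@continuous_comp _ _ _ (fun v => y * v ^+ 2) u v (c1 v) (cu _)).
exact: (@continuous_comp _ _ _ _ expR v (c2 v) (@continuous_expR R _)).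
Qed.

Lemma stein_int_integrable u b y : continuous u -> continuous b ->
  mu.-integrable `[0, 1] (EFin \o (fun v => u (y * v ^+ 2) * b v * expR (y * ((1 - v ^+ 2) / 2)))).
Proof. by move=> cu cb; exact/continuous_integrable01/stein_integrand_continuous. Qed.

(** As [0 <= 1 - v^2 <= 1], the exponent is at most [B / 2] on the whole half-line [y <= B]: a
    negative [y] only makes it smaller. *)
Lemma stein_integrand_le u b y v M B : (forall t, `|u t| <= M) ->
  0 <= v <= 1 -> `|b v| <= 1 -> y <= B -> 0 <= B ->
  `|u (y * v ^+ 2) * b v * expR (y * ((1 - v ^+ 2) / 2))| <= M * expR (B / 2).
Proof.
move=> uM /andP[v0 v1] b1 yB B0.
rewrite !normrM (ger0_norm (expR_ge0 _)) ler_pM ?mulr_ge0//.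
  by rewrite -[leRHS]mulr1 ler_pM.
rewrite ler_expR.
have vv : v ^+ 2 <= 1 by rewrite expr_le1.
have vv0 : 0 <= v ^+ 2 by exact: sqr_ge0.
by nra.
Qed.

Lemma Rintegral01_cst (r : R) : \int[mu]_(v in `[0, 1]) r = r.
Proof.
by rewrite Rintegral_cst//= lebesgue_measure_itv /= lte_fin ltr01 oppr0 adde0 mulr1.
Qed.

Lemma stein_int_le u b y M B : continuous u -> continuous b -> (forall t, `|u t| <= M) ->
  (forall v, 0 <= v <= 1 -> `|b v| <= 1) -> y <= B -> 0 <= B ->
  `|stein_int u b y| <= M * expR (B / 2).
Proof.
move=> cu cb uM b1 yB B0; have iu := stein_int_integrable y cu cb.
apply: le_trans (le_normr_Rintegral _ iu) _ => //.
rewrite -[leRHS]Rintegral01_cst; apply: le_Rintegral => //.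
- exact: integrable_norm iu.
- by apply: continuous_integrable01 => v; exact: cvg_cst.
- move=> v /=; rewrite in_itv /= => v01.
  exact: (stein_integrand_le uM v01 (b1 _ v01) yB B0).
Qed.

Let abs_le (y0 x : R) : `]y0 - 1, y0 + 1[%classic x -> x <= `|y0| + 1.
Proof.
by rewrite /= in_itv /= => /andP[_ /ltW/le_trans]; apply; rewrite lerD2r ler_norm.
Qed.

Let B0 (y0 : R) : 0 <= `|y0| + 1. Proof. by rewrite addr_ge0. Qed.

Lemma stein_int_continuous u b M : continuous u -> continuous b -> (forall t, `|u t| <= M) ->
  (forall v, 0 <= v <= 1 -> `|b v| <= 1) -> continuous (stein_int u b).
Proof.
move=> cu cb uM b1 y0.
have := @continuity_under_integral R _ _ mu
  (fun y v => u (y * v ^+ 2) * b v * expR (y * ((1 - v ^+ 2) / 2))) `[0, 1]%classic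
  (measurable_itv _) (y0 - 1) (y0 + 1) _ _ (cst (M * expR ((`|y0| + 1) / 2))).
apply => //.
- by move=> y _; exact: stein_int_integrable.
- apply: aeW => /= v _ y _; apply: (@cvgM R R); first (apply: (@cvgM R R); last exact: cvg_cst).
    apply: (@continuous_comp _ _ _ (fun y => y * v ^+ 2) u y _ (cu _)).
    exact: mulrr_continuous.
  apply: (@continuous_comp _ _ _ (fun y => y * ((1 - v ^+ 2) / 2)) expR y _ (@continuous_expR R _)).
  exact: mulrr_continuous.
- by apply: continuous_integrable01 => v; exact: cvg_cst.
- move=> y /abs_le yB; apply: aeW => v /=; rewrite in_itv /= => v01.
  exact: (stein_integrand_le uM v01 (b1 _ v01) yB (B0 _)).
- by rewrite inE /= in_itv /=; lra.
Qed.

Lemma sqr_factor_continuous b : continuous b -> continuous (fun v : R => v ^+ 2 * b v).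
Proof. by move=> cb v; apply: cvgM; [exact: exprn_continuous|exact: cb]. Qed.

Lemma onem_sqr_factor_continuous b : continuous b ->
  continuous (fun v : R => (1 - v ^+ 2) / 2 * b v).
Proof.
move=> cb v; apply: cvgM; last exact: cb.
by apply: cvgM; [apply: cvgB; [exact: cvg_cst|exact: exprn_continuous]|exact: cvg_cst].
Qed.

Lemma sqr_factor_le1 b : (forall v : R, 0 <= v <= 1 -> `|b v| <= 1) ->
  forall v : R, 0 <= v <= 1 -> `|v ^+ 2 * b v| <= 1.
Proof.
move=> b1 v /[dup] /b1 bv /andP[v0 v1].
by rewrite normrM mulr_ile1// ger0_norm ?sqr_ge0// expr_le1.
Qed.

Lemma onem_sqr_factor_le1 b : (forall v : R, 0 <= v <= 1 -> `|b v| <= 1) ->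
  forall v : R, 0 <= v <= 1 -> `|(1 - v ^+ 2) / 2 * b v| <= 1.
Proof.
move=> b1 v /[dup] /b1 bv /andP[v0 v1].
have vv : v ^+ 2 <= 1 by rewrite expr_le1.
have vv0 : 0 <= v ^+ 2 by exact: sqr_ge0.
by rewrite normrM mulr_ile1// ler_norml; lra.
Qed.

(** Differentiation under the integral stays in the family: the factors [v^2] and [(1 - v^2) / 2] go
    into [b] and preserve [|b| <= 1] on [[0, 1]]. The lemma can thus be iterated to obtain second
    derivatives. *)
Lemma stein_int_derive u u1 b M M1 : (forall t : R, is_derive t 1 u (u1 t)) ->
  continuous u1 -> continuous b -> (forall t, `|u t| <= M) -> (forall t, `|u1 t| <= M1) ->
  (forall v, 0 <= v <= 1 -> `|b v| <= 1) ->
  forall y, is_derive y 1 (stein_int u b)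
    (stein_int u1 (fun v => v ^+ 2 * b v) y + stein_int u (fun v => (1 - v ^+ 2) / 2 * b v) y).
Proof.
move=> Du cu1 cb uM uM1 b1 y0.
have cu : continuous u := is_derive_continuous (df := u1) Du.
pose phi y v := u (y * v ^+ 2) * b v * expR (y * ((1 - v ^+ 2) / 2)).
pose phi1 y v := u1 (y * v ^+ 2) * (v ^+ 2 * b v) * expR (y * ((1 - v ^+ 2) / 2)) +
   u (y * v ^+ 2) * ((1 - v ^+ 2) / 2 * b v) * expR (y * ((1 - v ^+ 2) / 2)).
have Dphi (y v : R) : is_derive y 1 (phi ^~ v) (phi1 y v).
  have Dlin (a : R) : is_derive y 1 (fun y : R => y * a) a.
    by apply: is_derive_eq; rewrite /GRing.scale /= mulr0 add0r mulr1.
  have d1 : is_derive y 1 (u \o (fun y => y * v ^+ 2)) (u1 (y * v ^+ 2) * v ^+ 2).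
    by have := Du (y * v ^+ 2); have := Dlin (v ^+ 2) => ? ?; exact: is_derive1_comp.
  have d2 : is_derive y 1 (expR \o (fun y => y * ((1 - v ^+ 2) / 2)))
      (expR (y * ((1 - v ^+ 2) / 2)) * ((1 - v ^+ 2) / 2)).
    have := Dlin ((1 - v ^+ 2) / 2); have := is_derive_expR (y * ((1 - v ^+ 2) / 2)).
    by move=> ? ?; exact: is_derive1_comp.
  have d3 : is_derive y 1 (fun y => (u \o (fun y => y * v ^+ 2)) y * b v)
      (u1 (y * v ^+ 2) * v ^+ 2 * b v).
    by apply: is_derive_eq; rewrite /GRing.scale /=; ring.
  by apply: (is_derive_eq (is_deriveM d3 d2)); rewrite /GRing.scale /= /phi1; ring.
have E (y v : R) : partial1of2 phi y v = phi1 y v.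
  by rewrite partial1of2E; have [_ ->] := Dphi y v.
have cv2 := sqr_factor_continuous cb.
have cv3 := onem_sqr_factor_continuous cb.
have bd2 := sqr_factor_le1 b1.
have bd3 := onem_sqr_factor_le1 b1.
have Iy0 : `]y0 - 1, y0 + 1[%classic y0 by rewrite /= in_itv /=; lra.
have G0 : 0 <= M1 * expR ((`|y0| + 1) / 2) + M * expR ((`|y0| + 1) / 2).
  by rewrite addr_ge0 ?mulr_ge0 ?expR_ge0// ?(le_trans (normr_ge0 _) (uM 0)) ?(le_trans (normr_ge0 _) (uM1 0)).
have iG : mu.-integrable `[0, 1] (EFin \o (cst (M1 * expR ((`|y0| + 1) / 2) + M * expR ((`|y0| + 1) / 2)))).
  by apply: continuous_integrable01 => v; exact: cvg_cst.
have iphi (x : R) : `]y0 - 1, y0 + 1[%classic x -> mu.-integrable `[0, 1] (EFin \o phi x).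
  by move=> _; exact: stein_int_integrable.
have dphi (x v : R) : `]y0 - 1, y0 + 1[%classic x -> `[0, 1]%classic v -> derivable (phi ^~ v) x 1.
  by move=> _ _; have [] := Dphi x v.
have bphi (x v : R) : `]y0 - 1, y0 + 1[%classic x -> `[0, 1]%classic v -> `|partial1of2 phi x v| <=
    cst (M1 * expR ((`|y0| + 1) / 2) + M * expR ((`|y0| + 1) / 2)) v.
  move=> /abs_le yB /=; rewrite in_itv /= => v01.
  rewrite E (le_trans (ler_normD _ _))// lerD//.
    exact: (@stein_integrand_le u1 (fun v => v ^+ 2 * b v) x v _ _ uM1 v01 (bd2 _ v01) yB (B0 _)).
  exact: (@stein_integrand_le u (fun v => (1 - v ^+ 2) / 2 * b v) x v _ _ uM v01 (bd3 _ v01) yB (B0 _)).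
apply: DeriveDef.
  exact: (@derivable_under_integral R _ _ mu phi `[0, 1]%classic (measurable_itv _)
    y0 (y0 - 1) (y0 + 1) Iy0 iphi dphi _ (fun=> G0) iG bphi).
rewrite -derive1E.
have := @differentiation_under_integral R _ _ mu phi `[0, 1]%classic (measurable_itv _)
    y0 (y0 - 1) (y0 + 1) Iy0 iphi dphi _ (fun=> G0) iG bphi.
move=> ->.
rewrite /stein_int -RintegralD//; [|exact: stein_int_integrable..].
by apply: eq_Rintegral => v _; rewrite E.
Qed.

End stein_integral.

(** * The integral representation solves Stein's equation *)

Section stein_equation.
Context {R : realType}.
Local Notation mu := (@lebesgue_measure R).

Lemma Rintegral_FTC2 (F f : R -> R) : (forall x : R, is_derive x 1 F (f x)) ->
  continuous f -> \int[mu]_(v in `[0, 1]) f v = F 1 - F 0.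
Proof.
by move=> DF cf; rewrite /Rintegral (FTC2_everywhere ltr01 DF cf).
Qed.

Lemma is_derive_pow n (x : R) : is_derive x 1 (fun x : R => x ^+ n.+1) (n.+1%:R * x ^+ n).
Proof.
have := @is_deriveX _ _ (@id R) n.+1 x 1 1 (is_derive_id x 1).
by rewrite exprfctE /GRing.scale /= mulr1.
Qed.

Lemma is_derive_gauss (r : R) : is_derive r 1 (expR \o (fun r => - (r ^+ 2 / 2)))
  (expR (- (r ^+ 2 / 2)) * - r).
Proof.
have d0 : is_derive r 1 (fun r : R => - (r ^+ 2 / 2)) (- r).
  by apply: is_derive_eq; rewrite /GRing.scale /=; field.
by have := is_derive_expR (- (r ^+ 2 / 2)) => ?; exact: is_derive1_comp.
Qed.

(** Under the integral sign the left side is the derivative in [v] of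
    [v^(n+1) u(y v^2) e^(y (1 - v^2) / 2)], which is [u(y)] at [v = 1] and 0 at [v = 0]. *)
Lemma stein_int_equation n (u u1 : R -> R) y : (forall t : R, is_derive t 1 u (u1 t)) ->
  continuous u1 ->
  2 * y * (stein_int u1 (fun v => v ^+ 2 * v ^+ n) y +
           stein_int u (fun v => (1 - v ^+ 2) / 2 * v ^+ n) y) -
  (y - n.+1%:R) * stein_int u (fun v => v ^+ n) y = u y.
Proof.
move=> Du cu1; have cu : continuous u := is_derive_continuous (df := u1) Du.
pose E (v : R) := expR (y * ((1 - v ^+ 2) / 2)).
pose psi (v : R) := v ^+ n.+1 * u (y * v ^+ 2) * E v.
pose psi1 v := 2 * y * (u1 (y * v ^+ 2) * (v ^+ 2 * v ^+ n) * E v) +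
  2 * y * (u (y * v ^+ 2) * ((1 - v ^+ 2) / 2 * v ^+ n) * E v) +
  (n.+1%:R - y) * (u (y * v ^+ 2) * v ^+ n * E v).
have cX : continuous (fun v : R => v ^+ n) by exact: exprn_continuous.
have cv2 := sqr_factor_continuous cX.
have cv3 := onem_sqr_factor_continuous cX.
have c1 := stein_integrand_continuous (y := y) cu1 cv2.
have c2 := stein_integrand_continuous (y := y) cu cv3.
have c3 := stein_integrand_continuous (y := y) cu cX.
have Dpsi (v : R) : is_derive v 1 psi (psi1 v).
  have d0 : is_derive v 1 (fun v : R => y * v ^+ 2) (2 * y * v).
    by apply: is_derive_eq; rewrite /GRing.scale /=; ring.
  have d1 : is_derive v 1 (u \o (fun v => y * v ^+ 2)) (u1 (y * v ^+ 2) * (2 * y * v)).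
    by have := Du (y * v ^+ 2) => ?; exact: is_derive1_comp.
  have d2' : is_derive v 1 (fun v : R => y * ((1 - v ^+ 2) / 2)) (- (y * v)).
    by apply: is_derive_eq; rewrite /GRing.scale /=; field.
  have d2 : is_derive v 1 (expR \o (fun v => y * ((1 - v ^+ 2) / 2))) (E v * - (y * v)).
    have := is_derive_expR (y * ((1 - v ^+ 2) / 2)).
    by move=> ?; exact: is_derive1_comp.
  have d4 := is_derive_pow n v.
  have d6 : is_derive v 1 (fun v : R => v ^+ n.+1 * u (y * v ^+ 2))
      (v ^+ n.+1 * (u1 (y * v ^+ 2) * (2 * y * v)) + u (y * v ^+ 2) * (n.+1%:R * v ^+ n)) :=
    is_deriveM d4 d1.
  have := is_deriveM d6 d2.
  move=> /is_derive_eq; apply; rewrite /GRing.scale /= /psi1 /E [v ^+ n.+1]exprS.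
  by field.
have cpsi1 : continuous psi1.
  by move=> v; do 2?[apply: cvgD]; (apply: cvgM; first exact: cvg_cst); [exact: c1|exact: c2|exact: c3].
have := Rintegral_FTC2 Dpsi cpsi1.
rewrite /psi /E !expr1n expr0n /= subrr !mul0r !mulr0 expR0 subr0 !mulr1 mul1r.
move=> <-.
have i1 := continuous_integrable01 c1.
have i2 := continuous_integrable01 c2.
have i3 := continuous_integrable01 c3.
rewrite /psi1 RintegralD//; last 2 first.
- have := continuous_integrable01Z (2 * y) c1; have := continuous_integrable01Z (2 * y) c2 => j1 j2.
  exact: integrableD j2 j1.
- exact: continuous_integrable01Z c3.
rewrite RintegralD//; [|exact: continuous_integrable01Z c1|exact: continuous_integrable01Z c2].
rewrite !RintegralZl//.
rewrite /stein_int; ring.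
Qed.

(* The integral over [0, r] of [u(s^2) s^n e^(-s^2/2)]. *)
Definition gamma_primitive n (u : R -> R) (r : R) : R :=
  r ^+ n.+1 * expR (- (r ^+ 2 / 2)) * stein_int u (fun v => v ^+ n) (r ^+ 2).

(** For [nu = n + 1] this is, up to normalization, the density of the square root of [G + nu]. In
    this variable the weight is smooth at the origin, even for [nu = 1]. *)
Definition gamma_weight n (r : R) : R := r ^+ n * expR (- (r ^+ 2 / 2)).

(** By the product rule the derivative is [gamma_weight n r] times the left side of Stein's equation
    at [y = r^2]. *)
Lemma gamma_primitive_derive n (u u1 : R -> R) M M1 : (forall t : R, is_derive t 1 u (u1 t)) ->
  continuous u1 -> (forall t, `|u t| <= M) -> (forall t, `|u1 t| <= M1) ->
  forall r : R, is_derive r 1 (gamma_primitive n u) (u (r ^+ 2) * gamma_weight n r).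
Proof.
move=> Du cu1 uM uM1 r.
have cX : continuous (fun v : R => v ^+ n) by exact: exprn_continuous.
have bX (v : R) : 0 <= v <= 1 -> `|v ^+ n| <= 1.
  by move=> /andP[v0 v1]; rewrite normrX exprn_ile1// ger0_norm.
have Df := stein_int_derive Du cu1 cX uM uM1 bX (r ^+ 2).
have SE := stein_int_equation n (r ^+ 2) Du cu1.
have d2 : is_derive r 1 (fun r : R => r ^+ 2) (2 * r).
  by apply: is_derive_eq; rewrite /GRing.scale /=; ring.
have d1 := is_derive_gauss r.
have d4 := is_derive_pow n r.
have d5 := @is_derive1_comp _ _ (fun r : R => r ^+ 2) _ _ _ Df d2.
have d6 : is_derive r 1 (fun r : R => r ^+ n.+1 * expR (- (r ^+ 2 / 2)))
    (r ^+ n.+1 * (expR (- (r ^+ 2 / 2)) * - r) + expR (- (r ^+ 2 / 2)) * (n.+1%:R * r ^+ n)) :=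
  is_deriveM d4 d1.
have := is_deriveM d6 d5.
move=> /is_derive_eq; apply; rewrite /GRing.scale /= -SE /gamma_weight [r ^+ n.+1]exprS.
by rewrite -natr1; ring.
Qed.

End stein_equation.

(** * Smoothed indicators of half-lines *)

Section smooth_step.
Context {R : realType}.

Definition clip (t : R) : R := Num.max 0 (Num.min t 1).

Lemma clip_ge0 t : 0 <= clip t.
Proof. by rewrite /clip le_max lexx. Qed.

Lemma clip_le1 t : clip t <= 1.
Proof. by rewrite /clip ge_max ler01 ge_min lexx orbT. Qed.

Lemma clip_id t : 0 <= t <= 1 -> clip t = t.
Proof. by move=> /andP[t0 t1]; rewrite /clip min_l// max_r. Qed.

Lemma clip_le0 t : t <= 0 -> clip t = 0.
Proof. by move=> t0; rewrite /clip max_l// ge_min t0. Qed.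

Lemma clip_ge1 t : 1 <= t -> clip t = 1.
Proof. by move=> t1; rewrite /clip min_r// max_r. Qed.

Lemma clip_continuous : continuous clip.
Proof.
move=> t; apply: (@continuous_max R R (fun=> 0) (fun t => Num.min t 1) t); first exact: cvg_cst.
by apply: (@continuous_min R R id (fun=> 1) t); [exact: cvg_id|exact: cvg_cst].
Qed.

(** Near 0 or 1 [clip] is constant on one side and the identity on the other; the difference
    quotients are 0 or those of [p], whose limit vanishes there by hypothesis. *)
Lemma is_derive_clip (p p1 : R -> R) : (forall t : R, is_derive t 1 p (p1 t)) ->
  p1 0 = 0 -> p1 1 = 0 -> forall t : R, is_derive t 1 (p \o clip) (p1 (clip t)).
Proof.
move=> Dp p0 p1' t.
have Dcst (c : R) : is_derive t 1 (fun _ : R => c) 0 by exact: is_derive_cst.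
have edge : clip t = t -> p1 t = 0 ->
    (\forall h \near (0 : R)^', clip (h + t) = t \/ clip (h + t) = h + t) ->
    is_derive t 1 (p \o clip) (p1 (clip t)).
  move=> ct pt near_t.
  have [dp Ep] := Dp t.
  have c0 : h^-1 *: (p (h *: 1 + t) - p t) @[h --> 0^'] --> 'D_1 p t by exact: dp.
  rewrite Ep pt in c0.
  have c1 : h^-1 *: ((p \o clip) (h *: 1 + t) - (p \o clip) t) @[h --> 0^'] --> (0 : R).
    apply/cvgrPdist_lt => e e0; have /cvgrPdist_lt/(_ _ e0) := c0.
    move=> H; near=> h; rewrite /= ct.
    have : clip (h *: 1 + t) = t \/ clip (h *: 1 + t) = h *: 1 + t.
      by rewrite scaler1; near: h.
    move=> [->|->].
    - by rewrite subrr scaler0 subr0 normr0.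
    - by near: h; exact: H.
  rewrite ct pt; apply: DeriveDef; first exact: cvgP c1.
  exact: cvg_lim c1.
have [t0|t0|t0] := ltgtP t 0.
- rewrite clip_le0 ?ltW// p0.
  apply: (near_eq_is_derive _ (Dcst (p 0))).
  near=> s; rewrite /= clip_le0// ltW//; near: s; exact: lt_nbhsl.
- have [t1|t1|t1] := ltgtP t 1.
  + rewrite clip_id ?ltW//.
    apply: (near_eq_is_derive _ (Dp t)).
    near=> s; rewrite /= clip_id//; apply/andP; split; apply: ltW; near: s.
      exact: lt_nbhsr.
    exact: lt_nbhsl.
  + rewrite clip_ge1 ?ltW// p1'.
    apply: (near_eq_is_derive _ (Dcst (p 1))).
    near=> s; rewrite /= clip_ge1// ltW//; near: s; exact: lt_nbhsr.
  + apply: edge; rewrite t1//; first by rewrite clip_ge1.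
    near=> h; have [h0|h0] := lerP h 0; [right|left].
      rewrite clip_id//; apply/andP; split; last lra.
      suff : `|h| < 1 by rewrite ltr_norml; lra.
      by near: h; apply: dnbhs0_lt.
    by rewrite clip_ge1; lra.
- apply: edge; rewrite t0//; first by rewrite clip_le0.
  near=> h; have [h0|h0] := lerP h 0; [left|right].
    by rewrite clip_le0; lra.
  rewrite clip_id//; apply/andP; split; first lra.
  suff : `|h| < 1 by rewrite ltr_norml; lra.
  by near: h; apply: dnbhs0_lt.
Unshelve. all: by end_near. Qed.

(** The quintic that falls from 1 at 0 to 0 at 1 with its first two derivatives vanishing at both
    ends, so that its extension by constants is C^2. *)
Definition step0 (t : R) : R := 1 - 10 * t ^+ 3 + 15 * t ^+ 4 - 6 * t ^+ 5.
Definition step1 (t : R) : R := - 30 * (t ^+ 2 * (1 - t) ^+ 2).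
Definition step2 (t : R) : R := - 60 * (t * (1 - t) * (1 - 2 * t)).

(** Each derivative costs a factor [1 / e]. The constants 30 and 60 are the coefficients of [step1]
    and [step2], whose remaining factors are at most 1 in absolute value on [[0, 1]]. *)
Lemma smooth_step (a e : R) : 0 < e -> exists h h1 h2 : R -> R,
  [/\ [/\ forall t : R, is_derive t 1 h (h1 t), forall t : R, is_derive t 1 h1 (h2 t) & continuous h2],
      [/\ forall t, 0 <= h t <= 1, forall t, `|h1 t| <= 30 / e & forall t, `|h2 t| <= 60 / e ^+ 2],
      forall t, t <= a -> h t = 1 & forall t, a + e <= t -> h t = 0].
Proof.
move=> e0; have e1 : e != 0 by rewrite gt_eqF.
have ei0 : 0 <= e^-1 by rewrite invr_ge0 ltW.
have ei20 : 0 <= e ^- 2 by rewrite invr_ge0 sqr_ge0.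
have D0 (t : R) : is_derive t 1 step0 (step1 t).
  by apply: is_derive_eq; rewrite /step1 /GRing.scale /=; ring.
have D1 (t : R) : is_derive t 1 step1 (step2 t).
  by apply: is_derive_eq; rewrite /step2 /GRing.scale /=; ring.
have C0 := is_derive_clip D0 _ _.
have C1 := is_derive_clip D1 _ _.
have {}C0 : forall t : R, is_derive t 1 (step0 \o clip) (step1 (clip t)).
  by apply: C0; rewrite /step1; ring.
have {}C1 : forall t : R, is_derive t 1 (step1 \o clip) (step2 (clip t)).
  by apply: C1; rewrite /step2; ring.
have Daff (y : R) : is_derive y 1 (fun y : R => (y - a) / e) e^-1.
  by apply: is_derive_eq; rewrite /GRing.scale /=; field.
pose g (p : R -> R) (y : R) := p (clip ((y - a) / e)).
exists (g step0), (fun y => e^-1 * g step1 y), (fun y => e^-2 * g step2 y).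
have Dg (p p1 : R -> R) : (forall t : R, is_derive t 1 (p \o clip) (p1 (clip t))) ->
    forall y : R, is_derive y 1 (g p) (e^-1 * g p1 y).
  move=> Dp y; have := Dp ((y - a) / e) => Dpy.
  have := @is_derive1_comp _ _ (fun y : R => (y - a) / e) _ _ _ Dpy (Daff y).
  by rewrite mulrC.
have c01 t : 0 <= clip t /\ clip t <= 1 by rewrite clip_ge0 clip_le1.
split.
- split; first exact: Dg.
    move=> y; have := Dg _ _ C1 y => Dgy.
    by apply: is_derive_eq; rewrite /GRing.scale /=; field.
  move=> y; apply: cvgM; first exact: cvg_cst.
  have cc : continuous (fun y : R => clip ((y - a) / e)).
    move=> z; apply: (@continuous_comp _ _ _ (fun y : R => (y - a) / e) clip); last exact: clip_continuous.
    exact: (is_derive_continuous (df := fun=> e^-1) Daff).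
  apply: (@continuous_comp _ _ _ (fun y : R => clip ((y - a) / e)) step2 _ (cc y)).
  rewrite /step2; apply: cvgM; first exact: cvg_cst.
  apply: cvgM; first apply: cvgM.
  + exact: cvg_id.
  + by apply: cvgB; [exact: cvg_cst|exact: cvg_id].
  + by apply: cvgB; [exact: cvg_cst|apply: cvgM; [exact: cvg_cst|exact: cvg_id]].
- split => t; rewrite /g.
  + have [] := c01 ((t - a) / e); move: (clip _) => s s0 s1; rewrite /step0.
    have s3 : 0 <= s ^+ 3 by exact: exprn_ge0.
    have r3 : 0 <= (1 - s) ^+ 3 by rewrite exprn_ge0// subr_ge0.
    have -> : 1 - 10 * s ^+ 3 + 15 * s ^+ 4 - 6 * s ^+ 5 = (1 - s) ^+ 3 * (1 + 3 * s + 6 * s ^+ 2) by ring.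
    apply/andP; split; first by rewrite mulr_ge0//; have := sqr_ge0 s; lra.
    have -> : (1 - s) ^+ 3 * (1 + 3 * s + 6 * s ^+ 2) = 1 - s ^+ 3 * (10 - 15 * s + 6 * s ^+ 2) by ring.
    by rewrite lerBlDr lerDl mulr_ge0//; nra.
  + rewrite normrM (ger0_norm ei0) [leLHS]mulrC ler_wpM2r//.
    have [] := c01 ((t - a) / e); move: (clip _) => s s0 s1; rewrite /step1.
    rewrite mulNr normrN ger0_norm ?mulr_ge0 ?sqr_ge0 ?subr_ge0//.
    by rewrite -[leRHS]mulr1 ler_wpM2l// mulr_ile1 ?sqr_ge0// expr_le1//; lra.
  + rewrite normrM (ger0_norm ei20) [leLHS]mulrC ler_wpM2r//.
    have [] := c01 ((t - a) / e); move: (clip _) => s s0 s1; rewrite /step2.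
    rewrite mulNr normrN normrM (@ger0_norm _ 60)// -[leRHS]mulr1 ler_wpM2l// !normrM !mulr_ile1 ?mulr_ge0//;
      by rewrite ler_norml; lra.
- move=> t ta; rewrite /g clip_le0; first by rewrite /step0; ring.
  by rewrite pmulr_lle0 ?invr_gt0// subr_le0.
- move=> t ta; rewrite /g clip_ge1; first by rewrite /step0; ring.
  by rewrite ler_pdivlMr// mul1r lerBrDl.
Qed.

End smooth_step.

(** * Bounds on the solution of Stein's equation *)

Section stein_solution.
Context {R : realType}.
Local Notation mu := (@lebesgue_measure R).

Lemma le_of_derive (f df : R -> R) (a b : R) : (forall x : R, is_derive x 1 f (df x)) ->
  a <= b -> (forall x, a < x < b -> 0 <= df x) -> f a <= f b.
Proof.
move=> Df; rewrite le_eqVlt => /predU1P[->//|ab] df0.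
have cf : {within `[a, b], continuous f}.
  exact/continuous_subspaceT/(is_derive_continuous (df := df) Df).
have [c cab E] := MVT ab (fun x _ => Df x) cf.
rewrite -subr_ge0 E; apply: mulr_ge0; last by rewrite subr_ge0 ltW.
by apply: df0; rewrite in_itv /= in cab.
Qed.

Variable n : nat.

Lemma gamma_weight_ge0 r : 0 <= r -> 0 <= gamma_weight n r :> R.
Proof. by move=> r0; rewrite mulr_ge0 ?expR_ge0// exprn_ge0. Qed.

(** The integral of [gamma_weight n] over [[0, r]], hence the unnormalized distribution function of
    the square root of [G + nu]. *)
Definition gamma_mass (r : R) : R := gamma_primitive n (fun=> 1) r.

Lemma gamma_primitive0 (u : R -> R) : gamma_primitive n u 0 = 0.
Proof. by rewrite /gamma_primitive expr0n /= !mul0r. Qed.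

Lemma gamma_mass_derive (r : R) : is_derive r 1 gamma_mass (gamma_weight n r).
Proof.
have D (t : R) : is_derive t 1 (fun _ : R => (1 : R)) 0 by exact: is_derive_cst.
have := gamma_primitive_derive n (M := 1) (M1 := 0) D (fun=> cvg_cst _) _ _ r.
by rewrite mul1r; apply => t; rewrite ?normr1 ?normr0.
Qed.

Lemma gamma_mass_le r s : 0 <= r -> r <= s -> gamma_mass r <= gamma_mass s.
Proof.
move=> r0 rs; apply: (le_of_derive gamma_mass_derive) => // x /andP[rx _].
by rewrite gamma_weight_ge0// (le_trans r0)// ltW.
Qed.

Lemma gamma_mass_ge0 r : 0 <= r -> 0 <= gamma_mass r.
Proof. by move=> r0; rewrite -[leLHS](gamma_primitive0 (fun=> 1)) gamma_mass_le. Qed.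

Lemma gamma_weightS_derive (r : R) : is_derive r 1 (gamma_weight n.+1)
  ((n.+1%:R - r ^+ 2) * gamma_weight n r).
Proof.
have d1 := is_derive_gauss r.
have := is_deriveM (is_derive_pow n r) d1.
by move=> /is_derive_eq; apply; rewrite /GRing.scale /= /gamma_weight [r ^+ n.+1]exprS; ring.
Qed.

(** The sum [gamma_mass + gamma_weight n.+1] has derivative [(n + 2 - x^2) gamma_weight n x], so it
    is nonincreasing once [x^2 >= n + 2]. This is where the threshold [n + 2] of the later estimates
    comes from. *)
Lemma gamma_mass_tail r s : 0 <= r -> n.+2%:R <= r ^+ 2 -> r <= s ->
  gamma_mass s <= gamma_mass r + gamma_weight n.+1 r.
Proof.
move=> r0 rn rs.
have D (x : R) : is_derive x 1 (fun x => - (gamma_mass x + gamma_weight n.+1 x))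
    (- (gamma_weight n x + (n.+1%:R - x ^+ 2) * gamma_weight n x)).
  by have := gamma_mass_derive x; have := gamma_weightS_derive x => ? ?; exact: is_deriveN.
have := le_of_derive D rs; rewrite lerN2.
have ws : 0 <= gamma_weight n.+1 s :> R.
  by rewrite mulr_ge0 ?expR_ge0// exprn_ge0// (le_trans r0).
move=> H; apply: le_trans (H _); first by rewrite lerDl.
move=> x /andP[rx _].
have x0 : 0 <= x by rewrite (le_trans r0)// ltW.
have : r ^+ 2 <= x ^+ 2 by rewrite lerXn2r ?nnegrE// ltW.
move: rn (gamma_weight_ge0 x0); rewrite -[n.+2%:R]natr1 => rn w0 rx2.
by nra.
Qed.

(** The total mass of the weight on the half-line, written as a supremum rather than as an improper
    integral. *)
Definition gamma_total : R := sup [set gamma_mass `|r| | r in [set: R]].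

Let bounded : has_sup [set gamma_mass `|r| | r in [set: R]].
Proof.
split; first by exists (gamma_mass `|0 : R|), 0.
exists (gamma_mass n.+2%:R + gamma_weight n.+1 n.+2%:R) => _ [r _ <-].
have n2 : (0 : R) <= n.+2%:R by [].
have w0 : 0 <= gamma_weight n.+1 n.+2%:R :> R by rewrite mulr_ge0 ?expR_ge0// exprn_ge0.
have [rn|/ltW rn] := leP `|r| n.+2%:R.
  by apply: (le_trans (gamma_mass_le _ rn)) => //; rewrite lerDl.
apply: gamma_mass_tail => //; rewrite expr2 ler_peMl// (ler_nat _ 1)//.
Qed.

Lemma gamma_mass_le_total r : 0 <= r -> gamma_mass r <= gamma_total.
Proof.
move=> r0; have := sup_upper_bound bounded; apply; exists r; first by [].
by rewrite (ger0_norm r0).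
Qed.

Lemma gamma_total_le M : (forall r, 0 <= r -> gamma_mass r <= M) -> gamma_total <= M.
Proof.
move=> WM; apply: ge_sup; first by case: bounded.
by move=> _ [r _ <-]; exact: WM.
Qed.

Lemma gamma_total_gt0 : 0 < gamma_total.
Proof.
apply: lt_le_trans (gamma_mass_le_total ler01).
have cW : {within `[0, 1], continuous gamma_mass}.
  exact/continuous_subspaceT/(is_derive_continuous (df := gamma_weight n) gamma_mass_derive).
have [c] := MVT ltr01 (fun x _ => gamma_mass_derive x) cW.
rewrite in_itv /= /gamma_mass gamma_primitive0 !subr0 mulr1 => /andP[c0 _] ->.
by rewrite mulr_gt0 ?expR_gt0 ?exprn_gt0.
Qed.

Lemma gamma_total_tail r : 0 <= r -> n.+2%:R <= r ^+ 2 ->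
  gamma_total - gamma_mass r <= gamma_weight n.+1 r.
Proof.
move=> r0 rn; rewrite lerBlDl; apply: gamma_total_le => s s0.
have [rs|/ltW sr] := leP r s; first exact: gamma_mass_tail.
apply: le_trans (gamma_mass_le s0 sr) _.
by rewrite lerDl mulr_ge0 ?expR_ge0// exprn_ge0.
Qed.

Lemma gamma_primitiveB (u : R -> R) (c r : R) : continuous u ->
  gamma_primitive n (fun t => u t - c) r = gamma_primitive n u r - c * gamma_mass r.
Proof.
move=> cu; rewrite /gamma_mass /gamma_primitive.
have cX : continuous (fun v : R => v ^+ n) by exact: exprn_continuous.
have c1 : continuous (fun _ : R => (1 : R)) by move=> x; exact: cvg_cst.
have i1 := stein_int_integrable (r ^+ 2) cu cX.
have i2 := stein_int_integrable (r ^+ 2) c1 cX.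
suff -> : stein_int (fun t => u t - c) (fun v => v ^+ n) (r ^+ 2) =
    stein_int u (fun v => v ^+ n) (r ^+ 2) - c * stein_int (fun=> 1) (fun v => v ^+ n) (r ^+ 2).
  by ring.
rewrite /stein_int -RintegralZl// -RintegralB//.
  by apply: eq_Rintegral => v _; ring.
have cc := stein_integrand_continuous (y := r ^+ 2) c1 cX.
exact: (continuous_integrable01Z c cc).
Qed.

Section solution.
Variables (a e : R) (h h1 h2 : R -> R).
Hypotheses (e0 : 0 < e) (Dh : forall t : R, is_derive t 1 h (h1 t))
  (Dh1 : forall t : R, is_derive t 1 h1 (h2 t)) (ch2 : continuous h2)
  (h01 : forall t : R, 0 <= h t <= 1) (bh1 : forall t, `|h1 t| <= 30 / e)
  (bh2 : forall t, `|h2 t| <= 60 / e ^+ 2)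
  (ha : forall t : R, t <= a -> h t = 1) (hae : forall t : R, a + e <= t -> h t = 0).

Let ch1 : continuous h1 := is_derive_continuous (df := h2) Dh1.
Let ch : continuous h := is_derive_continuous (df := h1) Dh.
Let W := gamma_mass.
Let Z := gamma_total.
(** [h (r^2)] vanishes beyond this radius. [Num.sqrt] returns 0 on negative numbers, in accordance
    with [G + nu] being nonnegative, so the sign of [a + e] is not distinguished. *)
Let rs : R := Num.sqrt (a + e).

Let Bh := gamma_primitive n h.

Let DBh (r : R) : is_derive r 1 Bh (h (r ^+ 2) * gamma_weight n r).
Proof.
apply: (gamma_primitive_derive n (M := 1) Dh ch1 _ bh1) => t; rewrite ger0_norm; last by have /andP[] := h01 t.
by have /andP[] := h01 t.
Qed.

(** This is [E h(G + nu)]; the integral may stop at [rs]. *)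
Definition stein_center : R := Bh rs / Z.
Let c := stein_center.

Let rs0 : 0 <= rs. Proof. exact: sqrtr_ge0. Qed.

Let Bh_le : Bh rs <= W rs.
Proof.
have D (x : R) : is_derive x 1 (fun x => W x - Bh x) (gamma_weight n x - h (x ^+ 2) * gamma_weight n x).
  by have := gamma_mass_derive x; have := DBh x => ? ?; exact: is_deriveB.
have := le_of_derive D rs0; rewrite /W /Bh /gamma_mass !gamma_primitive0 subrr subr_ge0; apply.
move=> x /andP[x0 _]; have := gamma_weight_ge0 (ltW x0); have /andP[] := h01 (x ^+ 2).
by move=> ? ? ?; nra.
Qed.

Let Bh_mono (r s : R) : 0 <= r -> r <= s -> Bh r <= Bh s.
Proof.
move=> r0 rs'; apply: (le_of_derive DBh) => // x /andP[rx _].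
have /andP[] := h01 (x ^+ 2) => ? ?; rewrite mulr_ge0// gamma_weight_ge0//.
by rewrite (le_trans r0)// ltW.
Qed.

Let Bh_ge : W (Num.sqrt a) <= Bh rs.
Proof.
apply: (@le_trans _ _ (Bh (Num.sqrt a))); last first.
  by apply: Bh_mono; [exact: sqrtr_ge0|rewrite ler_wsqrtr// lerDl ltW].
have D (x : R) : is_derive x 1 (fun x => Bh x - W x) (h (x ^+ 2) * gamma_weight n x - gamma_weight n x).
  by have := gamma_mass_derive x; have := DBh x => ? ?; exact: is_deriveB.
have := le_of_derive D (sqrtr_ge0 a); rewrite {1 2}/W /Bh /gamma_mass !gamma_primitive0 subrr subr_ge0; apply.
move=> x /andP[x0 xa]; rewrite ha ?mul1r ?subrr//.
have a0 : 0 <= a by rewrite leNgt; apply/negP => /ltW/ler0_sqrtr a0; move: xa; rewrite a0 ltNge ltW.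
by rewrite -[leRHS](sqr_sqrtr a0) lerXn2r ?nnegrE ?sqrtr_ge0 ?ltW.
Qed.

(** With the next bound, [E h(G + nu)] is enclosed between the distribution function of [G + nu] at
    [a] and at [a + e]; the smoothing error is then a modulus of continuity. *)
Lemma stein_center_ge : W (Num.sqrt a) / Z <= stein_center.
Proof. by apply: ler_wpM2r => //; rewrite invr_ge0; exact: ltW gamma_total_gt0. Qed.

Lemma stein_center_le : stein_center <= W (Num.sqrt (a + e)) / Z.
Proof. by apply: ler_wpM2r => //; rewrite invr_ge0; exact: ltW gamma_total_gt0. Qed.

Let c0 : 0 <= c.
Proof.
apply: le_trans stein_center_ge; apply: mulr_ge0.
  by apply: gamma_mass_ge0; exact: sqrtr_ge0.
by rewrite invr_ge0; exact: ltW gamma_total_gt0.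
Qed.

Let c1 : c <= 1.
Proof.
apply: (le_trans stein_center_le); rewrite (ler_pdivrMr _ _ gamma_total_gt0) mul1r.
by apply: gamma_mass_le_total; exact: sqrtr_ge0.
Qed.

Let u t := h t - c.

Let Du (t : R) : is_derive t 1 u (h1 t).
Proof.
have Dc : is_derive t 1 (fun _ : R => c) 0 by exact: is_derive_cst.
by have := Dh t => ?; have := is_deriveB (Dh t) Dc; rewrite subr0.
Qed.

Let cu : continuous u := is_derive_continuous (df := h1) Du.

Let bu t : `|u t| <= 1.
Proof. by have /andP[? ?] := h01 t; rewrite /u ler_norml; move: c0 c1 => ? ?; lra. Qed.

Let B := gamma_primitive n u.

Let BE r : B r = Bh r - c * W r. Proof. exact: gamma_primitiveB. Qed.

Let DB (r : R) : is_derive r 1 B (u (r ^+ 2) * gamma_weight n r).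
Proof. exact: (gamma_primitive_derive n Du ch1 bu bh1). Qed.

(** The choice of [c] makes the integral of [u] against the weight vanish over the whole half-line.
    Beyond [rs], where [u = - c], [B r] is thus [c] times the remaining mass. *)
Let B_end (r : R) : rs <= r -> B r = c * (Z - W r).
Proof.
move=> rr; rewrite BE mulrBr; congr (_ - _).
have -> : c * Z = Bh rs by rewrite /c /stein_center divfK// gt_eqF// gamma_total_gt0.
apply/eqP; rewrite eq_le; apply/andP; split; last exact: (Bh_mono rs0 rr).
rewrite -lerN2.
have D (x : R) : is_derive x 1 (fun x => - Bh x) (- (h (x ^+ 2) * gamma_weight n x)).
  by have := DBh x => ?; exact: is_deriveN.
apply: (le_of_derive D) => // x /andP[rx _]; rewrite hae ?mul0r ?oppr0//.
have x0 : 0 <= x by rewrite (le_trans rs0)// ltW.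
have [ae0|ae0] := leP 0 (a + e); last by rewrite (le_trans (ltW ae0))// sqr_ge0.
by rewrite -[leLHS](sqr_sqrtr ae0) lerXn2r ?nnegrE// ltW.
Qed.

(** [B r] is minus the integral of [u] over the tail, and [|u| <= 1]. Concretely [W + B] and [W - B]
    are nondecreasing up to [rs], where [B_end] takes over. *)
Let B_le (r : R) : 0 <= r -> `|B r| <= Z - W r.
Proof.
move=> r0.
have WZ (s : R) : 0 <= s -> W s <= Z by exact: gamma_mass_le_total.
have [rr|/ltW rr] := leP rs r.
  rewrite B_end// ger0_norm; last by apply: mulr_ge0 => //; rewrite subr_ge0; exact: WZ.
  by apply: ler_piMl => //; rewrite subr_ge0; exact: WZ.
have Dp (x : R) : is_derive x 1 (fun x => B x + W x) (u (x ^+ 2) * gamma_weight n x + gamma_weight n x).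
  by have := gamma_mass_derive x; have := DB x => ? ?; exact: is_deriveD.
have Dm (x : R) : is_derive x 1 (fun x => W x - B x) (gamma_weight n x - u (x ^+ 2) * gamma_weight n x).
  by have := gamma_mass_derive x; have := DB x => ? ?; exact: is_deriveB.
have wx x : r < x < rs -> 0 <= gamma_weight n x.
  by move=> /andP[rx _]; rewrite gamma_weight_ge0// (le_trans r0)// ltW.
have ub x : - 1 <= u x <= 1 by rewrite -ler_norml.
have up : B r + W r <= B rs + W rs.
  apply: (le_of_derive Dp rr) => x /wx w0.
  rewrite (_ : _ + _ = (u (x ^+ 2) + 1) * gamma_weight n x); last by ring.
  apply: mulr_ge0 w0; have /andP[? _] := ub (x ^+ 2); lra.
have um : W r - B r <= W rs - B rs.
  apply: (le_of_derive Dm rr) => x /wx w0.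
  rewrite (_ : _ - _ = (1 - u (x ^+ 2)) * gamma_weight n x); last by ring.
  apply: mulr_ge0 w0; have /andP[_ ?] := ub (x ^+ 2); lra.
have q : 0 <= c * (Z - W rs) by apply: mulr_ge0 => //; rewrite subr_ge0; exact: WZ.
have p : 0 <= (1 - c) * (Z - W rs) by apply: mulr_ge0; rewrite subr_ge0 ?c1//; exact: WZ.
have ws := WZ _ rs0.
rewrite (B_end (lexx rs)) in up um; rewrite ler_norml.
move: up um q p ws; move: (B r) (W r) (W rs) Z c => b w w' z k.
by move=> *; apply/andP; split; lra.
Qed.

Let f := stein_int u (fun v => v ^+ n).

(** With [r = sqrt y], [f y] is [B r] divided by [r^(n+1) e^(- r^2 / 2)], and this divisor is
    exactly the bound of [gamma_total_tail] on the tail mass. *)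
Let f_le (y : R) : n.+2%:R <= y -> `|f y| <= 1.
Proof.
move=> ny; have y0 : 0 < y by apply: lt_le_trans ny.
have r0 : 0 < Num.sqrt y by rewrite sqrtr_gt0.
have ry : Num.sqrt y ^+ 2 = y by rewrite sqr_sqrtr// ltW.
have := B_le (ltW r0); rewrite /B /gamma_primitive ry -/f.
have w0 : 0 < Num.sqrt y ^+ n.+1 * expR (- (y / 2)).
  by rewrite mulr_gt0 ?expR_gt0// exprn_gt0.
rewrite normrM gtr0_norm// => h'.
rewrite -(ler_pM2l w0) mulr1 (le_trans h')//.
have := gamma_total_tail (ltW r0); rewrite ry /gamma_weight ry.
exact.
Qed.

Let f1 y := stein_int h1 (fun v => v ^+ 2 * v ^+ n) y +
  stein_int u (fun v => (1 - v ^+ 2) / 2 * v ^+ n) y.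

Let cX : continuous (fun v : R => v ^+ n). Proof. exact: exprn_continuous. Qed.

Let bX (v : R) : 0 <= v <= 1 -> `|v ^+ n| <= 1.
Proof. by move=> /andP[v0 v1]; rewrite normrX exprn_ile1// ger0_norm. Qed.

Let Df (y : R) : is_derive y 1 f (f1 y).
Proof. exact: stein_int_derive Du ch1 cX bu bh1 bX y. Qed.

Let f2 y := (stein_int h2 (fun v => v ^+ 2 * (v ^+ 2 * v ^+ n)) y +
    stein_int h1 (fun v => (1 - v ^+ 2) / 2 * (v ^+ 2 * v ^+ n)) y) +
  (stein_int h1 (fun v => v ^+ 2 * ((1 - v ^+ 2) / 2 * v ^+ n)) y +
    stein_int u (fun v => (1 - v ^+ 2) / 2 * ((1 - v ^+ 2) / 2 * v ^+ n)) y).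

Let Df1 (y : R) : is_derive y 1 f1 (f2 y).
Proof.
have d1 := stein_int_derive Dh1 ch2 (sqr_factor_continuous cX) bh1 bh2 (sqr_factor_le1 bX) y.
have d2 := stein_int_derive Du ch1 (onem_sqr_factor_continuous cX) bu bh1 (onem_sqr_factor_le1 bX) y.
exact: is_deriveD.
Qed.

Let cf2 : continuous f2.
Proof.
move=> y; apply: cvgD; apply: cvgD.
- exact: stein_int_continuous ch2 (sqr_factor_continuous (sqr_factor_continuous cX)) bh2 (sqr_factor_le1 (sqr_factor_le1 bX)) y.
- exact: stein_int_continuous ch1 (onem_sqr_factor_continuous (sqr_factor_continuous cX)) bh1 (onem_sqr_factor_le1 (sqr_factor_le1 bX)) y.
- exact: stein_int_continuous ch1 (sqr_factor_continuous (onem_sqr_factor_continuous cX)) bh1 (sqr_factor_le1 (onem_sqr_factor_le1 bX)) y.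
- exact: stein_int_continuous cu (onem_sqr_factor_continuous (onem_sqr_factor_continuous cX)) bu (onem_sqr_factor_le1 (onem_sqr_factor_le1 bX)) y.
Qed.

Let f_eq y : 2 * y * f1 y - (y - n.+1%:R) * f y = u y.
Proof. exact: stein_int_equation. Qed.

Let n1 : (1 : R) <= n.+1%:R. Proof. by rewrite ler1n. Qed.
Let n2E : n.+2%:R = n.+1%:R + 1 :> R. Proof. by rewrite -[LHS]natr1. Qed.
Let E := expR (n.+2%:R / 2 : R).

(** Solved for [f1], the equation gives [|f1| <= (1 + y - nu) / (2 y)], which is at most [1 / 2]
    because [nu >= 1]. *)
Let f1_le_far (y : R) : n.+2%:R <= y -> `|f1 y| <= 1 / 2.
Proof.
move=> ny; move: (f_eq y) (bu y) (f_le ny) (ny) n1; rewrite n2E !ler_norml.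
move: (f1 y) (f y) (u y) (n.+1%:R : R) => p q k m E1 /andP[? ?] /andP[? ?] ? ?.
have q1 : 0 <= (y - m) * (1 - q) by apply: mulr_ge0; lra.
have q2 : 0 <= (y - m) * (1 + q) by apply: mulr_ge0; lra.
by apply/andP; split; nra.
Qed.

(** Up to [y = nu + 1] the integral representation gives the bounds, beyond it the equation does.
    The constant 31 adds the 30 of [h1] to the bound 1 on [u], using [1 <= 1 / e]. For [f2] a finite
    bound suffices, as its value does not enter the final estimate. *)
Lemma stein_solution_exists : e <= 1 -> exists f f1 f2 : R -> R,
  [/\ forall t : R, is_derive t 1 f (f1 t), forall t : R, is_derive t 1 f1 (f2 t), continuous f2,
      (forall t, `|f1 t| <= 31 * E / e) /\ exists M : R, forall t, `|f2 t| <= M &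
      forall y, 2 * y * f1 y - (y - n.+1%:R) * f y = h y - stein_center].
Proof.
move=> e1; exists f, f1, f2.
have E1 : 1 <= E by rewrite -expR0 ler_expR divr_ge0.
have ei : 1 <= e^-1 by rewrite invf_ge1.
have nn : (0 : R) <= n.+2%:R by [].
split; [exact: Df|exact: Df1|exact: cf2| |exact: f_eq].
split.
  move=> y; have [yn|/ltW ny] := leP y n.+2%:R.
    have b1 := stein_int_le ch1 (sqr_factor_continuous cX) bh1 (sqr_factor_le1 bX) yn nn.
    have b2 := stein_int_le cu (onem_sqr_factor_continuous cX) bu (onem_sqr_factor_le1 bX) yn nn.
    apply: (le_trans (ler_normD _ _)); apply: (le_trans (lerD b1 b2)).
    rewrite -/E -mulrDl -mulrA [E * _]mulrC mulrA ler_wpM2r ?expR_ge0//.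
    by lra.
  by apply: (le_trans (f1_le_far ny)); nra.
exists ((60 / e ^+ 2 + 30 / e + 30 / e + 1) * E + (30 / e + 2)) => y.
have ee0 : 0 <= 30 / e by rewrite divr_ge0// ltW.
have ee1 : 0 <= 60 / e ^+ 2 by rewrite divr_ge0// sqr_ge0.
have [yn|/ltW ny] := leP y n.+2%:R.
  have b1 := stein_int_le ch2 (sqr_factor_continuous (sqr_factor_continuous cX)) bh2 (sqr_factor_le1 (sqr_factor_le1 bX)) yn nn.
  have b2 := stein_int_le ch1 (onem_sqr_factor_continuous (sqr_factor_continuous cX)) bh1 (onem_sqr_factor_le1 (sqr_factor_le1 bX)) yn nn.
  have b3 := stein_int_le ch1 (sqr_factor_continuous (onem_sqr_factor_continuous cX)) bh1 (sqr_factor_le1 (onem_sqr_factor_le1 bX)) yn nn.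
  have b4 := stein_int_le cu (onem_sqr_factor_continuous (onem_sqr_factor_continuous cX)) bu (onem_sqr_factor_le1 (onem_sqr_factor_le1 bX)) yn nn.
  apply: (le_trans (ler_normD _ _)).
  apply: (le_trans (lerD (le_trans (ler_normD _ _) (lerD b1 b2)) (le_trans (ler_normD _ _) (lerD b3 b4)))).
  by rewrite -/E; nra.
apply: (@le_trans _ _ (30 / e + 2)); last first.
  by rewrite lerDr mulr_ge0 ?expR_ge0// !addr_ge0.
(* Differentiating the equation expresses [2 y f2] through [h1], [f] and [f1], for which bounds are
   known on this range. *)
have Dl : is_derive y 1 (fun y : R => 2 * y * f1 y - (y - n.+1%:R) * f y)
    (2 * f1 y + 2 * y * f2 y - (f y + (y - n.+1%:R) * f1 y)).
  have := Df y; have := Df1 y => ? ?.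
  by apply: is_derive_eq; rewrite /GRing.scale /=; ring.
have Eq : 2 * f1 y + 2 * y * f2 y - (f y + (y - n.+1%:R) * f1 y) = h1 y.
  rewrite -(@derive_val _ _ _ _ _ _ _ Dl) -(@derive_val _ _ _ _ _ _ _ (Du y)).
  by congr ('D_1 _ y); apply/funext => z; exact: f_eq.
move: Eq (bh1 y) (f_le ny) (f1_le_far ny) (ny) n1; rewrite n2E !ler_norml.
move: (30 / e) ee0 => k k0 Eq /andP[? ?] /andP[? ?] /andP[? ?] ? ?.
by apply/andP; split; nra.
Qed.

End solution.
End stein_solution.

(** * The centered Gamma distribution function *)

Section gamma_cdf.
Context {R : realType}.
Local Notation mu := (@lebesgue_measure R).
Variable n : nat.

Let W := @gamma_mass R n.
Let Z := @gamma_total R n.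

(** The constant that relates the Gamma density at [x = r^2 / 2] to [gamma_weight n r]. *)
Definition gamma_scale : R := (Gamma_fun (n.+1%:R / 2))^-1 / 2 `^ (n.+1%:R / 2 - 1).

Let k := gamma_scale.

Lemma gamma_scale_ge0 : 0 <= gamma_scale.
Proof.
rewrite /gamma_scale mulr_ge0// invr_ge0 ?powR_ge0//.
by apply: Rintegral_ge0 => x _; rewrite mulr_ge0 ?powR_ge0 ?expR_ge0.
Qed.

Let p (x : R) : R := k * (gamma_weight n (Num.sqrt (2 * x)) / Num.sqrt (2 * x)).

Lemma gamma_pdfE x : 0 < x -> gamma_pdf (n.+1%:R / 2) x = p x.
Proof.
move=> x0; have x20 : 0 < 2 * x by lra.
rewrite /gamma_pdf indicE mem_set ?mulr1; last by rewrite /= in_itv/= x0.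
rewrite /p /gamma_weight sqr_sqrtr ?ltW// (_ : 2 * x / 2 = x); last by field.
have -> : Num.sqrt (2 * x) ^+ n * expR (- x) / Num.sqrt (2 * x) =
    (2 `^ (n.+1%:R / 2 - 1) * x `^ (n.+1%:R / 2 - 1)) * expR (- x).
  rewrite -powRM ?ltW// mulrAC; congr (_ * _).
  rewrite -powR12_sqrt ?ltW// -powR_mulrn ?powR_ge0// -powRrM -powRB; last first.
    by apply/implyP => _; rewrite gt_eqF.
  by congr (_ `^ _); rewrite -[n.+1%:R]natr1; field.
rewrite /k /gamma_scale; have : 2 `^ (n.+1%:R / 2 - 1) != 0 :> R by rewrite gt_eqF// powR_gt0.
move: (2 `^ _) (x `^ _) (expR _) (Gamma_fun _)^-1 => s t u v s0.
by field.
Qed.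

Let F (x : R) : R := k * W (Num.sqrt (2 * x)).

Let cW : continuous W.
Proof. exact: (is_derive_continuous (df := gamma_weight n) (@gamma_mass_derive R n)). Qed.

Let cs : continuous (fun x : R => Num.sqrt (2 * x)).
Proof.
move=> x; apply: (@continuous_comp _ _ _ (fun x : R => 2 * x) Num.sqrt).
  exact: mulrl_continuous.
exact: sqrt_continuous.
Qed.

Let cF : continuous F.
Proof.
move=> x; apply: cvgM; first exact: cvg_cst.
by apply: (continuous_comp (f := fun x : R => Num.sqrt (2 * x)) (g := W)); [exact: cs|exact: cW].
Qed.

Let DF (x : R) : 0 < x -> is_derive x 1 F (p x).
Proof.
move=> x0; have x20 : 0 < 2 * x by lra.
have d2 : is_derive x 1 (fun x : R => 2 * x) 2.
  by apply: is_derive_eq; rewrite /GRing.scale /= mulr1.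
have d1 : is_derive x 1 (Num.sqrt \o (fun x : R => 2 * x)) ((2 * Num.sqrt (2 * x))^-1 * 2).
  by have := is_derive1_sqrt x20 => ?; exact: is_derive1_comp.
have d3 := @is_derive1_comp _ W (Num.sqrt \o (fun x : R => 2 * x)) x _ _ (gamma_mass_derive n (Num.sqrt (2 * x))) d1.
have d4 : is_derive x 1 (fun x : R => k * W (Num.sqrt (2 * x)))
    (k * (gamma_weight n (Num.sqrt (2 * x)) * ((2 * Num.sqrt (2 * x))^-1 * 2))).
  exact: (is_deriveZ k d3).
apply: (is_derive_eq d4); rewrite /p; congr (_ * (_ * _)).
by rewrite invfM mulrC mulrA divff ?mul1r.
Qed.

Let cp (x : R) : 0 < x -> {for x, continuous p}.
Proof.
move=> x0; apply: cvgM; first exact: cvg_cst.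
apply: cvgM; last first.
  apply: cvgV; last exact: cs.
  by rewrite gt_eqF// sqrtr_gt0; lra.
apply: (continuous_comp (f := fun x : R => Num.sqrt (2 * x)) (g := gamma_weight n)); first exact: cs.
have ce : continuous (fun r : R => expR (- (r ^+ 2 / 2))).
  move=> r; apply: (@continuous_comp _ _ _ (fun r : R => - (r ^+ 2 / 2)) expR r); last exact: continuous_expR.
  by apply: cvgN; apply: cvgM; [exact: exprn_continuous|exact: cvg_cst].
by apply: cvgM; [exact: exprn_continuous|exact: ce].
Qed.

(** The left endpoint is kept positive because the density is unbounded at 0 when [nu = 1]; the
    origin is reached later by right continuity. *)
Lemma gamma_law_itv (x y : R) : 0 < x -> x < y ->
  gamma_law (n.+1%:R / 2) `]x, y] = (k * W (Num.sqrt (2 * y)) - k * W (Num.sqrt (2 * x)))%:E.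
Proof.
move=> x0 xy.
have cpI : {within `[x, y], continuous p}.
  apply: continuous_in_subspaceT => z; rewrite inE /= in_itv /= => /andP[xz _].
  by apply: cp; exact: lt_le_trans xz.
have mp : measurable_fun `]x, y] (EFin \o p).
  apply/measurable_EFinP; apply: (@measurable_funS _ _ _ _ `[x, y]%classic) => //.
    exact: subset_itv_oc_cc.
  by apply: subspace_continuous_measurable_fun.
rewrite /gamma_law; transitivity (\int[mu]_(z in `]x, y]) (p z)%:E)%E.
  apply: eq_integral => z; rewrite inE /= in_itv /= => /andP[xz _].
  by rewrite gamma_pdfE//; exact: lt_trans xz.
rewrite integral_itv_obnd_cbnd//.
rewrite (@continuous_FTC2 _ p F x y xy cpI) -?EFinB//.
- split.
  + by move=> z; rewrite in_itv /= => /andP[xz _]; have [] := DF (lt_trans x0 xz).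
  + by apply: cvg_at_right_filter; exact: cF.
  + by apply: cvg_at_left_filter; exact: cF.
- move=> z; rewrite in_itv /= => /andP[xz _].
  by rewrite derive1E; have [_ ->] := DF (lt_trans x0 xz).
Qed.

Context {d : measure_display} {T : measurableType d} {P : probability T R}.
Variable G : {RV P >-> R}.
Hypothesis lawG : forall A : set R, measurable A -> distribution P G A = centered_gamma n.+1%:R A.

Let c (z : R) := fine (cdf G z).

Let cdf_fin z : cdf G z = (c z)%:E.
Proof. by rewrite /c fineK// fin_num_measure. Qed.

Let cdf_low (z : R) : z <= - n.+1%:R -> c z = 0.
Proof.
move=> zn; rewrite /c /cdf lawG; last exact: measurable_itv.
rewrite /centered_gamma /gamma_law integral0_eq// => x /=; rewrite in_itv /= => xz.
by rewrite /gamma_pdf indicE memNset ?mulr0//= in_itv /= andbT; apply/negP; rewrite -leNgt; lra.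
Qed.

Let cdf_itv (t z : R) : - n.+1%:R < t -> t < z ->
  c z - k * W (Num.sqrt (z + n.+1%:R)) = c t - k * W (Num.sqrt (t + n.+1%:R)).
Proof.
move=> nt tz.
have E : cdf G z = (cdf G t + distribution P G `]t, z])%E.
  rewrite /cdf -measureU//.
    by rewrite -itv_bndbnd_setU// bnd_simp ltW.
  apply/seteqP; split => // x /=; rewrite !in_itv /= => -[xt /andP[tx _]].
  by move: tx; rewrite ltNge xt.
have D : distribution P G `]t, z] = (k * W (Num.sqrt (z + n.+1%:R)) - k * W (Num.sqrt (t + n.+1%:R)))%:E.
  rewrite lawG; last exact: measurable_itv.
  rewrite /centered_gamma.
  have -> : (fun x : R => 2 * x - n.+1%:R) @^-1` `]t, z] = `](t + n.+1%:R) / 2, (z + n.+1%:R) / 2]%classic.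
    by apply/seteqP; split => x /=; rewrite !in_itv /= => /andP[? ?]; apply/andP; split; lra.
  rewrite gamma_law_itv; [|lra..].
  by rewrite ![2 * _]mulrC !divfK.
have : (c z)%:E = (c t + (k * W (Num.sqrt (z + n.+1%:R)) - k * W (Num.sqrt (t + n.+1%:R))))%:E.
  by rewrite EFinD -!cdf_fin -D.
by move=> H; rewrite (EFin_inj H) addrCA addrAC subrr add0r.
Qed.

(** On [z > - nu] the difference of the two sides is constant by [cdf_itv]; right continuity at
    [- nu], where both sides vanish, identifies the constant. *)
Let cdf_scale (z : R) : c z = k * W (Num.sqrt (z + n.+1%:R)).
Proof.
have [zn|nz] := leP z (- n.+1%:R).
  by rewrite cdf_low// ler0_sqrtr ?/W ?/gamma_mass ?gamma_primitive0 ?mulr0//; lra.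
apply/eqP; rewrite -subr_eq0; apply/eqP.
pose g (t : R) := c t - k * W (Num.sqrt (t + n.+1%:R)).
have lim0 : g t @[t --> (- n.+1%:R : R)^'+] --> g (- n.+1%:R).
  apply: cvgB.
    by apply: fine_cvg; rewrite -cdf_fin; exact: cdf_right_continuous.
  apply: cvgM; first exact: cvg_cst.
  apply: cvg_at_right_filter.
  apply: (continuous_comp (f := fun t : R => Num.sqrt (t + n.+1%:R)) (g := W)); last exact: cW.
  apply: (continuous_comp (f := fun t : R => t + n.+1%:R) (g := Num.sqrt)).
    by apply: cvgD; [exact: cvg_id|exact: cvg_cst].
  exact: sqrt_continuous.
have g0 : g (- n.+1%:R) = 0.
  by rewrite /g cdf_low// addNr sqrtr0 /W /gamma_mass gamma_primitive0 mulr0 subrr.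
rewrite g0 in lim0.
apply: (cvg_unique _ _ lim0) => //.
apply: cvg_near_cst; near=> t.
rewrite -/(g z) /g; apply/esym/cdf_itv; near: t; first exact: nbhs_right_gt.
exact: nbhs_right_lt.
Unshelve. all: by end_near. Qed.

(** The law of [G] has total mass 1: the limit of its distribution function at infinity gives
    [k Z >= 1], and the bound by 1 gives the converse. [Gamma_fun] is never evaluated. *)
Let scaleE : k = Z^-1.
Proof.
have Z0 : 0 < Z := gamma_total_gt0 n.
have c1 (z : R) : c z <= 1 by rewrite -lee_fin -cdf_fin; exact: cdf_le1.
have kZ : 1 <= k * Z.
  have : cdf G r @[r --> +oo] --> 1%E by exact: cvg_cdfy1.
  move=> /fine_cvgP[_] cv.
  apply: (cvgr_to_le cv); apply: nearW => z /=.
  rewrite -/(c z) cdf_scale ler_wpM2l ?gamma_scale_ge0//.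
  by apply: gamma_mass_le_total; exact: sqrtr_ge0.
have k0 : 0 < k by rewrite -(pmulr_lgt0 _ Z0); exact: lt_le_trans kZ.
apply: (mulIf (lt0r_neq0 Z0)); rewrite mulVf ?gt_eqF//; apply/eqP; rewrite eq_le kZ andbT.
rewrite mulrC -ler_pdivlMr// div1r; apply: gamma_total_le => r r0.
rewrite -div1r ler_pdivlMr// mulrC.
have := c1 (r ^+ 2 - n.+1%:R); rewrite cdf_scale subrK sqrtr_sqr ger0_norm//.
Qed.

Lemma cdf_centered_gamma (z : R) : cdf G z = (W (Num.sqrt (z + n.+1%:R)) / Z)%:E.
Proof. by rewrite cdf_fin cdf_scale scaleE mulrC. Qed.

End gamma_cdf.

(** * Modulus of continuity of the Gamma distribution function *)

Section gamma_modulus.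
Context {R : realType}.

(** [Num.sqrt y ^+ 2] is the positive part of [y], a 1-Lipschitz function. *)
Lemma sqr_sqrt_lip (y dlt : R) : 0 <= dlt ->
  Num.sqrt (y + dlt) ^+ 2 - Num.sqrt y ^+ 2 <= dlt.
Proof.
move=> d0; have [y0|y0] := leP 0 y.
  by rewrite !sqr_sqrtr ?addr_ge0//; lra.
rewrite (ler0_sqrtr (ltW y0)) expr0n subr0 /=.
have [yd|yd] := leP 0 (y + dlt); first by rewrite sqr_sqrtr//; lra.
by rewrite (ler0_sqrtr (ltW yd)) expr0n.
Qed.

Lemma sqrt_holder (y dlt : R) : 0 <= dlt -> Num.sqrt (y + dlt) - Num.sqrt y <= Num.sqrt dlt.
Proof.
move=> d0; have := sqr_sqrt_lip y d0.
have := sqr_sqrtr d0; have := sqrtr_ge0 dlt.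
have : Num.sqrt y <= Num.sqrt (y + dlt) by rewrite ler_wsqrtr// lerDl.
move: (sqrtr_ge0 y); move: (Num.sqrt y) (Num.sqrt (y + dlt)) (Num.sqrt dlt) => p q s p0 pq s0 sE h.
have [//|hs] := leP (q - p) s.
suff : s ^+ 2 < q ^+ 2 - p ^+ 2 by lra.
have -> : q ^+ 2 - p ^+ 2 = (q - p) ^+ 2 + 2 * (p * (q - p)) by ring.
have : s ^+ 2 < (q - p) ^+ 2 by rewrite ltrXn2r ?nnegrE//; lra.
have : 0 <= p * (q - p) by apply: mulr_ge0; lra.
lra.
Qed.

Lemma gamma_weight_bounded n : exists2 M : R, 0 < M & forall r, 0 <= r -> gamma_weight n r <= M.
Proof.
have k0 : (0 : R) <= 2 ^+ n * n`!%:R by rewrite mulr_ge0// exprn_ge0.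
exists (1 + 2 ^+ n * n`!%:R) => [|r r0]; first by rewrite ltr_pwDl.
have E1 : expR (- (r ^+ 2 / 2)) <= 1.
  by rewrite -expR0 ler_expR oppr_le0 divr_ge0// sqr_ge0.
have pw : r ^+ n <= 1 + (r ^+ 2) ^+ n.
  have [r1|r1] := leP r 1.
    by rewrite (le_trans (exprn_ile1 _ r0 r1))// lerDl exprn_ge0// sqr_ge0.
  rewrite -exprM (le_trans (ler_weXn2l (ltW r1) (_ : n <= 2 * n)%N)) ?lerDr//.
  by rewrite leq_pmull.
have h : (r ^+ 2) ^+ n <= 2 ^+ n * n`!%:R * expR (r ^+ 2 / 2).
  have := pow_le_expR n (_ : 0 <= r ^+ 2 / 2); rewrite divr_ge0 ?sqr_ge0// => /(_ isT).
  by rewrite expr_div_n ler_pdivrMr ?exprn_gt0// mulrC mulrA.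
rewrite /gamma_weight.
apply: (le_trans (ler_wpM2r (expR_ge0 _) pw)); rewrite mulrDl mul1r lerD//.
apply: (le_trans (ler_wpM2r (expR_ge0 _) h)).
by rewrite expRN mulfK// gt_eqF// expR_gt0.
Qed.

(** As [nu = n + 1], the test singles out [nu = 1], where the density has an inverse square root
    singularity at the origin. *)
Definition gamma_modulus n (dlt : R) : R := if (0 < n)%N then dlt else Num.sqrt dlt.

Let lerB_swap (p q p' q' : R) : p - q <= p' - q' -> q' - q <= p' - p.
Proof. by move=> ?; lra. Qed.

(** For [n = 0] the weight is at most 1, so the mass is Lipschitz in [r] and Hoelder of exponent
    [1 / 2] in [r^2]. Otherwise the weight is at most [M r], so [M r^2 / 2] minus the mass is
    nondecreasing and the mass is Lipschitz in [r^2]. *)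
Lemma gamma_mass_modulus n : exists2 K : R, 0 < K & forall y dlt, 0 <= dlt ->
  gamma_mass n (Num.sqrt (y + dlt)) - gamma_mass n (Num.sqrt y) <= K * gamma_modulus n dlt.
Proof.
have sle (y dlt : R) : 0 <= dlt -> Num.sqrt y <= Num.sqrt (y + dlt) by move=> ?; rewrite ler_wsqrtr// lerDl.
case: n => [|n].
  exists 1 => // y dlt d0; rewrite mul1r /gamma_modulus /=.
  apply: (le_trans _ (sqrt_holder y d0)).
  have D (x : R) : is_derive x 1 (fun x => x - gamma_mass 0 x) (1 - gamma_weight 0 x).
    by have := gamma_mass_derive 0 x => ?; apply: is_deriveB.
  have := le_of_derive D (sle y _ d0) => H.
  apply: lerB_swap; apply: H => x _; rewrite /gamma_weight expr0 mul1r subr_ge0 -expR0 ler_expR oppr_le0.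
  by rewrite divr_ge0// sqr_ge0.
have [M M0 wM] := gamma_weight_bounded n.
exists (M / 2) => [|y dlt d0]; first by rewrite divr_gt0.
rewrite /gamma_modulus /=.
apply: (le_trans _ (ler_wpM2l _ (sqr_sqrt_lip y d0))); last by rewrite divr_ge0// ltW.
have D (x : R) : is_derive x 1 (fun x => M / 2 * x ^+ 2 - gamma_mass n.+1 x) (M * x - gamma_weight n.+1 x).
  have := gamma_mass_derive n.+1 x => ?.
  by apply: is_derive_eq; rewrite /GRing.scale /=; field.
have := le_of_derive D (sle y _ d0) => H.
rewrite mulrBr; apply: lerB_swap; apply: H => x /andP[yx _]; have x0 : 0 <= x by rewrite (le_trans (sqrtr_ge0 y))// ltW.
rewrite subr_ge0 mulrC (_ : gamma_weight n.+1 x = x * gamma_weight n x); last by rewrite /gamma_weight exprS mulrA.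
by rewrite ler_wpM2l// wM.
Qed.

End gamma_modulus.

(** * The Kolmogorov distance *)

Section stein_bound.
Context {R : realType} (n : nat).
Context {d : measure_display} {T : measurableType d} {P : probability T R}.
Variables F G : {RV P >-> R}.
Hypotheses (F2 : L2 P F) (G2 : L2 P G).
Hypothesis ibpFG : forall (g g1 g2 : R -> R) (M1 M2 : R),
  (forall t : R, is_derive t 1 g (g1 t)) -> (forall t : R, is_derive t 1 g1 (g2 t)) ->
  continuous g2 -> (forall t, `|g1 t| <= M1) -> (forall t, `|g2 t| <= M2) ->
  Ex P (fun w => F w * g (F w)) = Ex P (fun w => g1 (F w) * G w).

Definition stein_constant : R := 31 * expR (n.+2%:R / 2).

(** When [E F = 0] and [E G = 2 nu], as in the application, this is the standard deviation of
    [G - 2 F]. *)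
Definition stein_discrepancy : R :=
  Num.sqrt (Ex P (fun w => (G w - 2 * F w - 2 * n.+1%:R) ^+ 2)).

Let nu : R := n.+1%:R.
Let S := stein_constant.
Let sg := stein_discrepancy.

Let D2 : L2 P (fun w => G w - 2 * F w - 2 * nu).
Proof. by apply: L2B; [apply: L2B => //; exact: L2Z|exact: L2_cst]. Qed.

Let Ex_absD : Ex P (fun w => `|G w - 2 * F w - 2 * nu|) <= sg.
Proof.
have := cauchy_schwarz_abs D2 (L2_cst P 1).
rewrite (_ : (fun w => _ * `|1|) = fun w => `|G w - 2 * F w - 2 * nu|); last first.
  by apply/funext => w; rewrite normr1 mulr1.
by rewrite (_ : Ex P (fun=> 1 ^+ 2) = 1) ?sqrtr1 ?mulr1// expr1n Ex_cst.
Qed.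

Let sandwich (x y c E s : R) : x <= c -> c <= y -> `|E - c| <= s -> x - s <= E /\ E <= y + s.
Proof. by rewrite ler_norml => ? ? /andP[? ?]; split; lra. Qed.

Lemma smoothed_probability_bound (a e : R) : 0 < e -> e <= 1 -> exists h : R -> R,
  [/\ intg P (fun w => h (F w + nu)) /\ (forall t : R, 0 <= h t <= 1),
      (forall t : R, t <= a -> h t = 1), (forall t : R, a + e <= t -> h t = 0),
      gamma_mass n (Num.sqrt a) / gamma_total n - S / e * sg <= Ex P (fun w => h (F w + nu)) &
      Ex P (fun w => h (F w + nu)) <= gamma_mass n (Num.sqrt (a + e)) / gamma_total n + S / e * sg].
Proof.
move=> e0 e1.
have [h [h1 [h2 [[Dh Dh1 ch2] [h01 bh1 bh2] ha hae]]]] := smooth_step a e0.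
have cge := stein_center_ge n e0 Dh Dh1 h01 bh1 ha.
have cle := stein_center_le n a Dh Dh1 h01 bh1.
have [f [f1 [f2 [Df Df1 cf2 [bf1 [M bf2]] feq]]]] :=
  stein_solution_exists n e0 Dh Dh1 ch2 h01 bh1 bh2 ha hae e1.
move: (stein_center n a e h) cge cle feq => c cge cle feq.
have ch : continuous h := is_derive_continuous (df := h1) Dh.
have Dsh (t : R) : is_derive t 1 (fun t : R => t + nu) 1.
  by apply: is_derive_eq; rewrite addr0.
have Dg (u u1 : R -> R) : (forall t : R, is_derive t 1 u (u1 t)) ->
    forall t : R, is_derive t 1 (fun t => u (t + nu)) (u1 (t + nu)).
  move=> Du t; have := @is_derive1_comp _ u (fun t : R => t + nu) t _ _ (Du _) (Dsh t).
  by rewrite mulr1.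
have csh : continuous (fun t : R => t + nu) := is_derive_continuous (df := fun=> 1) Dsh.
have cshift (u : R -> R) : continuous u -> continuous (fun t => u (t + nu)).
  move=> cu t; apply: (continuous_comp (f := fun t : R => t + nu) (g := u)); [exact: csh|exact: cu].
have I := ibpFG (Dg _ _ Df) (Dg _ _ Df1) (cshift _ cf2)
  (fun t => bf1 (t + nu)) (fun t => bf2 (t + nu)).
have cf1 : continuous f1 := is_derive_continuous (df := f2) Df1.
have cf : continuous f := is_derive_continuous (df := f1) Df.
have mF : measurable_fun setT F := F2.1.
have mc (u : R -> R) : continuous u -> measurable_fun setT (fun w => u (F w + nu)).
  move=> cu; apply: (@measurableT_comp _ _ _ _ _ _ (fun t : R => u (t + nu))) => //.
  exact: continuous_measurable_fun (cshift _ cu).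
have K0 : 0 <= S / e by rewrite divr_ge0 ?mulr_ge0 ?expR_ge0 ?ltW.
have bdd (u : R -> R) (K : R) Y : continuous u -> (forall t, `|u t| <= K) -> L2 P Y ->
    intg P (fun w => u (F w + nu) * Y w).
  move=> cu bu Y2; apply: intg_dom (intgZ K (intg_abs (L2_intg Y2))).
    by apply: measurable_funM; [exact: mc|exact: Y2.1].
  by move=> w; rewrite normrM ler_wpM2r.
have bh t : `|h t| <= 1 by have /andP[? ?] := h01 t; rewrite ger0_norm.
have ih : intg P (fun w => h (F w + nu)).
  by have := bdd _ _ _ ch bh (L2_cst P 1); apply: eq_intg => w; rewrite mulr1.
have fL2 : L2 P (fun w => f (F w + nu)).
  apply: (L2_lipschitz (u := fun t => f (t + nu)) (K := S / e)) => //.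
    exact: continuous_measurable_fun (cshift _ cf).
  move=> x y; apply: (lipschitz_of_derive (Dg _ _ Df)) => t; exact: bf1.
(* At [y = F + nu] the equation reads [h - c = 2 (F + nu) f1 - F f], and the integration by parts
   trades [E (F f)] for [E (f1 G)]. *)
have key : Ex P (fun w => h (F w + nu)) - c =
    - Ex P (fun w => f1 (F w + nu) * (G w - 2 * F w - 2 * nu)).
  have i1 : intg P (fun w => F w * f (F w + nu)) by exact: L2_mul.
  have i2 : intg P (fun w => f1 (F w + nu) * G w) by exact: bdd bf1 G2.
  have i3 := bdd _ _ _ cf1 bf1 D2.
  have i4 : intg P (fun w => f1 (F w + nu) * (2 * F w + 2 * nu)).
    by apply: bdd bf1 _ => //; apply: L2D; [exact: L2Z|exact: L2_cst].
  rewrite -[in LHS](Ex_cst P c) -ExB//; last exact: intg_cst.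
  transitivity (Ex P (fun w => f1 (F w + nu) * (2 * F w + 2 * nu) - F w * f (F w + nu))).
    by apply: eq_Ex => w; rewrite -feq -/nu; ring.
  rewrite ExB// I -ExB// -ExN//; apply: eq_Ex => w; ring.
have bound : `|Ex P (fun w => h (F w + nu)) - c| <= S / e * sg.
  rewrite key normrN; have i3 := bdd _ _ _ cf1 bf1 D2.
  have iD := intg_abs (L2_intg D2).
  apply: (le_trans (Ex_abs i3)).
  apply: (le_trans (y := Ex P (fun w => S / e * `|G w - 2 * F w - 2 * nu|))).
    apply: Ex_le; [exact: intg_abs i3|exact: intgZ iD|move=> w].
    by rewrite normrM ler_wpM2r.
  by rewrite ExZ// ler_wpM2l.
by have [? ?] := sandwich cge cle bound; exists h.
Qed.

Let cdf_Ex z : (cdf F z = (Ex P (\1_(F @^-1` `]-oo, z]%classic)))%:E)%E.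
Proof.
have mA : measurable (F @^-1` `]-oo, z]%classic).
  by rewrite -[X in measurable X]setTI; exact: (F2.1 measurableT _ (measurable_itv _)).
rewrite /Ex /Rintegral integral_indic// setIT fineK//.
exact: fin_num_measure.
Qed.

Let sandwich2 (a b c E s t : R) : b - a <= t -> a - c <= t -> E <= b + s -> c - s <= E ->
  `|E - a| <= t + s.
Proof. by move=> *; rewrite ler_norml; apply/andP; split; lra. Qed.

Lemma cdf_gamma_mass_bound (K : R) :
  (forall y dlt : R, 0 <= dlt -> gamma_mass n (Num.sqrt (y + dlt)) - gamma_mass n (Num.sqrt y) <=
     K * gamma_modulus n dlt) ->
  forall z e, 0 < e -> e <= 1 ->
  (`|cdf F z - (gamma_mass n (Num.sqrt (z + nu)) / gamma_total n)%:E| <=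
    (K / gamma_total n * gamma_modulus n e + S / e * sg)%:E)%E.
Proof.
move=> W1 z e e0 e1.
have Z0 := @gamma_total_gt0 R n; set Z := gamma_total n in Z0 *.
set A := F @^-1` `]-oo, z]%classic.
have mA : measurable A.
  by rewrite -[X in measurable X]setTI; exact: (F2.1 measurableT _ (measurable_itv _)).
have iA : intg P \1_A.
  by apply: intg_dom (intg_cst P 1) => // w; rewrite indicE; case: (_ \in _); rewrite ?normr1 ?normr0.
rewrite cdf_Ex -/A -EFinB lee_fin.
(* The step that falls to the right of [z] bounds the indicator from above, the one that falls to
   its left bounds it from below. *)
have [h [[ih h01] h1 _ _ up]] := smoothed_probability_bound (z + nu) e0 e1.
have [h' [[ih' h01'] _ h0' low _]] := smoothed_probability_bound (z + nu - e) e0 e1.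
have hi : Ex P \1_A <= Ex P (fun w => h (F w + nu)).
  apply: Ex_le => // w; rewrite indicE; have [wA|_] := boolP (w \in A); last by have /andP[] := h01 (F w + nu).
  by rewrite h1// lerD2r; move: wA; rewrite inE /A /= in_itv.
have lo : Ex P (fun w => h' (F w + nu)) <= Ex P \1_A.
  apply: Ex_le => // w; rewrite indicE; have [_|wA] := boolP (w \in A); first by have /andP[] := h01' (F w + nu).
  rewrite h0'// subrK lerD2r ltW// ltNge; move: wA; apply: contra => wz.
  by rewrite inE /A /= in_itv.
have Zi : 0 <= Z^-1 by rewrite invr_ge0 ltW.
have w1 := ler_wpM2r Zi (W1 (z + nu) e (ltW e0)).
have w2 := ler_wpM2r Zi (W1 (z + nu - e) e (ltW e0)).
rewrite subrK in w2; rewrite mulrAC mulrBl in w1; rewrite mulrAC mulrBl in w2.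
exact: sandwich2 w1 w2 (le_trans hi up) (le_trans low lo).
Qed.

End stein_bound.

(** * Optimization of the smoothing scale *)

Section rates.
Context {R : realType}.

Lemma eventual_le0 (x K : R) : (forall t, 0 < t -> t <= 1 -> x <= K * t) -> x <= 0.
Proof.
move=> H; rewrite leNgt; apply/negP => x0.
have K0 : 0 < K by have := H 1 ltr01 (lexx 1); rewrite mulr1; exact: lt_le_trans.
pose t := Num.min 1 (x / (2 * K)).
have t0 : 0 < t by rewrite lt_min ltr01 divr_gt0// mulr_gt0.
have tx : t * (2 * K) <= x by rewrite -ler_pdivlMr ?mulr_gt0// ge_min lexx orbT.
have t1 : t <= 1 by rewrite ge_min lexx.
by have := H t t0 t1; nra.
Qed.

(** At [e = t^j] both error terms are multiples of [t]. For [t > 1] the bound [x <= 1] suffices, and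
    for [t = 0] the scale [e] is sent to 0 instead. *)
Lemma optimized_rate (x K S t s : R) (j : nat) (om : R -> R) : 0 <= K -> 0 <= S ->
  (forall t, 0 <= t -> om (t ^+ j) = t) -> 0 <= t -> s = t ^+ j.+1 -> x <= 1 ->
  (forall e, 0 < e -> e <= 1 -> x <= K * om e + S / e * s) -> x <= (K + S + 1) * t.
Proof.
move=> K0 S0 omE t0 sE x1 H.
have [t1|t1] := leP t 1; last by nra.
have [t_0|tn0] := eqVneq t 0.
  rewrite t_0 mulr0; apply: (@eventual_le0 _ K) => u u0 u1.
  have := H (u ^+ j) (exprn_gt0 _ u0) (exprn_ile1 _ (ltW u0) u1).
  by rewrite (omE _ (ltW u0)) sE t_0 expr0n /= mulr0 addr0.
have tp : 0 < t by rewrite lt_def tn0.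
have := H (t ^+ j) (exprn_gt0 _ tp) (exprn_ile1 _ t0 t1).
rewrite omE// sE.
have -> : S / t ^+ j * t ^+ j.+1 = S * t by rewrite exprS; field; exact: expf_neq0.
by move=> ?; lra.
Qed.

Lemma gamma_modulus_pow n (t : R) : 0 <= t ->
  gamma_modulus n (t ^+ (if (0 < n)%N then 1 else 2)) = t.
Proof. by move=> t0; rewrite /gamma_modulus; case: (0 < n)%N; rewrite ?expr1// sqrtr_sqr ger0_norm. Qed.

End rates.

Section variance_L2.
Context {R : realType} {d : measure_display} {T : measurableType d} {P : probability T R}.

(** A finite variance is what places [Gamma_1(F) - 2 F], hence [Gamma_1(F)], in L^2. *)
Lemma variance_fin_L2 (D : T -> R) (v : R) : measurable_fun setT D -> ('V_P[D] = v%:E)%E ->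
  L2 P D /\ v = Ex P (fun w => (D w - Ex P D) ^+ 2).
Proof.
move=> mD VE.
pose c := Ex P D.
have E : ('V_P[D] = \int[P]_w ((D w - c) ^+ 2)%:E)%E.
  by rewrite /variance unlock /= unlock; exact: eq_integral.
have mDc : measurable_fun setT (fun w => D w - c) by exact: measurable_funB.
have Dc2 : L2 P (fun w => D w - c).
  split => //; apply/integrableP; split; first exact/measurable_EFinP/measurable_funX.
  rewrite (eq_integral (fun w => ((D w - c) ^+ 2)%:E)); last first.
    by move=> w _; rewrite /= ger0_norm ?sqr_ge0.
  by rewrite -E VE ltry.
split.
  apply: (@eq_L2 _ _ _ _ (fun w => (D w - c) + c)) => [w|]; first by rewrite subrK.
  by apply: L2D; [exact: Dc2|exact: L2_cst].
by rewrite /Ex /Rintegral -E VE.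
Qed.

End variance_L2.

Theorem theorem6p6 (R : realType) (nu : nat) (nu_gt0 : (0 < nu)%N) :
  exists2 C : R, 0 < C &
  forall (H : completeNormedModType R) (dot : {dot H for idfun})
    (d : measure_display) (T : measurableType d) (P : probability T R)
    (X : H -> {RV P >-> R}) (F Gamma1F : {RV P >-> R})
    (d' : measure_display) (T' : measurableType d') (P' : probability T' R)
    (G : {RV P' >-> R}),
  separable_hilbert dot ->
  isonormal dot X ->
  finite_chaos_expansion dot X F ->
  ('E_P[F] = 0)%E ->
  ('E_P[fun w => (F w ^+ 2)%R] = (2 * nu%:R)%:E)%E ->
  Gamma1 dot X F Gamma1F ->
  (forall A : set R, measurable A ->
     distribution P' G A = centered_gamma nu%:R A) ->
  (kolmogorov_dist F G <=
    if (2 <= nu)%N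
    then C%:E * 'V_P[(fun w => Gamma1F w - 2 * F w)%R] `^ (1 / 4)
    else C%:E * 'V_P[(fun w => Gamma1F w - 2 * F w)%R] `^ (1 / 6))%E.
Proof.
(* From here [nu = n + 1], and [n] is the exponent in [gamma_weight]. *)
case: nu nu_gt0 => // n _.
have [K1 K10 modK] := @gamma_mass_modulus R n.
have Z0 := @gamma_total_gt0 R n.
have K0 : 0 <= K1 / gamma_total n by rewrite divr_ge0// ltW.
have S0 : 0 <= stein_constant n :> R by rewrite mulr_ge0// expR_ge0.
exists (K1 / gamma_total n + stein_constant n + 1); first by rewrite ltr_wpDl// addr_ge0.
set C := K1 / _ + _ + 1.
move=> H dot d T P X F Gm d' T' P' G sepH isoX _ EF EF2 GmF lawG.
set D := fun w => Gm w - 2 * F w.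
have mF : measurable_fun setT F by exact: measurable_funPT.
have mGm : measurable_fun setT Gm by exact: measurable_funPT.
have mD : measurable_fun setT D by apply: measurable_funB => //; exact: measurable_funM.
have C0 : 0 < C by rewrite ltr_wpDl// addr_ge0.
(* If the variance is infinite, so is the right-hand side, and the claim is trivial. *)
have := variance_ge0 P D; case VE : ('V_P[D]%E) => [v| |] // v0; last first.
  by rewrite !poweRyr ?mul1r ?invr_eq0 ?pnatr_eq0// gt0_muley ?lte_fin// if_same leey.
rewrite lee_fin in v0.
have [D2 vE] := variance_fin_L2 mD VE.
have [_ [DF [_ [_ mvF _ _]]]] := GmF.
have [F2 _ _] := malliavin_approx sepH isoX mvF.
have G2 : L2 P Gm.
  by apply: (@eq_L2 _ _ _ _ (fun w => D w + 2 * F w)) => [w|]; [rewrite subrK|apply: L2D => //; exact: L2Z].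
have ibp := fun g g1 g2 M1 M2 Dg Dg1 cg2 bg1 bg2 =>
  @malliavin_ibp R H dot sepH d T P X isoX g g1 g2 M1 M2 Dg Dg1 cg2 bg1 bg2 F Gm EF GmF G2.
have ExF : Ex P F = 0 by move: EF; rewrite unlock /Ex /Rintegral => ->.
have ExF2 : Ex P (fun w => F w * F w) = 2 * n.+1%:R.
  by move: EF2; rewrite unlock /Ex /Rintegral => ->.
(* The mean [2 nu] of [Gamma_1(F)] makes the discrepancy of the Stein bound equal to the standard
   deviation of [D]. *)
have ExG : Ex P Gm = 2 * n.+1%:R.
  rewrite -ExF2.
  have D0 (t : R) : is_derive t 1 (fun _ : R => (1 : R)) 0 by exact: is_derive_cst.
  rewrite (@ibp id (fun=> 1) (fun=> 0) 1 0)//.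
  - by apply: eq_Ex => w; rewrite mul1r.
  - by move=> t; exact: cvg_cst.
  - by move=> t; rewrite normr1.
  - by move=> t; rewrite normr0.
have ExD : Ex P D = 2 * n.+1%:R.
  rewrite /D ExB ?ExZ ?ExF ?mulr0 ?subr0//; [exact: L2_intg|exact: L2_intg|apply: intgZ; exact: L2_intg].
have sgE : Num.sqrt v = stein_discrepancy n F Gm by rewrite vE ExD.
have bd := @cdf_gamma_mass_bound R n d T P F Gm F2 G2 ibp K1 modK.
apply: ge_ereal_sup => _ [z _ <-].
rewrite (cdf_centered_gamma lawG).
have cF : cdf F z = (fine (cdf F z))%:E by rewrite fineK// fin_num_measure.
set x := `|fine (cdf F z) - gamma_mass n (Num.sqrt (z + n.+1%:R)) / gamma_total n|.
have xE : (`|cdf F z - (gamma_mass n (Num.sqrt (z + n.+1%:R)) / gamma_total n)%:E| = x%:E)%E.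
  by rewrite cF -EFinB.
have x1 : x <= 1.
  have := cdf_le1 F z; have := cdf_le1 G z; have := cdf_ge0 F z; have := cdf_ge0 G z.
  rewrite (cdf_centered_gamma lawG) cF !lee_fin /x ler_norml.
  move: (fine _) (_ / _) => p q ? ? ? ?; apply/andP; split; lra.
have xb e : 0 < e -> e <= 1 -> x <= K1 / gamma_total n * gamma_modulus n e +
     stein_constant n / e * Num.sqrt v.
  by move=> e0 e1; rewrite sgE -lee_fin -xE; exact: bd.
rewrite xE !poweR_EFin -!EFinM.
have rate := optimized_rate K0 S0 (@gamma_modulus_pow R n) (powR_ge0 _ _) _ x1 xb.
(* The standard deviation is [t^2] for [t = v^(1/4)] and [t^3] for [t = v^(1/6)], matching [j = 1]
   and [j = 2] in [optimized_rate]. *)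
have powE (k : nat) (r : R) : r * k%:R = 2^-1 -> Num.sqrt v = (v `^ r) ^+ k.
  by move=> rk; rewrite -powR_mulrn ?powR_ge0// -powRrM rk powR12_sqrt.
move: rate; case: ifP => n0 rate; rewrite ?lee_fin.
  by rewrite (_ : (1 < n.+1)%N) // lee_fin; apply: rate; apply: powE; field.
by rewrite ltnS n0 lee_fin; apply: rate; apply: powE; field.
Qed.
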